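(* In the setting given in the context, let $U_{\tilde\vartheta_{\mathrm{plt}}}(\theta;x,y)\in\mathbb{R}^d$ be an estimating function satisfying $\mathbb{E}\{\delta U_{\tilde\vartheta_{\mathrm{plt}}}(\theta;x,y)\mid x,\tilde\vartheta_{\mathrm{plt}}\}=0$ (for each $\theta$, the expectation being under parameter $\theta$), and let $\hat\theta_{u,\tilde\vartheta_{\mathrm{plt}}}$ be the estimator obtained by solving $\sum_{i=1}^N\delta_iU_{\tilde\vartheta_{\mathrm{plt}}}(\theta;x_i,y_i)=0$ in $\theta$. Assume that the partial derivatives of $\mathbb{E}\{\delta U_{\tilde\vartheta_{\mathrm{plt}}}(\theta;x,y)\mid x,\tilde\vartheta_{\mathrm{plt}}\}$ with respect to $\theta$ can be passed under the integration sign, and that the regularity conditions for the following standard asymptotic expansion hold: $$\hat\theta_{u,\tilde\vartheta_{\mathrm{plt}}}=\theta-n^{-1}M_{\theta,\vartheta_p}^{-1}\sum_{i=1}^N\delta_iU_{\tilde\vartheta_{\mathrm{plt}}}(\theta;x_i,y_i)+o_P(n^{-1/2}),$$ where, with $\dot U_\vartheta(\theta;x,y)=\partial U_\vartheta(\theta;x,y)/\partial\theta^{\mathrm T}$, the matrices $M_{N,\theta,\vartheta}=n^{-1}N\,\mathbb{E}\{\delta\dot U_\vartheta(\theta;x,y)\}$ and $V_{N,\theta,\vartheta}=n^{-1}N\,\mathbb{E}\{\delta U_\vartheta(\theta;x,y)^{\otimes2}\}$ are assumed to be continuous in $\vartheta$ and to converge to finite and full rank matrices $M_{\theta,\vartheta}$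 and $V_{\theta,\vartheta}$, respectively. Assume also that the matrix $\Sigma_{N,\theta,\vartheta}$ in the context satisfies, as $n,N\to\infty$, for $\vartheta$ in a neighborhood of $\vartheta_p$, $\Sigma_{N,\theta,\vartheta}\to\Sigma_{\theta,\vartheta}$, where $\Sigma_{N,\theta,\vartheta}$ and $\Sigma_{\theta,\vartheta}$ are finite, positive definite, and continuous with respect to $\vartheta$. Then the asymptotic variance-covariance matrix of $\hat\theta_{u,\tilde\vartheta_{\mathrm{plt}}}$ (multiplied by $n$; that is, the covariance matrix of the limiting distribution of $\sqrt n(\hat\theta_{u,\tilde\vartheta_{\mathrm{plt}}}-\theta)$) is $M_{\theta,\vartheta_p}^{-1}V_{\theta,\vartheta_p}(M_{\theta,\vartheta_p}^{-1})^{\mathrm T}$, and it satisfies $$M_{\theta,\vartheta_p}^{-1}V_{\theta,\vartheta_p}(M_{\theta,\vartheta_p}^{-1})^{\mathrm T}\ \ge\ \Sigma_{\theta,\vartheta_p}^{-1}$$ in the Loewner ordering, where equality holds if $U_{\tilde\vartheta_{\mathrm{plt}}}(\theta;x,y)$ is asymptotically a linear function of $\dot\ell_S(\theta;x,y\mid\tilde\vartheta_{\mathrm{plt}})$ in the sense that $$n^{-1}N\,\mathbb{E}\big(\delta\|T_{N\tilde\vartheta_{\mathrm{plt}}}\|^2\mid\tilde\vartheta_{\mathrm{plt}}\big)=o_P(1),\qquad T_{N\tilde\vartheta_{\mathrm{plt}}}=U_{\tilde\vartheta_{\mathrm{plt}}}(\theta;x,y)+M_{\theta,\vartheta_p}\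Sigma_{\theta,\vartheta_p}^{-1}\dot\ell_S(\theta;x,y\mid\tilde\vartheta_{\mathrm{plt}}).$$
   Context: The data $(x_i,y_i)$, $i=1,\dots,N$, are independent realizations of $(x,y)$ with joint density $f(y\mid x;\theta)f_X(x)$ for a true parameter $\theta\in\Theta\subset\mathbb{R}^d$, with $f_X$ unspecified; $f(y\mid x;\theta)$ is a density with respect to $\mathrm dy$ (Lebesgue measure for continuous responses, counting measure for discrete ones). $\ell(\theta;x,y)=\log f(y\mid x;\theta)$; $\dot\ell$ is its gradient in $\theta$. $\|A\|=\mathrm{tr}^{1/2}(A^{\mathrm T}A)$ and $A^{\otimes2}=AA^{\mathrm T}$. Subsampling: the subsampling probabilities $\pi_N(x,y;\vartheta)\in(0,1]$ depend on $N$ and on a parameter vector $\vartheta$ (which may equal $\theta$ or contain $\theta$ as components). The number $n=n_N$ denotes the average subsample size, $\mathbb{E}\{\pi_N(x_i,y_i;\vartheta)\}=n/N$, and $n=o(N)$ is allowed. A pilot estimator $\tilde\vartheta_{\mathrm{plt}}$ is independent of the data to be sampled and converges in probability to a limit $\vartheta_p$ (not necessarily the true value). Given the data and $\tilde\vartheta_{\mathrm{plt}}$, the sampling indicators $\delta_i\in\{0,1\}$ are independent Bernoulli with success probabilities $\pi_N(x_i,y_i;\tilde\vartheta_{\mathrm{plt}})$; $(x,y,\delta)$ denotes a generic copy of $(x_i,y_i,\delta_i)$. In expectations indexed by a fixed $\vartheta$ (such as those in $M_{N,\theta,\vartheta}$ and $V_{N,\theta,\vartheta}$), $\delta$ is Bernoulli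 with success probability $\pi_N(x,y;\vartheta)$ given $(x,y)$. Limits are as $n,N\to\infty$. Define $$\Sigma_{N,\theta,\vartheta}=\frac Nn\mathbb{E}\left[\dot\ell(\theta;x,y)^{\otimes2}\pi_N(x,y;\vartheta)-\frac{\big(\mathbb{E}\{\dot\ell(\theta;x,y)\pi_N(x,y;\vartheta)\mid x\}\big)^{\otimes2}}{\mathbb{E}\{\pi_N(x,y;\vartheta)\mid x\}}\right],$$ and the sampled data conditional score function $$\dot\ell_S(\theta;x,y\mid\vartheta)=\dot\ell(\theta;x,y)-\frac{\mathbb{E}\{\dot\ell(\theta;x,y)\pi_N(x,y;\vartheta)\mid x\}}{\mathbb{E}\{\pi_N(x,y;\vartheta)\mid x\}}.$$
   Formalization: Proved with added conditions: for the asymptotic covariance, V_N converges uniformly near ϑ_p and a Lindeberg condition on δU given the pilot holds; for the equality case, V_N and Σ_N converge uniformly near ϑ_p. Without these the two claims can fail; the inequality needs neither. *)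

(* Defs.v *)
From HB Require Import structures.
From mathcomp Require Import all_boot all_order all_algebra.
From mathcomp Require Import all_classical all_reals all_analysis.

Set Implicit Arguments.
Unset Strict Implicit.
Unset Printing Implicit Defensive.
Import Order.TTheory GRing.Theory Num.Theory.
Import numFieldNormedType.Exports.

Local Open Scope classical_set_scope.
Local Open Scope ring_scope.

Definition borel (R : realType) (q : nat) :=
  g_sigma_algebraType (@open 'cV[R]_q).

Section linear_algebra.
Context {R : realType}.

Definition frob m p (A : 'M[R]_(m, p)) : R := Num.sqrt (\tr (A^T *m A)).

Definition outer d (a : 'cV[R]_d) : 'M[R]_d := a *m a^T.

Definition posdef d (A : 'M[R]_d) : Prop :=
  A^T = A /\ forall v : 'cV[R]_d, v != 0 -> 0 < (v^T *m A *m v) 0 0.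

Definition possemidef d (A : 'M[R]_d) : Prop :=
  A^T = A /\ forall v : 'cV[R]_d, 0 <= (v^T *m A *m v) 0 0.

Definition loewner_ge d (A B : 'M[R]_d) : Prop := possemidef (A - B).

Definition grad d (g : 'cV[R]_d -> R) (t : 'cV[R]_d) : 'cV[R]_d :=
  \col_k 'D_(delta_mx k 0) g t.

(* the matrix dG/dt^T: row j is the transposed gradient of the j-th
   coordinate of G *)
Definition jac d (G : 'cV[R]_d -> 'cV[R]_d) (t : 'cV[R]_d) : 'M[R]_d :=
  \matrix_(j, k) 'D_(delta_mx k 0) (fun s => G s j 0) t.

End linear_algebra.

Section convergence.
Context {R : realType} {dO : measure_display} {Om : measurableType dO}.
Variable P : probability Om R.

Definition oP1 (Z : nat -> Om -> R) : Prop :=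
  forall eps : R, 0 < eps ->
    (fun N => P [set w | eps < `|Z N w|]) @ \oo --> 0%E.

Definition cvg_dist d (Z : nat -> Om -> 'cV[R]_d)
    dT (T : measurableType dT) (Q : probability T R) (W : T -> 'cV[R]_d) :=
  forall g : 'cV[R]_d -> R,
    continuous g -> (exists K : R, forall z, `|g z| <= K) ->
    'E_P[g \o Z N]%E @[N --> \oo] --> 'E_Q[g \o W]%E.

Definition asymptotic_covariance d (Z : nat -> Om -> 'cV[R]_d)
    (S : 'M[R]_d) : Prop :=
  exists (dT : measure_display) (T : measurableType dT)
      (Q : probability T R) (W : T -> 'cV[R]_d),
    [/\ forall i, (fun t => W t i 0) \in Lfun Q 2%:E,
        cvg_dist Z Q W &
        forall i j, covariance Q (fun t => W t i 0) (fun t => W t j 0)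
                    = (S i j)%:E].

End convergence.

(* [PX] is the law of the covariate, [mu] the measure dy dominating the
   response, [f theta x y] the density f(y | x; theta), [pi N vt x y] the
   subsampling probability, [n N] the average subsample size. *)
Section model.
Context {R : realType} {dX dY : measure_display}
  {X : measurableType dX} {Y : measurableType dY}.
Variables (PX : probability X R) (mu : {sigma_finite_measure set Y -> \bar R}).
Context {d q : nat}.
Variables (f : 'cV[R]_d -> X -> Y -> R) (pi : nat -> 'cV[R]_q -> X -> Y -> R).
Variable n : nat -> R.

Definition is_conditional_density (Theta : set 'cV[R]_d) : Prop :=
  forall theta, Theta theta ->
    [/\ forall x y, 0 <= f theta x y,
        measurable_fun setT (fun z : X * Y => f theta z.1 z.2) &
        forall x, (\int[mu]_y (f theta x y)%:E = 1)%E].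

(* density with respect to dy, given x, of h(x, y, delta) integrated over
   delta ~ Bernoulli(pi_N(x, y; vt)) *)
Definition integrand N theta vt (h : X -> Y -> bool -> R) x y : R :=
  (pi N vt x y * h x y true + (1 - pi N vt x y) * h x y false) * f theta x y.

(* E {h(x, y, delta)} and E {h(x, y, delta) | x} under theta, with delta drawn
   with the fixed vt; a function of (x, y) alone is an h ignoring its last
   argument *)
Definition Exp N theta vt (h : X -> Y -> bool -> R) : R :=
  \int[(PX \x mu)%E]_z integrand N theta vt h z.1 z.2.

Definition condE N theta vt (h : X -> Y -> bool -> R) (x : X) : R :=
  \int[mu]_y integrand N theta vt h x y.

Definition Emx m p N theta vt (h : X -> Y -> bool -> 'M[R]_(m, p)) :
    'M[R]_(m, p) :=
  \matrix_(i, j) Exp N theta vt (fun x y b => h x y b i j).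

Definition condEmx m p N theta vt (h : X -> Y -> bool -> 'M[R]_(m, p)) x :
    'M[R]_(m, p) :=
  \matrix_(i, j) condE N theta vt (fun x y b => h x y b i j) x.

Definition finite_Emx m p N theta vt (h : X -> Y -> bool -> 'M[R]_(m, p)) :=
  forall i j, (PX \x mu)%E.-integrable setT
    (fun z => (integrand N theta vt (fun x y b => h x y b i j) z.1 z.2)%:E).

Definition score (theta : 'cV[R]_d) x y : 'cV[R]_d :=
  grad (fun t => ln (f t x y)) theta.

Definition mean_piscore N theta vt x : 'cV[R]_d :=
  condEmx N theta vt (fun x y _ => pi N vt x y *: score theta x y) x.

Definition mean_pi N theta vt x : R :=
  condE N theta vt (fun x y _ => pi N vt x y) x.

Definition SigmaN N theta vt : 'M[R]_d :=
  (N%:R / n N) *: Emx N theta vt (fun x y _ =>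
    pi N vt x y *: outer (score theta x y)
    - (mean_pi N theta vt x)^-1 *: outer (mean_piscore N theta vt x)).

Definition scoreS N theta vt x y : 'cV[R]_d :=
  score theta x y - (mean_pi N theta vt x)^-1 *: mean_piscore N theta vt x.

(* [U N vt theta x y] is the estimating function; it may depend on N, as the
   constraint E {delta U | x} = 0 involves pi_N *)
Variable U : nat -> 'cV[R]_q -> 'cV[R]_d -> X -> Y -> 'cV[R]_d.

Definition MN N theta vt : 'M[R]_d :=
  (N%:R / n N) *: Emx N theta vt
    (fun x y b => b%:R *: jac (fun t => U N vt t x y) theta).

Definition VN N theta vt : 'M[R]_d :=
  (N%:R / n N) *: Emx N theta vt (fun x y b => b%:R *: outer (U N vt theta x y)).

Definition conditionally_unbiased (Theta : set 'cV[R]_d) : Prop :=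
  forall N vt theta, Theta theta -> \forall x \ae PX, forall j,
    let dU x y (b : bool) := b%:R * U N vt theta x y j 0 in
    mu.-integrable setT (fun y => (integrand N theta vt dU x y)%:E) /\
    condE N theta vt dU x = 0.

Definition diff_under_integral N theta vt : Prop :=
  \forall x \ae PX, forall j k : 'I_d,
    let e := delta_mx k 0 : 'cV[R]_d in
    let dU t x y (b : bool) := b%:R * U N vt t x y j 0 in
    let ddensity y := 'D_e (fun t => integrand N t vt (dU t) x y) theta in
    [/\ derivable (fun t => condE N t vt (dU t) x) theta e,
        mu.-integrable setT (fun y => (ddensity y)%:E) &
        'D_e (fun t => condE N t vt (dU t) x) theta = \int[mu]_y ddensity y].

Definition TN (M Sigma : 'M[R]_d) N theta vt x y : 'cV[R]_d :=
  U N vt theta x y + M *m invmx Sigma *m scoreS N theta vt x y.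

Definition mean_sq_TN (M Sigma : 'M[R]_d) N theta vt : R :=
  N%:R / n N * Exp N theta vt
    (fun x y b => b%:R * frob (TN M Sigma N theta vt x y) ^+ 2).

Definition lindeberg_tail (eps : R) N theta vt : R :=
  N%:R / n N * Exp N theta vt (fun x y b =>
    b%:R * (if eps * Num.sqrt (n N) < frob (U N vt theta x y)
            then frob (U N vt theta x y) ^+ 2 else 0)).

Context {dO : measure_display} {Om : measurableType dO}.
Variable P : probability Om R.
Variables (xs : nat -> Om -> X) (ys : nat -> Om -> Y).
Variables (delta : nat -> nat -> Om -> bool) (pilot : nat -> Om -> borel R q).

Definition data_event N (C : 'I_N -> set (X * Y)) : set Om :=
  [set w | forall i : 'I_N, C i (xs i w, ys i w)].

(* the first N pairs are independent with joint law f(y | x; theta) dy PX(dx) *)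
Definition iid_sample theta : Prop :=
  forall N (C : 'I_N -> set (X * Y)), (forall i, measurable (C i)) ->
    P (data_event C)
    = (\prod_(i < N) \int[(PX \x mu)%E]_(z in C i) (f theta z.1 z.2)%:E)%E.

Definition pilot_independent : Prop :=
  forall N (A : set (borel R q)) (C : 'I_N -> set (X * Y)),
    measurable A -> (forall i, measurable (C i)) ->
    P (pilot N @^-1` A `&` data_event C)
    = (P (pilot N @^-1` A) * P (data_event C))%E.

(* conditional law of the indicators given the data and the pilot, tested on
   the pi-system of rectangles generating the conditioning sigma-algebra *)
Definition bernoulli_subsampling : Prop :=
  forall N (A : set (borel R q)) (C : 'I_N -> set (X * Y)) (b : 'I_N -> bool),
    measurable A -> (forall i, measurable (C i)) ->
    P (pilot N @^-1` A `&` data_event C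
       `&` [set w | forall i : 'I_N, delta N i w = b i])
    = (\int[P]_(w in pilot N @^-1` A `&` data_event C)
        (\prod_(i < N)
           let p := pi N (pilot N w) (xs i w) (ys i w) in
           if b i then p else 1 - p)%R%:E)%E.

Definition sampled_sum N (theta : 'cV[R]_d) w : 'cV[R]_d :=
  \sum_(i < N) (delta N i w)%:R *: U N (pilot N w) theta (xs i w) (ys i w).

End model.

(* Main.v *)
Require Import Defs.
From HB Require Import structures.
From mathcomp Require Import all_boot all_order all_algebra.
From mathcomp Require Import all_classical all_reals all_analysis.
From mathcomp Require Import measurable_realfun zify ring lra.

Set Implicit Arguments.
Unset Strict Implicit.
Unset Printing Implicit Defensive.
Import Order.TTheory GRing.Theory Num.Theory.
Import numFieldNormedType.Exports.

Local Open Scope classical_set_scope.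
Local Open Scope ring_scope.

Section real_integral.
Context {R : realType} {d : measure_display} {T : measurableType d}.
Variable m : {measure set T -> \bar R}.
Implicit Types f g : T -> R.

Definition Rintegrable f := m.-integrable setT (EFin \o f).

Lemma Rintegrable_meas f : Rintegrable f -> measurable_fun setT f.
Proof. by move/(measurable_int m)/measurable_EFinP. Qed.

Lemma eq_Rintegrable f g : f =1 g -> Rintegrable f -> Rintegrable g.
Proof. by move=> /funext ->. Qed.

Lemma RintegrableD f g :
  Rintegrable f -> Rintegrable g -> Rintegrable (fun x => f x + g x).
Proof. by move=> fi gi; have := integrableD measurableT fi gi. Qed.

Lemma RintegrableZ k f : Rintegrable f -> Rintegrable (fun x => k * f x).
Proof. by move=> fi; have := integrableZl measurableT k fi. Qed.

Lemma RintegrableB f g :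
  Rintegrable f -> Rintegrable g -> Rintegrable (fun x => f x - g x).
Proof. by move=> fi gi; have := integrableB measurableT fi gi. Qed.

Lemma Rintegrable_norm f : Rintegrable f -> Rintegrable (fun x => `|f x|).
Proof. exact: integrable_norm. Qed.

Lemma Rintegrable_sum (I : Type) (r : seq I) (P : pred I) (h : I -> T -> R) :
  (forall i, P i -> Rintegrable (h i)) ->
  Rintegrable (fun x => \sum_(i <- r | P i) h i x).
Proof.
move=> hi; have := integrable_sum measurableT r hi.
apply: eq_integrable => // x _ /=.
by rewrite sumEFin.
Qed.

Lemma Rintegrable_le f g : measurable_fun setT f ->
  (forall x, `|f x| <= g x) -> Rintegrable g -> Rintegrable f.
Proof.
move=> mf fg gi; apply: (le_integrable measurableT _ _ gi).
  exact/measurable_EFinP.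
by move=> x _ /=; rewrite lee_fin; exact: le_trans (fg x) (ler_norm _).
Qed.

Lemma RintegralE f : Rintegrable f ->
  (\int[m]_x (f x)%:E)%E = (\int[m]_x f x)%:E.
Proof. by move=> fi; rewrite fineK //; exact: integrable_fin_num. Qed.

Lemma RintegralZ k f : Rintegrable f ->
  \int[m]_x (k * f x) = k * \int[m]_x f x.
Proof. exact: RintegralZl. Qed.

Lemma Rintegral_sum (I : Type) (r : seq I) (P : pred I) (h : I -> T -> R) :
  (forall i, P i -> Rintegrable (h i)) ->
  \int[m]_x (\sum_(i <- r | P i) h i x) = \sum_(i <- r | P i) \int[m]_x h i x.
Proof.
move=> hi; elim: r => [|a r IH].
  rewrite big_nil; under eq_Rintegral do rewrite big_nil.
  by rewrite Rintegral_cst // mul0r.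
rewrite big_cons; under eq_Rintegral do rewrite big_cons.
case: ifPn => Pa //; rewrite -IH RintegralD //; first exact: hi.
exact: Rintegrable_sum.
Qed.

Lemma Rintegral_mono f g : Rintegrable f -> Rintegrable g ->
  (forall x, f x <= g x) -> \int[m]_x f x <= \int[m]_x g x.
Proof. by move=> fi gi fg; apply: le_Rintegral. Qed.

Lemma Rintegrable_nneg f (c : R) : measurable_fun setT f ->
  (forall x, 0 <= f x) -> (\int[m]_x (f x)%:E <= c%:E)%E -> Rintegrable f.
Proof.
move=> mf f0 fc; apply/integrableP; split; first exact/measurable_EFinP.
apply: le_lt_trans (ltry c); apply: le_trans fc; rewrite le_eqVlt.
by apply/orP; left; apply/eqP/eq_integral => x _ /=; rewrite ger0_norm.
Qed.

End real_integral.

Lemma Rintegral_cstT {R : realType} {d} {T : measurableType d}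
    (m : probability T R) (r : R) : \int[m]_x r = r.
Proof. by rewrite /Rintegral integral_cst //= probability_setT mule1. Qed.

Lemma Rintegrable_bounded {R : realType} {d} {T : measurableType d}
    (m : probability T R) (f : T -> R) (K : R) : measurable_fun setT f ->
  (forall x, `|f x| <= K) -> Rintegrable m f.
Proof.
move=> mf fK; apply: (Rintegrable_le mf fK).
exact: finite_measure_integrable_cst.
Qed.

Lemma Rintegral_norm_bounded {R : realType} {d} {T : measurableType d}
    (m : probability T R) (f : T -> R) (K : R) : measurable_fun setT f ->
  (forall x, `|f x| <= K) -> `|\int[m]_x f x| <= K.
Proof.
move=> mf fK; have fi := Rintegrable_bounded m mf fK.
apply: le_trans (le_normr_Rintegral measurableT fi) _.
have <- : \int[m]_(x in setT) K = K.
  by rewrite Rintegral_cst //= (_ : m _ = 1%E) ?probability_setT ?mulr1.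
apply: Rintegral_mono => //; first exact: Rintegrable_norm.
exact: finite_measure_integrable_cst.
Qed.

Section real_fubini.
Context {R : realType} {d1 d2 : measure_display}
  {T1 : measurableType d1} {T2 : measurableType d2}.
Variables (m1 : {sigma_finite_measure set T1 -> \bar R})
  (m2 : {sigma_finite_measure set T2 -> \bar R}).
Implicit Type f : T1 * T2 -> R.

Lemma measurable_Rintegral f : measurable_fun setT f ->
  measurable_fun setT (fun x => \int[m2]_y f (x, y)).
Proof.
move=> mf; rewrite /Rintegral; apply: (measurableT_comp (f := fine)) => //.
under eq_fun do rewrite integralE.
have mfE : measurable_fun setT (EFin \o f) by exact/measurable_EFinP.
apply: emeasurable_funB.
  rewrite [X in measurable_fun _ X](_ : _ = fubini_F m2 (EFin \o f)^\+%E).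
    by apply: measurable_fun_fubini_tonelli_F => //; exact: measurable_funepos.
  by rewrite /fubini_F unlock.
rewrite [X in measurable_fun _ X](_ : _ = fubini_F m2 (EFin \o f)^\-%E).
  by apply: measurable_fun_fubini_tonelli_F => //; exact: measurable_funeneg.
by rewrite /fubini_F unlock.
Qed.

Lemma Rfubini f : Rintegrable (m1 \x m2)%E f ->
  \int[(m1 \x m2)%E]_z f z = \int[m1]_x \int[m2]_y f (x, y).
Proof.
move=> fi; rewrite /Rintegral -integral12_prod_meas1 //; congr fine.
apply: ae_eq_integral => //.
- exact: measurable_fubini_F fi.
- apply/measurable_EFinP; apply: measurable_Rintegral.
  exact: Rintegrable_meas fi.
- apply: filterS (ae_integrable1 fi) => x fx _; rewrite fineK //.
  exact: integrable_fin_num.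
Qed.

Lemma Rintegrable_fubini f : Rintegrable (m1 \x m2)%E f ->
  Rintegrable m1 (fun x => \int[m2]_y f (x, y)).
Proof.
move=> fi; have mf := Rintegrable_meas fi.
apply: (le_integrable measurableT _ _ (integrable_fubini_F fi)).
  by apply/measurable_EFinP; exact: measurable_Rintegral.
move=> x _ /=; rewrite /Rintegral /fubini_F /=.
by case: (\int[m2]_y _)%E => [r||] //=; rewrite ?normr0 // leey.
Qed.

End real_fubini.

Lemma measurable_inv_pos {R : realType} {d} {T : measurableType d} (f : T -> R) :
  measurable_fun setT f -> (forall x, 0 < f x) ->
  measurable_fun setT (fun x => (f x)^-1).
Proof.
move=> mf f0; under eq_fun do rewrite -powR_inv1 ?(ltW (f0 _)) //.
exact: (measurableT_comp (measurable_powR _)).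
Qed.

Section product_parameter.
Context {R : realType} {d1 d2 d3 : measure_display} {T1 : measurableType d1}
  {T2 : measurableType d2} {T3 : measurableType d3}.
Variables (m2 : {sigma_finite_measure set T2 -> \bar R})
  (m3 : {sigma_finite_measure set T3 -> \bar R}).

Lemma measurable_integral_prod (f : T1 * (T2 * T3) -> \bar R) :
  measurable_fun setT f -> (forall t, 0 <= f t)%E ->
  measurable_fun setT (fun x => \int[(m2 \x m3)%E]_z f (x, z))%E.
Proof.
move=> mf f0.
have mx x : measurable_fun setT (fun z => f (x, z)).
  exact: (measurableT_comp mf (pair1_measurable x)).
have E x : (\int[(m2 \x m3)%E]_z f (x, z) = \int[m2]_y \int[m3]_z f (x, (y, z)))%E.
  exact: (fubini_tonelli1 (fun z => f (x, z)) (mx x) (fun z => f0 _)).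
under eq_fun do rewrite E.
have mg : measurable_fun setT (fun t : T1 * T2 * T3 => f (t.1.1, (t.1.2, t.2))).
  apply: (measurableT_comp mf); apply: measurable_fun_pair; first exact: measurableT_comp.
  by apply: measurable_fun_pair => //; exact: measurableT_comp.
have mG := measurable_fun_fubini_tonelli_F (m2 := m3) _ mg (fun t => f0 _).
have G0 t : (0 <= \int[m3]_z f (t.1, (t.2, z)))%E by exact: integral_ge0.
exact: (measurable_fun_fubini_tonelli_F (m2 := m2) _ mG G0).
Qed.

Lemma measurable_Rintegral_prod (f : T1 * (T2 * T3) -> R) :
  measurable_fun setT f ->
  measurable_fun setT (fun x => \int[(m2 \x m3)%E]_z f (x, z)).
Proof.
move=> mf; rewrite /Rintegral; apply: (measurableT_comp (f := fine)) => //.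
under eq_fun do rewrite integralE.
have mfE : measurable_fun setT (EFin \o f) by exact/measurable_EFinP.
apply: emeasurable_funB.
  have := measurable_integral_prod (measurable_funepos mfE) (funepos_ge0 _).
  by rewrite unlock.
have := measurable_integral_prod (measurable_funeneg mfE) (funeneg_ge0 _).
by rewrite unlock.
Qed.

End product_parameter.

Section weighted_L2.
Context {R : realType} {dX dY : measure_display}
  {X : measurableType dX} {Y : measurableType dY}.
Variables (PX : probability X R) (mu : {sigma_finite_measure set Y -> \bar R}).
Variable w : X * Y -> R.
Hypotheses (mw : measurable_fun setT w) (w_ge0 : forall z, 0 <= w z).

Local Notation m := (PX \x mu)%E.
Implicit Types g h : X * Y -> R.

Definition wL2 g := measurable_fun setT g /\ Rintegrable m (fun z => w z * g z ^+ 2).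

Definition wip g h : R := \int[m]_z (w z * (g z * h z)).

Lemma wL2_meas g : wL2 g -> measurable_fun setT g. Proof. by case. Qed.

Lemma wL2M g h : wL2 g -> wL2 h -> Rintegrable m (fun z => w z * (g z * h z)).
Proof.
move=> [mg gi] [mh hi]; apply: Rintegrable_le (RintegrableD gi hi).
  by apply: measurable_funM => //; exact: measurable_funM.
move=> z; rewrite normrM (ger0_norm (w_ge0 z)) -mulrDr ler_wpM2l //.
rewrite normrM; have := sqr_ge0 (`|g z| - `|h z|).
have -> : g z ^+ 2 = `|g z| ^+ 2 by rewrite real_normK // num_real.
have -> : h z ^+ 2 = `|h z| ^+ 2 by rewrite real_normK // num_real.
have := normr_ge0 (g z); have := normr_ge0 (h z); nra.
Qed.

Lemma wL2Z k g : wL2 g -> wL2 (fun z => k * g z).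
Proof.
move=> [mg gi]; split; first exact: measurable_funM.
apply: (eq_Rintegrable _ (RintegrableZ (k ^+ 2) gi)) => z /=; ring.
Qed.

Lemma wL2D g h : wL2 g -> wL2 h -> wL2 (fun z => g z + h z).
Proof.
move=> Lg Lh; have [mg gi] := Lg; have [mh hi] := Lh.
split; first exact: measurable_funD.
apply: (eq_Rintegrable _ (RintegrableD (RintegrableD gi hi)
  (RintegrableZ 2 (wL2M Lg Lh)))) => z /=; ring.
Qed.

Lemma wL2B g h : wL2 g -> wL2 h -> wL2 (fun z => g z - h z).
Proof.
move=> Lg Lh; have := wL2D Lg (wL2Z (-1) Lh).
by congr wL2; apply/funext => z; rewrite mulN1r.
Qed.

Lemma wL20 : wL2 (fun=> 0).
Proof.
split=> //; apply: (eq_Rintegrable (f := fun=> 0)) => [z|].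
  by rewrite expr0n mulr0.
exact: integrable0.
Qed.

Lemma wL2_sum (I : Type) (r : seq I) (F : I -> X * Y -> R) :
  (forall i, wL2 (F i)) -> wL2 (fun z => \sum_(i <- r) F i z).
Proof.
move=> LF; elim: r => [|a r IH].
  by under eq_fun do rewrite big_nil; exact: wL20.
by under eq_fun do rewrite big_cons; exact: wL2D.
Qed.

Lemma wipC g h : wip g h = wip h g.
Proof. by apply: eq_Rintegral => z _; rewrite (mulrC (g z)). Qed.

Lemma wip_ge0 g : 0 <= wip g g.
Proof. by apply: Rintegral_ge0 => z _; rewrite mulr_ge0 // -expr2 sqr_ge0. Qed.

Lemma wipDl g1 g2 h : wL2 g1 -> wL2 g2 -> wL2 h ->
  wip (fun z => g1 z + g2 z) h = wip g1 h + wip g2 h.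
Proof.
move=> L1 L2 Lh; rewrite /wip -RintegralD //; [|exact: wL2M|exact: wL2M].
by apply: eq_Rintegral => z _; ring.
Qed.

Lemma wipZl k g h : wL2 g -> wL2 h ->
  wip (fun z => k * g z) h = k * wip g h.
Proof.
move=> L1 Lh; rewrite /wip -RintegralZ; last exact: wL2M.
by apply: eq_Rintegral => z _; ring.
Qed.

Lemma wipBl g1 g2 h : wL2 g1 -> wL2 g2 -> wL2 h ->
  wip (fun z => g1 z - g2 z) h = wip g1 h - wip g2 h.
Proof.
move=> L1 L2 Lh; rewrite -mulN1r -wipZl // -wipDl //; last exact: wL2Z.
by apply: eq_Rintegral => z _; ring.
Qed.

Lemma wip_sqrD g h : wL2 g -> wL2 h ->
  wip (fun z => g z + h z) (fun z => g z + h z) = wip g g + 2 * wip g h + wip h h.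
Proof.
move=> Lg Lh; have gg := wL2M Lg Lg; have gh := wL2M Lg Lh; have hh := wL2M Lh Lh.
have gh2 := RintegrableZ 2 gh.
rewrite /wip -RintegralZ // -(RintegralD _ gg gh2) // -RintegralD //; last first.
  exact: RintegrableD.
by apply: eq_Rintegral => z _; ring.
Qed.

Lemma wip_sqrZ k g h : wL2 g -> wL2 h ->
  wip (fun z => g z + k * h z) (fun z => g z + k * h z) =
  wip g g + 2 * k * wip g h + k ^+ 2 * wip h h.
Proof.
move=> Lg Lh; have Lk := wL2Z k Lh; rewrite wip_sqrD //.
rewrite (wipC g (fun z => k * h z)) !wipZl // (wipC h (fun z => k * h z)) wipZl //.
by rewrite (wipC h g); ring.
Qed.

Lemma wip_sqrB g h : wL2 g -> wL2 h ->
  wip (fun z => g z - h z) (fun z => g z - h z) = wip g g - 2 * wip g h + wip h h.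
Proof.
move=> Lg Lh; have := wip_sqrZ (-1) Lg Lh.
under eq_fun do rewrite mulN1r.
by move=> ->; ring.
Qed.

Lemma wip_suml (I : Type) (r : seq I) (F : I -> X * Y -> R) h :
  (forall i, wL2 (F i)) -> wL2 h ->
  wip (fun z => \sum_(i <- r) F i z) h = \sum_(i <- r) wip (F i) h.
Proof.
move=> LF Lh; rewrite -Rintegral_sum => [|i _]; last exact: wL2M.
by apply: eq_Rintegral => z _; rewrite mulr_suml mulr_sumr.
Qed.

Lemma wip_lin (d e : nat) (a : 'I_d -> R) (b : 'I_e -> R) F G :
  (forall i, wL2 (F i)) -> (forall i, wL2 (G i)) ->
  wip (fun z => \sum_i a i * F i z) (fun z => \sum_j b j * G j z) =
  \sum_i \sum_j a i * b j * wip (F i) (G j).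
Proof.
move=> LF LG; rewrite wip_suml; first last.
  by apply: wL2_sum => j; exact: wL2Z.
  by move=> i; exact: wL2Z.
apply: eq_bigr => i _; rewrite wipZl //; last by apply: wL2_sum => j; exact: wL2Z.
rewrite wipC wip_suml // ?mulr_sumr => [|j]; last exact: wL2Z.
by apply: eq_bigr => j _; rewrite wipZl // wipC mulrA.
Qed.

Lemma wL2_lin (d : nat) (a : 'I_d -> R) F : (forall i, wL2 (F i)) ->
  wL2 (fun z => \sum_i a i * F i z).
Proof. by move=> LF; apply: wL2_sum => i; exact: wL2Z. Qed.

Lemma wip_orthogonal (g : X -> R) h : wL2 (fun z => g z.1) -> wL2 h ->
  (\forall x \ae PX, \int[mu]_y (w (x, y) * h (x, y)) = 0) ->
  (\forall x \ae PX, Rintegrable mu (fun y => w (x, y) * h (x, y))) ->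
  wip (fun z => g z.1) h = 0.
Proof.
move=> Lg Lh h0 hi; rewrite /wip Rfubini; last exact: wL2M.
rewrite -[RHS](_ : \int[PX]_x 0 = 0); last by rewrite Rintegral_cst // mul0r.
rewrite /Rintegral; congr fine; apply: ae_eq_integral => //.
  apply/measurable_EFinP.
  apply: (measurable_Rintegral mu (f := fun z => w z * (g z.1 * h z))).
  exact: Rintegrable_meas (wL2M Lg Lh).
apply: filterS2 h0 hi => x hx0 hxi _ /=; congr EFin.
transitivity (\int[mu]_y (g x * (w (x, y) * h (x, y)))).
  by apply: eq_Rintegral => y _; ring.
by rewrite RintegralZ // hx0 mulr0.
Qed.

(* The projection onto functions of x; requires the conditional mass of w to be
   positive. *)
Definition wmass x := \int[mu]_y w (x, y).
Definition wproj h x := (wmass x)^-1 * \int[mu]_y (w (x, y) * h (x, y)).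

Hypothesis wi : Rintegrable m w.
Hypothesis wmass_gt0 : forall x, 0 < wmass x.

Lemma wL2_int g : wL2 g -> Rintegrable m (fun z => w z * g z).
Proof.
move=> [mg gi]; apply: (Rintegrable_le _ _ (RintegrableD wi gi)).
  exact: measurable_funM.
move=> z; rewrite normrM (ger0_norm (w_ge0 z)).
rewrite (_ : w z + _ = w z * (1 + g z ^+ 2)); last by ring.
rewrite ler_wpM2l // ler_norml; apply/andP.
have := sqr_ge0 (g z - 1); have := sqr_ge0 (g z + 1); split; nra.
Qed.

Lemma ae_wL2_int g : wL2 g ->
  \forall x \ae PX, Rintegrable mu (fun y => w (x, y) * g (x, y)).
Proof. by move=> Lg; have := ae_integrable1 (wL2_int Lg). Qed.

Lemma measurable_wmass : measurable_fun setT wmass.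
Proof. exact: measurable_Rintegral. Qed.

Lemma measurable_wproj h : measurable_fun setT h -> measurable_fun setT (wproj h).
Proof.
move=> mh; apply: measurable_funM.
  exact: measurable_inv_pos measurable_wmass wmass_gt0.
by apply: (measurable_Rintegral mu (f := fun z => w z * h z)); exact: measurable_funM.
Qed.

Lemma Rintegrable_slice_w x : Rintegrable mu (fun y => w (x, y)).
Proof.
apply: contrapT => nwi; have := wmass_gt0 x; rewrite /wmass /Rintegral.
suff -> : (\int[mu]_y (w (x, y))%:E)%E = +oo%E by rewrite /= ltxx.
apply: contrapT => /eqP; rewrite -ltey => wlt; apply: nwi.
apply/integrableP; split; first by apply/measurable_EFinP; exact: measurableT_comp.
apply: le_lt_trans wlt; rewrite le_eqVlt; apply/orP; left; apply/eqP.
by apply: eq_integral => y _ /=; rewrite ger0_norm.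
Qed.

Lemma wL2_wproj h : wL2 h -> wL2 (fun z => wproj h z.1).
Proof.
move=> Lh; have [mh hi] := Lh.
have mp : measurable_fun setT (fun z : X * Y => wproj h z.1).
  by apply: measurableT_comp => //; exact: measurable_wproj.
split=> //.
have mf : measurable_fun setT (fun z : X * Y => w z * wproj h z.1 ^+ 2).
  by apply: measurable_funM => //; exact: measurable_funX.
apply: (Rintegrable_nneg (c := \int[m]_z (w z * h z ^+ 2))) => //.
  by move=> z; rewrite mulr_ge0 // sqr_ge0.
rewrite -RintegralE // fubini_tonelli1 //=; last 2 first.
- exact/measurable_EFinP.
- by move=> z; rewrite lee_fin mulr_ge0 // sqr_ge0.
rewrite fubini_tonelli1 //=; last 2 first.
- apply/measurable_EFinP; exact: Rintegrable_meas hi.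
- by move=> z; rewrite lee_fin mulr_ge0 // sqr_ge0.
rewrite /fubini_F /=; apply: ae_ge0_le_integral => //.
- by move=> x _; apply: integral_ge0 => y _; rewrite lee_fin mulr_ge0 // sqr_ge0.
- apply: (measurable_fun_fubini_tonelli_F (fun z => (w z * wproj h z.1 ^+ 2)%:E)).
    exact/measurable_EFinP.
  by move=> z; rewrite lee_fin mulr_ge0 // sqr_ge0.
- by move=> x _; apply: integral_ge0 => y _; rewrite lee_fin mulr_ge0 // sqr_ge0.
- apply: (measurable_fun_fubini_tonelli_F (fun z => (w z * h z ^+ 2)%:E)).
    apply/measurable_EFinP; exact: Rintegrable_meas hi.
  by move=> z; rewrite lee_fin mulr_ge0 // sqr_ge0.
apply: filterS2 (ae_wL2_int Lh) (ae_integrable1 hi) => x whi whi2 _.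
have wi1 := Rintegrable_slice_w x.
have i2 : Rintegrable mu (fun y => w (x, y) * wproj h x ^+ 2).
  by apply: (eq_Rintegrable _ (RintegrableZ (wproj h x ^+ 2) wi1)) => y; rewrite mulrC.
rewrite !RintegralE // lee_fin -subr_ge0.
have e1 : \int[mu]_y (w (x, y) * wproj h x ^+ 2) = wproj h x ^+ 2 * wmass x.
  by rewrite /wmass -RintegralZ //; apply: eq_Rintegral => y _; rewrite mulrC.
have e2 : \int[mu]_y (w (x, y) * h (x, y)) = wproj h x * wmass x.
  by rewrite /wproj mulrAC mulVf ?mul1r // gt_eqF.
have : 0 <= \int[mu]_y (w (x, y) * (h (x, y) - wproj h x) ^+ 2).
  by apply: Rintegral_ge0 => y _; rewrite mulr_ge0 // sqr_ge0.
suff -> : \int[mu]_y (w (x, y) * (h (x, y) - wproj h x) ^+ 2) =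
  \int[mu]_y (w (x, y) * h (x, y) ^+ 2) - \int[mu]_y (w (x, y) * wproj h x ^+ 2).
  by [].
transitivity (\int[mu]_y (w (x, y) * h (x, y) ^+ 2 + (w (x, y) * wproj h x ^+ 2
   + (- 2 * wproj h x) * (w (x, y) * h (x, y))))).
  by apply: eq_Rintegral => y _; ring.
rewrite RintegralD //; last by apply: RintegrableD => //; exact: RintegrableZ.
rewrite RintegralD //; last exact: RintegrableZ.
rewrite RintegralZ // e1 e2; ring.
Qed.

Lemma wip_proj_eq0 (g : X -> R) h : wL2 (fun z => g z.1) -> wL2 h ->
  wip (fun z => g z.1) (fun z => h z - wproj h z.1) = 0.
Proof.
move=> Lg Lh; have Lp := wL2_wproj Lh; have Ld := wL2B Lh Lp.
apply: wip_orthogonal => //; last exact: (ae_wL2_int Ld).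
apply: filterS (ae_wL2_int Lh) => x whi /=.
have wi1 := Rintegrable_slice_w x.
transitivity (\int[mu]_y (w (x, y) * h (x, y) + (- wproj h x) * w (x, y))).
  by apply: eq_Rintegral => y _; ring.
rewrite RintegralD //; last exact: RintegrableZ.
rewrite RintegralZ // -/(wmass x) /wproj.
by rewrite mulNr mulrAC mulVf ?mul1r ?subrr // gt_eqF.
Qed.

Lemma wip_projD g h : wL2 g -> wL2 h ->
  wip (fun z => g z - wproj g z.1) (fun z => h z - wproj h z.1) =
  wip g h - wip (fun z => wproj g z.1) (fun z => wproj h z.1).
Proof.
move=> Lg Lh; have Lpg := wL2_wproj Lg; have Lph := wL2_wproj Lh.
have Ldh := wL2B Lh Lph.
rewrite wipBl // (wip_proj_eq0 Lpg Lh) subr0.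
rewrite wipC wipBl // (wipC h); congr (_ - _).
by have := wip_proj_eq0 Lph Lg; rewrite wipC wipBl // wipC => /subr0_eq.
Qed.

End weighted_L2.

Section directional_derivatives.
Context {R : realType} {V : normedModType R}.
Implicit Types (g : V -> R) (a v : V).

Let derive_ge0 g a v : derivable g a v ->
  (\forall x \near a, g a <= g x) -> 0 <= 'D_v g a.
Proof.
move=> dg mg; have dg' := cvg_dnbhs_at_right dg.
rewrite /derive -(cvg_lim _ dg') //.
apply: limr_ge; first exact: cvgP dg'.
have sv : h *: v + a @[h --> 0^'+] --> a.
  rewrite -[X in _ --> X]add0r -[X in X + _](scale0r v).
  apply: (cvg_at_right_filter (f := fun h : R => h *: v + a)).
  apply: cvgD; last exact: cvg_cst.
  by apply: cvgZr_tmp; exact: cvg_id.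
near=> h; apply: mulr_ge0.
  by rewrite invr_ge0 ltW.
rewrite subr_ge0; near: h.
exact: (sv _ mg).
Unshelve. all: by end_near. Qed.

Lemma derive_local_min g a v : differentiable g a ->
  (\forall x \near a, g a <= g x) -> 'D_v g a = 0.
Proof.
move=> dg mg; apply/eqP; rewrite eq_le; apply/andP; split; last first.
  by apply: derive_ge0 => //; exact: diff_derivable.
have : 0 <= 'D_(- v) g a by apply: derive_ge0 => //; exact: diff_derivable.
by rewrite !deriveE // linearN oppr_ge0.
Qed.

Lemma derive_ln g a v : differentiable g a -> 0 < g a ->
  'D_v (fun t => ln (g t)) a = (g a)^-1 * 'D_v g a.
Proof.
move=> dg ga0.
have dl : is_derive (g a) 1 (@ln R) (g a)^-1 by exact: is_derive1_ln.
have dln : differentiable (@ln R) (g a) by apply/derivable1_diffP.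
rewrite deriveE; last exact: (differentiable_comp dg dln).
rewrite (_ : (fun t => _) = @ln R \o g) // diff_comp //= diff1E //.
by rewrite deriveE // derive1E derive_val mulrC.
Qed.

Lemma derive_seq0 g a v : derivable g a v -> g a = 0 ->
  (\forall m \near \oo, g (m.+1%:R^-1 *: v + a) = 0) -> 'D_v g a = 0.
Proof.
move=> dg ga0 g0; rewrite /derive.
set q := fun h : R => _; have cq : q h @[h --> 0^'] --> lim (q @ 0^') by exact: dg.
have s0 : (m.+1%:R^-1 : R) @[m --> \oo] --> 0^'.
  move=> A; rewrite /dnbhs /within /= => A0.
  have : \forall m \near \oo, (m.+1%:R^-1 : R) != 0 -> A (m.+1%:R^-1).
    exact: (@cvg_harmonic R _ A0).
  by apply: filterS => m; apply; rewrite invr_neq0 // pnatr_eq0.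
have cs : q (m.+1%:R^-1) @[m --> \oo] --> lim (q @ 0^') by exact: cvg_comp s0 cq.
apply: (cvg_unique _ cs) => //; apply: cvg_near_cst.
by apply: filterS g0 => m /= gm0; rewrite /q /= gm0 ga0 subrr scaler0.
Qed.

End directional_derivatives.

Section model_moments.
Context {R : realType} {dX dY : measure_display}
  {X : measurableType dX} {Y : measurableType dY} {d q : nat}.
Variables (PX : probability X R) (mu : {sigma_finite_measure set Y -> \bar R}).
Variables (Theta : set 'cV[R]_d) (theta : 'cV[R]_d)
  (f : 'cV[R]_d -> X -> Y -> R).
Hypotheses (hTheta : Theta° theta) (hf : is_conditional_density mu f Theta)
  (hf_diff : \forall x \ae PX, \forall y \ae mu,
     differentiable (fun t => f t x y) theta)
  (hscore : forall k, measurable_fun setT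
     (fun z : X * Y => score f theta z.1 z.2 k 0)).
Variables (pi : nat -> 'cV[R]_q -> X -> Y -> R) (n : nat -> R) (N : nat)
  (v : 'cV[R]_q).
Hypotheses (hpi_meas : measurable_fun setT
     (fun z : X * Y * borel R q => pi N z.2 z.1.1 z.1.2))
  (hpi : forall N vt x y, 0 < pi N vt x y <= 1).

Definition sampled_density (z : X * Y) : R := pi N v z.1 z.2 * f theta z.1 z.2.
Local Notation w := sampled_density.
Local Notation m := (PX \x mu)%E.

Lemma Theta_theta : Theta theta. Proof. exact: interior_subset. Qed.

Lemma density_ge0 x y : 0 <= f theta x y.
Proof. by have [] := hf Theta_theta. Qed.

Lemma measurable_density : measurable_fun setT (fun z : X * Y => f theta z.1 z.2).
Proof. by have [] := hf Theta_theta. Qed.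

Lemma measurable_pi_v : measurable_fun setT (fun z : X * Y => pi N v z.1 z.2).
Proof.
have -> : (fun z : X * Y => pi N v z.1 z.2) =
  (fun z : X * Y * borel R q => pi N z.2 z.1.1 z.1.2) \o (fun z => (z, v)) by [].
by apply: measurableT_comp => //; exact: pair2_measurable.
Qed.

Lemma measurable_w : measurable_fun setT w.
Proof. exact: measurable_funM measurable_pi_v measurable_density. Qed.

Lemma w_ge0 z : 0 <= w z.
Proof. by rewrite mulr_ge0 ?density_ge0 // ltW //; have /andP[] := hpi N v z.1 z.2. Qed.

Lemma w_le_density z : w z <= f theta z.1 z.2.
Proof. by rewrite ler_piMl ?density_ge0 //; have /andP[] := hpi N v z.1 z.2. Qed.

Lemma Rintegrable_density_slice x : Rintegrable mu (f theta x).
Proof.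
have [f0 mf f1] := hf Theta_theta.
apply: (Rintegrable_nneg (c := 1)) => //.
  exact: (measurableT_comp mf (pair1_measurable x)).
by rewrite f1.
Qed.

Lemma Rintegral_density_slice x : \int[mu]_y f theta x y = 1.
Proof. by have [_ _ f1] := hf Theta_theta; rewrite /Rintegral f1. Qed.

Lemma integral_density (h : X -> R) : measurable_fun setT h -> (forall x, 0 <= h x) ->
  (\int[m]_z (f theta z.1 z.2 * h z.1)%:E = \int[PX]_x (h x)%:E)%E.
Proof.
move=> mh h0; have [f0 mf f1] := hf Theta_theta.
rewrite fubini_tonelli1 //=; first last.
- by move=> z; rewrite lee_fin mulr_ge0.
- by apply/measurable_EFinP; apply: measurable_funM => //; exact: measurableT_comp.
apply: eq_integral => x _; rewrite /fubini_F /=.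
under eq_integral do rewrite EFinM.
have mfx : measurable_fun setT (fun y => (f theta x y)%:E).
  by apply/measurable_EFinP; exact: (measurableT_comp mf (pair1_measurable x)).
have fx0 y : [set: Y] y -> (0 <= (f theta x y)%:E)%E by rewrite lee_fin.
by rewrite (ge0_integralZr _ measurableT mfx fx0) ?lee_fin // f1 mul1e.
Qed.

Lemma Rintegrable_density : Rintegrable m (fun z => f theta z.1 z.2).
Proof.
apply: (Rintegrable_nneg (c := 1)); first exact: measurable_density.
  by move=> z; exact: density_ge0.
have -> : (\int[m]_z (f theta z.1 z.2)%:E = \int[m]_z (f theta z.1 z.2 * 1)%:E)%E.
  by apply: eq_integral => z _; rewrite mulr1.
rewrite (@integral_density (fun=> 1) (measurable_cst _) (fun=> ler01)).
by rewrite integral_cst //= probability_setT mule1.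
Qed.

Lemma Rintegrable_w : Rintegrable m w.
Proof.
apply: Rintegrable_le Rintegrable_density; first exact: measurable_w.
by move=> z; rewrite ger0_norm ?w_ge0 // w_le_density.
Qed.

Lemma wmass_gt0 x : 0 < wmass mu w x.
Proof.
rewrite lt0r; apply/andP; split; last by apply: Rintegral_ge0 => y _; exact: w_ge0.
apply/negP => /eqP w0.
have mwx : measurable_fun setT (fun y => w (x, y)).
  exact: (measurableT_comp measurable_w (pair1_measurable x)).
have wi : Rintegrable mu (fun y => w (x, y)).
  apply: Rintegrable_le (Rintegrable_density_slice x) => // y.
  by rewrite ger0_norm ?w_ge0 // (w_le_density (x, y)).
have /(ae_eq_integral_abs mu measurableT) : (\int[mu]_y `|(w (x, y))%:E| = 0)%E.
  under eq_integral do rewrite gee0_abs ?lee_fin ?w_ge0 //.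
  by rewrite RintegralE // -[X in X%:E]/(wmass mu w x) w0.
move=> /(_ (measurable_int mu wi)) wae.
have := Rintegral_density_slice x.
suff f0 : (\int[mu]_y (f theta x y)%:E = 0)%E.
  by rewrite /Rintegral f0 /= => /esym/eqP; rewrite oner_eq0.
rewrite -[RHS](integral0 mu setT); apply: ae_eq_integral => //.
  by have := Rintegrable_density_slice x => /(measurable_int mu).
apply: filterS wae => y /= /(_ I) [] /eqP.
rewrite mulf_eq0 gt_eqF /=; last by have /andP[] := hpi N v x y.
by move=> /eqP -> _.
Qed.

Lemma Exp_fun (g : X -> Y -> R) :
  Exp PX mu f pi N theta v (fun x y _ => g x y) =
  \int[m]_z (g z.1 z.2 * f theta z.1 z.2).
Proof. by apply: eq_Rintegral => z _; rewrite /integrand; ring. Qed.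

Lemma integrand_delta (g : X -> Y -> R) t vt x y :
  integrand f pi N t vt (fun x y b => b%:R * g x y) x y =
  pi N vt x y * g x y * f t x y.
Proof. by rewrite /integrand /= ; ring. Qed.

Lemma Exp_delta (g : X -> Y -> R) :
  Exp PX mu f pi N theta v (fun x y b => b%:R * g x y) =
  \int[m]_z (w z * g z.1 z.2).
Proof. by apply: eq_Rintegral => z _; rewrite integrand_delta /w; ring. Qed.

Definition score_c j (z : X * Y) := score f theta z.1 z.2 j 0.
Local Notation s := score_c.

Hypothesis hS_fin : finite_Emx PX mu f pi N theta v
     (fun x y _ => pi N v x y *: outer (score f theta x y)).

Lemma outerE k (a : 'cV[R]_k) i j : outer a i j = a i 0 * a j 0.
Proof. by rewrite !mxE big_ord1 !mxE. Qed.

Lemma wL2_score j : wL2 PX mu w (s j).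
Proof.
split; first exact: hscore.
apply: (eq_Rintegrable _ (hS_fin j j)) => z.
by rewrite /integrand mxE outerE /w /s; ring.
Qed.

Lemma mean_piE x : mean_pi mu f pi N theta v x = wmass mu w x.
Proof. by apply: eq_Rintegral => y _; rewrite /integrand /w /=; ring. Qed.

Lemma scoreSE x y j :
  scoreS mu f pi N theta v x y j 0 = s j (x, y) - wproj mu w (s j) x.
Proof.
rewrite /scoreS !mxE mean_piE /wproj; congr (_ - _ * _).
  by rewrite /s /score /grad mxE.
by apply: eq_Rintegral => z _; rewrite /integrand mxE /w /s /sampled_density /score_c /=; ring.
Qed.

Definition scoreS_c j (z : X * Y) := s j z - wproj mu w (s j) z.1.

Lemma wL2_scoreS j : wL2 PX mu w (scoreS_c j).
Proof.
apply: (wL2B measurable_w w_ge0 (wL2_score j)).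
exact: (wL2_wproj measurable_w w_ge0 Rintegrable_w wmass_gt0 (wL2_score j)).
Qed.

Let wL2_p j : wL2 PX mu w (fun z => wproj mu w (s j) z.1).
Proof. exact: (wL2_wproj measurable_w w_ge0 Rintegrable_w wmass_gt0 (wL2_score j)). Qed.

Lemma SigmaN_wip i j : SigmaN PX mu f pi n N theta v i j =
  N%:R / n N * wip PX mu w (scoreS_c i) (scoreS_c j).
Proof.
rewrite mxE; congr (_ * _).
rewrite mxE Exp_fun (wip_projD measurable_w w_ge0 Rintegrable_w wmass_gt0
  (wL2_score i) (wL2_score j)).
pose c j x := wproj mu w (s j) x.
have mc k : measurable_fun setT (c k).
  exact: (measurable_wproj measurable_w wmass_gt0 (hscore k)).
have mg : measurable_fun setT (wmass mu w) by exact: measurable_wmass measurable_w.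
have ci : Rintegrable m (fun z => f theta z.1 z.2 * (wmass mu w z.1 * (c i z.1 * c j z.1))).
  have ck k : Rintegrable PX (fun x => wmass mu w x * c k x ^+ 2).
    have := Rintegrable_fubini (wL2_p k).2.
    apply: eq_Rintegrable => x /=; rewrite mulrC -RintegralZ.
      by apply: eq_Rintegral => y _; rewrite mulrC.
    exact: (Rintegrable_slice_w measurable_w w_ge0 wmass_gt0).
  have cg0 x : 0 <= wmass mu w x * (c i x ^+ 2 + c j x ^+ 2).
    by rewrite mulr_ge0 ?addr_ge0 ?sqr_ge0 // ltW // wmass_gt0.
  have mcc : measurable_fun setT (fun x => wmass mu w x * (c i x ^+ 2 + c j x ^+ 2)).
    apply: measurable_funM => //.
    by apply: measurable_funD; exact: measurable_funX.
  have : Rintegrable m (fun z => f theta z.1 z.2 *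
      (wmass mu w z.1 * (c i z.1 ^+ 2 + c j z.1 ^+ 2))).
    apply: (Rintegrable_nneg (c := \int[PX]_x (wmass mu w x * c i x ^+ 2 +
        wmass mu w x * c j x ^+ 2))).
    - apply: measurable_funM; first exact: measurable_density.
      exact: (measurableT_comp mcc).
    - by move=> z; rewrite mulr_ge0 // density_ge0.
    - rewrite (integral_density mcc cg0) -RintegralE; last exact: RintegrableD.
      by rewrite le_eqVlt; apply/orP; left; apply/eqP/eq_integral => x _; rewrite mulrDr.
  move=> hi0; apply: (Rintegrable_le _ _ hi0).
    apply: measurable_funM; first exact: measurable_density.
    apply: (measurableT_comp (f := fun x => wmass mu w x * (c i x * c j x))) => //.
    by apply: measurable_funM => //; exact: measurable_funM.
  move=> z; rewrite normrM (ger0_norm (density_ge0 _ _)) ler_wpM2l ?density_ge0 //.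
  rewrite normrM (ger0_norm (ltW (wmass_gt0 _))) ler_wpM2l ?(ltW (wmass_gt0 _)) //.
  rewrite ler_norml; apply/andP.
  have := sqr_ge0 (c i z.1 + c j z.1); have := sqr_ge0 (c i z.1 - c j z.1).
  by split; nra.
have -> : wip PX mu w (fun z => wproj mu w (s i) z.1) (fun z => wproj mu w (s j) z.1)
   = \int[m]_z (f theta z.1 z.2 * (wmass mu w z.1 * (c i z.1 * c j z.1))).
  rewrite Rfubini // /wip Rfubini; last exact: (wL2M measurable_w w_ge0 (wL2_p i) (wL2_p j)).
  apply: eq_Rintegral => x _ /=.
  rewrite -/(c i x) -/(c j x).
  transitivity (c i x * c j x * wmass mu w x).
    rewrite -RintegralZ; first by apply: eq_Rintegral => y _; rewrite mulrC.
    exact: (Rintegrable_slice_w measurable_w w_ge0 wmass_gt0).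
  transitivity (wmass mu w x * (c i x * c j x) * \int[mu]_y f theta x y).
    by rewrite Rintegral_density_slice mulr1 mulrC.
  rewrite -RintegralZ; last exact: Rintegrable_density_slice.
  by apply: eq_Rintegral => y _; rewrite mulrC.
rewrite /wip -RintegralB //; last exact: (wL2M measurable_w w_ge0 (wL2_score i) (wL2_score j)).
apply: eq_Rintegral => -[x y] _ /=.
have mE k : mean_piscore mu f pi N theta v x k 0 = wmass mu w x * c k x.
  rewrite mxE /c /wproj mulrA mulfV ?mul1r ?gt_eqF ?wmass_gt0 //.
  by apply: eq_Rintegral => z _; rewrite /integrand mxE /w /s /sampled_density /score_c /=; ring.
rewrite [X in X * _]mxE [X in (X + _) * _]mxE outerE.
rewrite [X in (_ + X) * _]mxE [X in (_ - X) * _]mxE outerE !mE mean_piE.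
have g0 : wmass mu w x != 0 by rewrite gt_eqF // wmass_gt0.
by rewrite /w /s /=; field.
Qed.

Variable U : nat -> 'cV[R]_q -> 'cV[R]_d -> X -> Y -> 'cV[R]_d.
Hypotheses (hU_meas : forall j, measurable_fun setT
     (fun z : X * Y * borel R q => U N z.2 theta z.1.1 z.1.2 j 0))
  (hV_fin : finite_Emx PX mu f pi N theta v
     (fun x y b => b%:R *: outer (U N v theta x y))).

Definition U_c j (z : X * Y) := U N v theta z.1 z.2 j 0.
Local Notation u := U_c.

Lemma measurable_U_c j : measurable_fun setT (u j).
Proof.
have -> : u j = (fun z : X * Y * borel R q => U N z.2 theta z.1.1 z.1.2 j 0)
  \o (fun z => (z, v)) by [].
by apply: measurableT_comp; [exact: hU_meas|exact: pair2_measurable].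
Qed.

Lemma wL2_U j : wL2 PX mu w (u j).
Proof.
split; first exact: measurable_U_c.
apply: (eq_Rintegrable _ (hV_fin j j)) => z.
by rewrite /integrand !mxE !big_ord1 !mxE /w /u /sampled_density /U_c /=; ring.
Qed.

Lemma VN_wip i j : VN PX mu f pi n U N theta v i j =
  N%:R / n N * wip PX mu w (u i) (u j).
Proof.
rewrite mxE; congr (_ * _); rewrite mxE.
apply: eq_Rintegral => z _.
by rewrite /integrand !mxE !big_ord1 !mxE /w /u /sampled_density /U_c /=; ring.
Qed.

Lemma mean_sq_TN_wip (M Sigma : 'M[R]_d) :
  mean_sq_TN PX mu f pi n U M Sigma N theta v =
  N%:R / n N * \int[m]_z (w z * \sum_i (u i z +
    \sum_j (M *m invmx Sigma) i j * scoreS_c j z) ^+ 2).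
Proof.
congr (_ * _); rewrite Exp_delta; apply: eq_Rintegral => -[x y] _.
congr (_ * _); rewrite /frob sqr_sqrtr; last first.
  rewrite /mxtrace; apply: sumr_ge0 => i _; rewrite mxE; apply: sumr_ge0 => k _.
  by rewrite mxE -expr2 sqr_ge0.
rewrite /mxtrace big_ord1 mxE; apply: eq_bigr => i _.
rewrite mxE -expr2 /TN mxE; congr ((_ + _) ^+ 2).
by rewrite mxE; apply: eq_bigr => j _; rewrite scoreSE.
Qed.

Hypotheses (hU_diff : \forall x \ae PX, \forall y \ae mu,
     differentiable (fun t => U N v t x y) theta)
  (hU_unbiased : conditionally_unbiased PX mu f pi U Theta)
  (hU_swap : diff_under_integral PX mu f pi U N theta v)
  (hM_fin : finite_Emx PX mu f pi N theta v
     (fun x y b => b%:R *: jac (fun t => U N v t x y) theta)).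

Lemma ae_U_centered j : \forall x \ae PX, \int[mu]_y (w (x, y) * u j (x, y)) = 0.
Proof.
apply: filterS (hU_unbiased N v Theta_theta) => x /(_ j)[_ /= <-].
by apply: eq_Rintegral => y _; rewrite /integrand /w /u /=; ring.
Qed.

Lemma U_centered j : \int[m]_z (w z * u j z) = 0.
Proof.
have ui := wL2_int measurable_w w_ge0 Rintegrable_w (wL2_U j).
rewrite Rfubini // -[RHS](_ : \int[PX]_x 0 = 0); last by rewrite Rintegral_cst // mul0r.
rewrite /Rintegral; congr fine; apply: ae_eq_integral => //.
  apply/measurable_EFinP.
  apply: (measurable_Rintegral mu (f := fun z => w z * u j z)).
  exact: Rintegrable_meas ui.
by apply: filterS (ae_U_centered j) => x hx _ /=; congr EFin.
Qed.

Lemma wip_U_proj j k : wip PX mu w (fun z => wproj mu w (s k) z.1) (u j) = 0.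
Proof.
apply: wip_orthogonal measurable_w w_ge0 _ _ (wL2_p k) (wL2_U j) (ae_U_centered j) _.
exact: (ae_wL2_int measurable_w w_ge0 Rintegrable_w (wL2_U j)).
Qed.

Lemma wip_U_score j k : wip PX mu w (u j) (s k) = wip PX mu w (u j) (scoreS_c k).
Proof.
rewrite wipC [RHS]wipC (wipBl measurable_w w_ge0 (wL2_score k) (wL2_p k) (wL2_U j)).
by rewrite wip_U_proj subr0.
Qed.

Lemma derive_density x y k : differentiable (fun t => f t x y) theta ->
  'D_(delta_mx k 0) (fun t => f t x y) theta = s k (x, y) * f theta x y.
Proof.
move=> df; rewrite /s /score /grad mxE /=.
have := density_ge0 x y; rewrite le_eqVlt => /predU1P[f0|f0].
  rewrite -f0 mulr0; apply: derive_local_min => //.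
  rewrite -f0; apply: filterS hTheta => t Tt /=.
  by have [] := hf Tt.
by rewrite derive_ln // mulrC mulrA mulfV ?mul1r // gt_eqF.
Qed.

Lemma MN_wip j k : MN PX mu f pi n U N theta v j k =
  - (N%:R / n N * wip PX mu w (u j) (scoreS_c k)).
Proof.
rewrite -wip_U_score mxE -mulrN; congr (_ * _).
pose J z := jac (fun t => U N v t z.1 z.2) theta j k : R.
have Ji : Rintegrable m (fun z : X * Y => w z * J z).
  apply: (eq_Rintegrable _ (hM_fin j k)) => z.
  by rewrite /integrand !mxE /w /sampled_density /J !mxE /=; ring.
have us := wL2M measurable_w w_ge0 (wL2_U j) (wL2_score k).
have -> : Emx PX mu f pi N theta v
   (fun x y b => b%:R *: jac (fun t => U N v t x y) theta) j k = \int[m]_z (w z * J z).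
  rewrite mxE; apply: eq_Rintegral => z _.
  by rewrite /integrand !mxE /w /sampled_density /J !mxE /=; ring.
apply/eqP; rewrite -subr_eq0 opprK; apply/eqP.
rewrite /wip -RintegralD // Rfubini; last exact: RintegrableD.
rewrite -[RHS](_ : \int[PX]_x 0 = 0); last by rewrite Rintegral_cst // mul0r.
rewrite /Rintegral; congr fine; apply: ae_eq_integral => //.
  apply/measurable_EFinP.
  apply: (measurable_Rintegral mu (f := fun z => w z * J z + w z * (u j z * s k z))).
  exact: Rintegrable_meas (RintegrableD Ji us).
pose e := delta_mx k 0 : 'cV[R]_d.
have zero : \forall x \ae PX, forall i : nat, Theta (i.+1%:R^-1 *: e + theta) ->
   condE mu f pi N (i.+1%:R^-1 *: e + theta) v
     (fun x y b => b%:R * U N v (i.+1%:R^-1 *: e + theta) x y j 0) x = 0.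
  apply/ae_foralln => i.
  have [Ti|nTi] := pselect (Theta (i.+1%:R^-1 *: e + theta)).
    by apply: filterS (hU_unbiased N v Ti) => x /(_ j)[_ h] _.
  by apply: nearW => x.
have zero0 := hU_unbiased N v Theta_theta.
have near_Theta : \forall i \near \oo, Theta (i.+1%:R^-1 *: e + theta).
  have : (i.+1%:R^-1 *: e + theta) @[i --> \oo] --> theta.
    rewrite -[X in _ --> X]add0r -[X in X + _](scale0r e).
    by apply: cvgD; [apply: cvgZr_tmp; exact: cvg_harmonic|exact: cvg_cst].
  by move/(_ _ hTheta).
have diffs : \forall x \ae PX, \forall y \ae mu,
    differentiable (fun t => f t x y) theta /\ differentiable (fun t => U N v t x y) theta.
  by apply: filterS2 hf_diff hU_diff => x; exact: filterS2.
have mJ := ae_integrable1 (RintegrableD Ji us).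
apply: filterS3 (filterI zero zero0) (filterI diffs mJ) hU_swap.
move=> x [hz /(_ j)[_ h0]] [hxy hJ] /(_ j k)[dcond ddi ddE] _; congr EFin.
have D0 := derive_seq0 dcond.
rewrite -[RHS]D0; last 2 first.
- by [].
- by apply: filterS near_Theta => i; exact: hz.
rewrite ddE /Rintegral; congr fine; apply: ae_eq_integral => //.
- exact: measurable_int hJ.
- exact: measurable_int ddi.
apply: filterS hxy => y [df dU] _ /=; congr EFin.
have dUj : differentiable (fun t => U N v t x y j 0) theta.
  exact: (differentiable_comp dU (differentiable_coord _ _ _)).
have -> : (fun t => integrand f pi N t v (fun x y b => b%:R * U N v t x y j 0) x y) =
   (pi N v x y \*: ((fun t => U N v t x y j 0) * (fun t => f t x y)))%R.
  by apply/funext => t; rewrite integrand_delta -mulrA.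
rewrite deriveZ; last by apply: derivableM; exact: diff_derivable.
rewrite deriveM; [|exact: diff_derivable|exact: diff_derivable].
rewrite derive_density // /J mxE /w /u /= -/e.
transitivity (pi N v x y * (U N v theta x y j 0 * (s k (x, y) * f theta x y) +
  f theta x y * 'D_e (fun t => U N v t x y j 0) theta)); last by [].
ring.
Qed.

End model_moments.

Section matrix_norms.
Context {R : realType}.

Lemma mx_entry_le m n (A : 'M[R]_(m, n)) i j : `|A i j| <= `|A|.
Proof. by rewrite [leRHS]/Num.norm /= mx_normrE (le_bigmax _ _ (i, j)). Qed.

Lemma mx_norm_le m n (A : 'M[R]_(m, n)) c : 0 <= c ->
  (forall i j, `|A i j| <= c) -> `|A| <= c.
Proof.
move=> c0 Ac; rewrite [leLHS]/Num.norm /= mx_normrE; apply/bigmax_leP.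
by split=> // ij _; exact: Ac.
Qed.

Lemma sqr_frob d (a : 'cV[R]_d) : frob a ^+ 2 = \sum_i a i 0 ^+ 2.
Proof.
have E : \tr (a^T *m a) = \sum_i a i 0 ^+ 2.
  by rewrite /mxtrace big_ord1 mxE; apply: eq_bigr => i _; rewrite mxE expr2.
by rewrite /frob sqr_sqrtr E // sumr_ge0 // => i _; rewrite sqr_ge0.
Qed.

Lemma frob_ge0 d (a : 'cV[R]_d) : 0 <= frob a.
Proof. exact: sqrtr_ge0. Qed.

Lemma norm_le_frob d (a : 'cV[R]_d) : `|a| <= frob a.
Proof.
apply: mx_norm_le => [|i j]; first exact: frob_ge0.
rewrite -ler_sqr ?nnegrE ?frob_ge0 // sqr_frob ord1 (bigD1 i) //=.
by rewrite real_normK ?num_real // lerDl sumr_ge0 // => k _; rewrite sqr_ge0.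
Qed.

Lemma mulmx_norm_le m n (A : 'M[R]_(m, n)) (a : 'cV[R]_n) :
  `|A *m a| <= n%:R * `|A| * `|a|.
Proof.
apply: mx_norm_le => [|i j]; first by rewrite !mulr_ge0.
rewrite mxE (le_trans (ler_norm_sum _ _ _)) //.
have -> : n%:R * `|A| * `|a| = \sum_(k < n) `|A| * `|a|.
  by rewrite sumr_const card_ord -mulrA mulr_natl.
by apply: ler_sum => k _; rewrite normrM ler_pM // mx_entry_le.
Qed.

Definition bilmx m n (A : 'M[R]_(m, n)) (a : 'cV[R]_m) (b : 'cV[R]_n) : R :=
  (a^T *m A *m b) 0 0.

Lemma bilmxE m n (A : 'M[R]_(m, n)) a b :
  bilmx A a b = \sum_i \sum_j a i 0 * b j 0 * A i j.
Proof.
rewrite /bilmx -mulmxA mxE; apply: eq_bigr => i _.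
by rewrite !mxE mulr_sumr; apply: eq_bigr => j _; ring.
Qed.

Lemma bilmxB m n (A B : 'M[R]_(m, n)) a b :
  bilmx (A - B) a b = bilmx A a b - bilmx B a b.
Proof. by rewrite /bilmx mulmxBr mulmxBl !mxE. Qed.

Definition bilmx_bound m n (a : 'cV[R]_m) (b : 'cV[R]_n) :=
  \sum_i \sum_j `|a i 0 * b j 0|.

Lemma bilmx_bound_ge0 m n (a : 'cV[R]_m) (b : 'cV[R]_n) : 0 <= bilmx_bound a b.
Proof. by apply: sumr_ge0 => i _; apply: sumr_ge0. Qed.

Lemma bilmx_le m n (A : 'M[R]_(m, n)) a b :
  `|bilmx A a b| <= bilmx_bound a b * `|A|.
Proof.
rewrite bilmxE (le_trans (ler_norm_sum _ _ _)) // mulr_suml.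
apply: ler_sum => i _; rewrite (le_trans (ler_norm_sum _ _ _)) // mulr_suml.
by apply: ler_sum => j _; rewrite normrM ler_wpM2l // mx_entry_le.
Qed.

Lemma cvg_bilmx m n (F : nat -> 'M[R]_(m, n)) A a b :
  F N @[N --> \oo] --> A -> bilmx (F N) a b @[N --> \oo] --> bilmx A a b.
Proof.
move=> FA; apply/cvgrPdist_le => e e0.
have c0 : 0 < bilmx_bound a b + 1 by rewrite ltr_wpDl // bilmx_bound_ge0.
move/cvgrPdist_le: FA => /(_ (e / (bilmx_bound a b + 1))).
rewrite divr_gt0 // => /(_ isT); apply: filterS => N FN.
rewrite -bilmxB (le_trans (bilmx_le _ _ _)) //.
rewrite (le_trans (ler_pM (bilmx_bound_ge0 _ _) (normr_ge0 _) (lexx _) FN)) //.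
rewrite mulrCA ler_piMr ?(ltW e0) // ler_pdivrMr // mul1r lerDl //.
Qed.

Lemma bilmx_delta d (A : 'M[R]_d) i j :
  bilmx A (delta_mx i 0) (delta_mx j 0) = A i j.
Proof. by rewrite /bilmx trmx_delta -rowE -colE !mxE. Qed.

Lemma bilmxDD d (A : 'M[R]_d) a b : bilmx A (a + b) (a + b) =
  bilmx A a a + bilmx A a b + bilmx A b a + bilmx A b b.
Proof.
by rewrite /bilmx [(a + b)^T]raddfD /= !mulmxDl !mulmxDr !mxE; ring.
Qed.

Lemma bilmx_sym_polar d (A : 'M[R]_d) : A^T = A ->
  (forall a, bilmx A a a = 0) -> A = 0.
Proof.
move=> As A0; apply/matrixP => i j; rewrite mxE -bilmx_delta.
have := A0 (delta_mx i 0 + delta_mx j 0).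
have := A0 (delta_mx i 0); have := A0 (delta_mx j 0).
have : bilmx A (delta_mx i 0) (delta_mx j 0) = bilmx A (delta_mx j 0) (delta_mx i 0).
  by rewrite !bilmx_delta -[in LHS]As mxE.
move=> e aj ai; rewrite bilmxDD ai aj -e addr0 add0r => /eqP.
by rewrite -mulr2n mulrn_eq0 /= => /eqP.
Qed.

End matrix_norms.

Section information_inequality.
Context {R : realType} {dX dY : measure_display}
  {X : measurableType dX} {Y : measurableType dY} {d : nat}.
Variables (PX : probability X R) (mu : {sigma_finite_measure set Y -> \bar R}).
Variables (w : X * Y -> R) (u s : 'I_d -> X * Y -> R) (c : R).
Hypotheses (mw : measurable_fun setT w) (w0 : forall z, 0 <= w z) (c0 : 0 <= c).
Hypotheses (Lu : forall i, wL2 PX mu w (u i)) (Ls : forall i, wL2 PX mu w (s i)).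
Variables V M Sigma : 'M[R]_d.
Hypotheses (VE : forall i j, V i j = c * wip PX mu w (u i) (u j))
  (ME : forall i j, M i j = - (c * wip PX mu w (u i) (s j)))
  (SE : forall i j, Sigma i j = c * wip PX mu w (s i) (s j)).

Local Notation ip := (wip PX mu w).
Let lin (a : 'cV[R]_d) (F : 'I_d -> X * Y -> R) z := \sum_i a i 0 * F i z.

Let Llin a F : (forall i, wL2 PX mu w (F i)) -> wL2 PX mu w (lin a F).
Proof. by move=> LF; exact: (wL2_lin mw w0 (fun i => a i 0) LF). Qed.

Let ip_lin F G a b (B : 'M[R]_d) :
  (forall i, wL2 PX mu w (F i)) -> (forall i, wL2 PX mu w (G i)) ->
  (forall i j, B i j = c * ip (F i) (G j)) ->
  c * ip (lin a F) (lin b G) = bilmx B a b.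
Proof.
move=> LF LG BE; rewrite bilmxE (wip_lin mw w0 (fun i => a i 0) (fun i => b i 0) LF LG).
rewrite mulr_sumr; apply: eq_bigr => i _; rewrite mulr_sumr; apply: eq_bigr => j _.
by rewrite BE; ring.
Qed.

Lemma bilmx_info_ge0 a b :
  0 <= bilmx V a a - 2 * bilmx M a b + bilmx Sigma b b.
Proof.
have La := Llin a Lu; have Lb := Llin b Ls; have Lab := wL2D mw w0 La Lb.
have -> : bilmx V a a - 2 * bilmx M a b + bilmx Sigma b b =
    c * ip (fun z => lin a u z + lin b s z) (fun z => lin a u z + lin b s z).
  rewrite -(ip_lin a a Lu Lu VE) -(ip_lin b b Ls Ls SE).
  have ME' i j : (- M) i j = c * ip (u i) (s j) by rewrite mxE ME opprK.
  have -> : bilmx M a b = - bilmx (- M) a b.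
    by rewrite -[in RHS](sub0r M) bilmxB [bilmx 0 _ _]bilmxE big1 ?sub0r ?opprK // => i _;
      rewrite big1 // => j _; rewrite mxE mulr0.
  rewrite -(ip_lin a b Lu Ls ME').
  rewrite (wip_sqrD mw w0 La Lb); ring.
by rewrite mulr_ge0 // wip_ge0.
Qed.

Variable K : 'M[R]_d.
Let t i z := u i z + \sum_j K i j * s j z.

Let Lt i : wL2 PX mu w (t i).
Proof. by apply: wL2D => //; exact: (wL2_lin mw w0 (K i) Ls). Qed.

Lemma wip_sum_sqr : \int[(PX \x mu)%E]_z (w z * \sum_i t i z ^+ 2) = \sum_i ip (t i) (t i).
Proof.
rewrite /wip -Rintegral_sum => [|i _]; last exact: wL2M.
by apply: eq_Rintegral => z _; rewrite mulr_sumr; apply: eq_bigr => i _; rewrite expr2.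
Qed.

Let T := c * \sum_i ip (t i) (t i).

Lemma bilmx_linear_defect a b (e : R) : 0 < e -> b = K^T *m a ->
  `|bilmx V a a - bilmx Sigma b b| <=
     (1 + e^-1) * bilmx_bound a a * T + e * bilmx Sigma b b.
Proof.
move=> e0 bE.
have Lb := Llin b Ls; have LT := Llin a Lt.
have aU : lin a u = (fun z => lin a t z - lin b s z).
  apply/funext => z; rewrite /lin /t bE.
  under [X in _ = X - _]eq_bigr do rewrite mulrDr.
  rewrite big_split /= -addrA -[LHS]addr0; congr (_ + _).
  under eq_bigr do rewrite mulr_sumr.
  rewrite exchange_big /= -sumrB big1 // => j _; rewrite mxE mulr_suml -sumrB big1 // => i _.
  by rewrite mxE; ring.
have tt_le i j : `|ip (t i) (t j)| <= \sum_k ip (t k) (t k).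
  have h1 : ip (t i) (t i) <= \sum_k ip (t k) (t k).
    by rewrite (bigD1 i) //= lerDl sumr_ge0 // => k _; exact: wip_ge0.
  have h2 : ip (t j) (t j) <= \sum_k ip (t k) (t k).
    by rewrite (bigD1 j) //= lerDl sumr_ge0 // => k _; exact: wip_ge0.
  have := wip_ge0 PX mu w0 (fun z => t i z + t j z).
  have := wip_ge0 PX mu w0 (fun z => t i z - t j z).
  rewrite (wip_sqrB mw w0 (Lt i) (Lt j)) (wip_sqrD mw w0 (Lt i) (Lt j)) => g1 g2.
  by rewrite ler_norml; apply/andP; split; lra.
have a_le : c * ip (lin a t) (lin a t) <= bilmx_bound a a * T.
  rewrite /T mulrCA ler_wpM2l // (wip_lin mw w0 (fun i => a i 0) (fun i => a i 0) Lt Lt).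
  rewrite mulr_suml; apply: ler_sum => i _; rewrite mulr_suml; apply: ler_sum => j _.
  by rewrite (le_trans (ler_norm _)) // normrM ler_wpM2l.
have V_E : bilmx V a a =
   c * ip (lin a t) (lin a t) - 2 * (c * ip (lin a t) (lin b s)) + bilmx Sigma b b.
  rewrite -(ip_lin a a Lu Lu VE) -(ip_lin b b Ls Ls SE) aU.
  rewrite (wip_sqrB mw w0 LT Lb); ring.
have SbE := ip_lin b b Ls Ls SE.
have cross k : 0 <= c * ip (lin a t) (lin a t) + 2 * k * (c * ip (lin a t) (lin b s)) +
     k ^+ 2 * bilmx Sigma b b.
  have := mulr_ge0 c0 (wip_ge0 PX mu w0 (fun z => lin a t z + k * lin b s z)).
  rewrite (wip_sqrZ mw w0 k LT Lb) -SbE.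
  by move=> h; apply: le_trans h _; rewrite le_eqVlt; apply/orP; left; apply/eqP; ring.
have A0 : 0 <= c * ip (lin a t) (lin a t) by rewrite mulr_ge0 // wip_ge0.
set A := c * ip (lin a t) (lin a t) in A0 a_le V_E cross *.
set C := c * ip (lin a t) (lin b s) in V_E cross *.
set S := bilmx Sigma b b in V_E cross *.
have c1 := cross e; have c2 := cross (- e).
have ei : 0 < e^-1 by rewrite invr_gt0.
have ee : e * e^-1 = 1 by rewrite mulfV // gt_eqF.
have d1 : 0 <= e^-1 * (A + 2 * e * C + e ^+ 2 * S) by rewrite mulr_ge0 // ltW.
have d2 : 0 <= e^-1 * (A + 2 * (- e) * C + (- e) ^+ 2 * S) by rewrite mulr_ge0 // ltW.
have f1 : e^-1 * (A + 2 * e * C + e ^+ 2 * S) = e^-1 * A + 2 * C + e * S.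
  by field; rewrite gt_eqF.
have f2 : e^-1 * (A + 2 * (- e) * C + (- e) ^+ 2 * S) = e^-1 * A - 2 * C + e * S.
  by field; rewrite gt_eqF.
rewrite f1 in d1; rewrite f2 in d2.
have g : (1 + e^-1) * A <= (1 + e^-1) * bilmx_bound a a * T.
  by rewrite -mulrA ler_wpM2l // addr_ge0 // ltW.
rewrite V_E addrK; apply: le_trans (_ : _ <= (1 + e^-1) * A + e * S) _; last by rewrite lerD2r.
by rewrite mulrDl mul1r ler_norml; apply/andP; split; lra.
Qed.

End information_inequality.

Lemma continuous_borel_measurable {R : realType} q (g : 'cV[R]_q -> R) :
  continuous g -> measurable_fun [set: borel R q] g.
Proof.
move=> cg; apply: (measurability (@RGenOInfty.G R)).
  exact: RGenOInfty.measurableE.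
move=> _ [_ [a ->] <-]; rewrite setTI; apply: sub_sigma_algebra.
by move/continuousP: cg; apply; exact: interval_open.
Qed.

Lemma continuous_sqr_frob {R : realType} d : continuous (fun a : 'cV[R]_d => frob a ^+ 2).
Proof.
have -> : (fun a : 'cV[R]_d => frob a ^+ 2) = (fun a => \sum_i a i 0 * a i 0).
  by apply/funext => a; rewrite sqr_frob; under eq_bigr do rewrite expr2.
elim: (index_enum _) => [|i r IH] a.
  rewrite (_ : (fun _ => _) = fun=> 0); first exact: cst_continuous.
  by apply/funext => b; rewrite big_nil.
rewrite (_ : (fun _ => _) = fun b : 'cV[R]_d => b i 0 * b i 0 + \sum_(j <- r) b j 0 * b j 0).
  apply: (continuousD (f := fun b : 'cV[R]_d => b i 0 * b i 0)); last exact: IH.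
  by apply: (continuousM (s := fun b : 'cV[R]_d => b i 0)); exact: coord_continuous.
by apply/funext => b; rewrite big_cons.
Qed.

Lemma continuous_frob {R : realType} d : continuous (@frob R d 1).
Proof.
move=> a; have -> : @frob R d 1 = (fun t => Num.sqrt (frob t ^+ 2)).
  by apply/funext => t; rewrite sqrtr_sqr ger0_norm // frob_ge0.
apply: continuous_comp; first exact: continuous_sqr_frob.
exact: sqrt_continuous.
Qed.

Lemma measurable_frob_sub {R : realType} q (v0 : 'cV[R]_q) :
  measurable_fun [set: borel R q] (fun v : borel R q => frob ((v : 'cV[R]_q) - v0)).
Proof.
have c : continuous (@frob R q 1 \o (fun v => v - v0)).
  move=> v; apply: continuous_comp; last exact: continuous_frob.
  apply: (continuousB (f := idfun) (g := cst v0)); last exact: cst_continuous.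
  by move=> A.
exact: continuous_borel_measurable c.
Qed.

Lemma posdef_unit {R : realType} d (S : 'M[R]_d) : posdef S -> S \in unitmx.
Proof.
move=> [_ S0]; rewrite -row_free_unit -kermx_eq0.
apply: contraT => /rowV0Pn[v /sub_kermxP vS v0].
have := S0 v^T; rewrite trmxK vS mul0mx mxE ltxx => -> //.
by apply: contra v0 => /eqP vt; rewrite -(trmxK v) vt trmx0.
Qed.

Section convergence_in_probability.
Context {R : realType} {dO : measure_display} {Om : measurableType dO}.
Variable P : probability Om R.

Lemma measurable_gt_norm (Z : Om -> R) e : measurable_fun setT Z ->
  measurable [set w | e < `|Z w|].
Proof.
move=> mZ; rewrite (_ : [set w | _] = (fun w => `|Z w|) @^-1` `]e, +oo[).
  by rewrite -[X in measurable X]setTI; apply: measurableT_comp.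
by apply/seteqP; split => w /=; rewrite in_itv /= andbT.
Qed.

Lemma oP1_near_le (Z1 Z2 : nat -> Om -> R) e1 e2 :
  (forall N, measurable_fun setT (Z1 N)) -> (forall N, measurable_fun setT (Z2 N)) ->
  oP1 P Z1 -> oP1 P Z2 -> 0 < e1 -> 0 < e2 ->
  \forall N \near \oo, exists w, `|Z1 N w| <= e1 /\ `|Z2 N w| <= e2.
Proof.
move=> m1 m2 o1 o2 e10 e20.
have lt_half Z e : oP1 P Z -> 0 < e -> \forall N \near \oo,
    (P [set w | (e < `|Z N w|)%R] < (2^-1)%:E)%E.
  move=> oZ e0; apply: (oZ _ e0 [set x | (x < (2^-1)%:E)%E]).
  apply: open_nbhs_nbhs; split; first exact: open_ereal_lt_ereal.
  by rewrite /= lte_fin invr_gt0.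
apply: filterS2 (lt_half _ _ o1 e10) (lt_half _ _ o2 e20) => N h1 h2.
apply: contrapT => nex.
have : (P setT < 1%:E)%E; last by rewrite probability_setT ltxx.
apply: (@le_lt_trans _ _ (P [set w | (e1 < `|Z1 N w|)%R] + P [set w | (e2 < `|Z2 N w|)%R])%E).
  have g1 := measurable_gt_norm e1 (m1 N); have g2 := measurable_gt_norm e2 (m2 N).
  apply: le_trans (measureU2 P g1 g2).
  apply: le_measure; rewrite ?inE //.
    exact: measurableU.
  move=> w _; apply: contrapT => /not_orP[/= /negP + /negP].
  by rewrite -!leNgt => a1 a2; apply: nex; exists w.
rewrite (_ : 1%:E = (2^-1)%:E + (2^-1)%:E)%E; last by rewrite -EFinD; congr EFin; field.
exact: lteD.
Qed.

End convergence_in_probability.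

Lemma limr_ge_of_cvg {R : realType} (F : nat -> R) (l c : R) :
  F @ \oo --> l -> (\forall N \near \oo, c <= F N) -> c <= l.
Proof. by move=> Fl cF; rewrite -(cvg_lim _ Fl) //; apply: limr_ge => //; exact: cvgP Fl. Qed.

Lemma near_ex3 (P1 P2 P3 : nat -> Prop) :
  (\forall N \near \oo, P1 N) -> (\forall N \near \oo, P2 N) ->
  (\forall N \near \oo, P3 N) -> exists N, [/\ P1 N, P2 N & P3 N].
Proof.
move=> [N1 _ h1] [N2 _ h2] [N3 _ h3]; exists (N1 + N2 + N3)%N.
by split; [apply: h1|apply: h2|apply: h3] => /=; lia.
Qed.

Section uniform_near.
Context {R : realType} {q m n : nat}.
Variables (B : set 'cV[R]_q) (v0 : 'cV[R]_q)
  (F : nat -> 'cV[R]_q -> 'M[R]_(m, n)) (G : 'cV[R]_q -> 'M[R]_(m, n)).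

Lemma uniform_near_le : open_nbhs v0 B ->
  (forall N, {for v0, continuous (F N)}) -> {uniform B, F @ \oo --> G} ->
  forall e, 0 < e -> exists2 r, 0 < r &
    \forall N \near \oo, forall v, `|v - v0| <= r -> B v /\ `|F N v - G v0| <= e.
Proof.
move=> [oB Bv0] cF uF e e0; have e4 : 0 < e / 4 by rewrite divr_gt0.
have : \forall N \near \oo, forall v, B v -> `|F N v - G v| <= e / 4.
  have : nbhs (G : {uniform` B -> 'M[R]_(m, n)})
      [set h | forall v, B v -> `|h v - G v| <= e / 4].
    apply/uniform_nbhs; exists [set xy | ball xy.1 (e / 4) xy.2]; split.
      exact: (entourage_ball _ (PosNum e4)).
    by move=> h /= hB v Bv; rewrite distrC ltW //; have := hB v Bv; rewrite -ball_normE.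
  by move/uF.
move=> nF; have [N0 _ hN0] := nF.
have hN := hN0 N0 (leqnn N0).
have : \forall v \near v0, B v /\ `|F N0 v0 - F N0 v| <= e / 4.
  apply: filterI; first exact: open_nbhs_nbhs.
  by have := cF N0 => /cvgrPdist_le; apply.
move/nbhs_ballP => [r /= r0 hr]; exists (r / 2); first by rewrite divr_gt0.
apply: filterS nF => N hFN v vr.
have [Bv Fv] : B v /\ `|F N0 v0 - F N0 v| <= e / 4.
  apply: hr; rewrite -ball_normE /= distrC (le_lt_trans vr) //.
  by rewrite ltr_pdivrMr // ltr_pMr // ltr1n.
split=> //.
have h1 := hFN v Bv; have h2 := hN v Bv; have h3 := hN v0 Bv0.
have -> : F N v - G v0 = (F N v - G v) - (F N0 v - G v) - (F N0 v0 - F N0 v)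
     + (F N0 v0 - G v0).
  by rewrite !opprB; apply/matrixP => i j; rewrite !mxE; ring.
have t1 := ler_normD (F N v - G v - (F N0 v - G v) - (F N0 v0 - F N0 v)) (F N0 v0 - G v0).
have t2 := ler_normB (F N v - G v - (F N0 v - G v)) (F N0 v0 - F N0 v).
have t3 := ler_normB (F N v - G v) (F N0 v - G v).
lra.
Qed.

End uniform_near.

Section sampled_information.
Context {R : realType} {dX dY dO : measure_display}
  {X : measurableType dX} {Y : measurableType dY} {Om : measurableType dO}
  {d q : nat}.
Variables (PX : probability X R) (mu : {sigma_finite_measure set Y -> \bar R})
  (Theta : set 'cV[R]_d) (theta : 'cV[R]_d)
  (f : 'cV[R]_d -> X -> Y -> R).
Hypotheses (hTheta : Theta° theta)
  (hf : is_conditional_density mu f Theta)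
  (hf_diff : \forall x \ae PX, \forall y \ae mu,
     differentiable (fun t => f t x y) theta)
  (hscore : forall k, measurable_fun setT
     (fun z : X * Y => score f theta z.1 z.2 k 0)).
Variables (pi : nat -> 'cV[R]_q -> X -> Y -> R) (n : nat -> R).
Hypotheses (hpi_meas : forall N, measurable_fun setT
     (fun z : X * Y * borel R q => pi N z.2 z.1.1 z.1.2))
  (hpi : forall N vt x y, 0 < pi N vt x y <= 1)
  (hn : forall N vt, (0 < N)%N ->
     Exp PX mu f pi N theta vt (fun x y _ => pi N vt x y) = n N / N%:R).
Variable U : nat -> 'cV[R]_q -> 'cV[R]_d -> X -> Y -> 'cV[R]_d.
Hypotheses (hU_meas : forall N t j, Theta t -> measurable_fun setT
     (fun z : X * Y * borel R q => U N z.2 t z.1.1 z.1.2 j 0))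
  (hU_diff : forall N vt, \forall x \ae PX, \forall y \ae mu,
     differentiable (fun t => U N vt t x y) theta)
  (hU_unbiased : conditionally_unbiased PX mu f pi U Theta)
  (hU_swap : forall N vt, diff_under_integral PX mu f pi U N theta vt).
Variables (B : set 'cV[R]_q) (vtp : 'cV[R]_q) (M V Sigma : 'M[R]_d).
Hypotheses (hB : open_nbhs vtp B)
  (hM_fin : forall N vt, B vt -> finite_Emx PX mu f pi N theta vt
     (fun x y b => b%:R *: jac (fun t => U N vt t x y) theta))
  (hM_cvg : MN PX mu f pi n U N theta vtp @[N --> \oo] --> M)
  (hM_rank : \rank M = d)
  (hV_fin : forall N vt, B vt -> finite_Emx PX mu f pi N theta vt
     (fun x y b => b%:R *: outer (U N vt theta x y)))
  (hV_cvg : VN PX mu f pi n U N theta vtp @[N --> \oo] --> V)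
  (hSigma_fin : forall N vt, B vt -> finite_Emx PX mu f pi N theta vt
     (fun x y _ => pi N vt x y *: outer (score f theta x y)))
  (hSigma_cvg : SigmaN PX mu f pi n N theta vtp @[N --> \oo] --> Sigma)
  (hSigma_pd : posdef Sigma).

Local Notation w N v := (sampled_density theta f pi N v).
Local Notation u N v := (U_c theta N v U).
Local Notation s N v := (scoreS_c mu theta f pi N v).
Local Notation m := (PX \x mu)%E.

Let mw N v : measurable_fun setT (w N v) := measurable_w hTheta hf v (hpi_meas N).
Let w0 N v z : 0 <= w N v z := w_ge0 hTheta hf N v hpi z.

Lemma n_gt0 N : (0 < N)%N -> 0 < n N.
Proof.
move=> N0; have := hn vtp N0.
rewrite (Exp_fun PX mu theta f pi N vtp (pi N vtp)).
have wi := Rintegrable_w PX hTheta hf vtp (hpi_meas N) hpi.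
have wm := wmass_gt0 hTheta hf vtp (hpi_meas N) hpi.
have : 0 < \int[m]_z w N vtp z.
  rewrite lt0r Rintegral_ge0 ?andbT => [|z _]; last exact: w0.
  apply/negP => /eqP; rewrite Rfubini // => w00.
  have mm : measurable_fun setT (wmass mu (w N vtp)).
    by apply: measurable_wmass; exact: mw.
  have mi : Rintegrable PX (wmass mu (w N vtp)) := Rintegrable_fubini wi.
  have : (\int[PX]_x `|(wmass mu (w N vtp) x)%:E| = 0)%E.
    under eq_integral do rewrite gee0_abs ?lee_fin ?(ltW (wm _)) //.
    by rewrite RintegralE // /wmass w00.
  move/(ae_eq_integral_abs PX measurableT (measurable_int PX mi)) => ae0.
  have : (\int[PX]_x (1%:E : \bar R) = 0)%E.
    rewrite -[RHS](integral0 PX setT); apply: ae_eq_integral => //.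
    apply: filterS ae0 => x /(_ I) /= [] h _.
    by have := wm x; rewrite h ltxx.
  by rewrite integral_cst //= probability_setT mule1 => -[] /eqP; rewrite oner_eq0.
by move=> h e; move: h; rewrite /sampled_density e pmulr_lgt0 // invr_gt0 ltr0n.
Qed.

Lemma ratio_ge0 N : 0 <= N%:R / n N.
Proof.
case: N => [|N]; first by rewrite mul0r.
by rewrite divr_ge0 // ltW // n_gt0.
Qed.

Lemma moments_info N v a b : B v ->
  0 <= bilmx (VN PX mu f pi n U N theta v) a a
     - 2 * bilmx (MN PX mu f pi n U N theta v) a b
     + bilmx (SigmaN PX mu f pi n N theta v) b b.
Proof.
move=> Bv; have T0 := Theta_theta hTheta.
apply: (bilmx_info_ge0 (mw N v) (w0 N v) (ratio_ge0 N) (u := u N v) (s := s N v)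
  (PX := PX) (mu := mu)).
- move=> i; apply: (wL2_U (fun j => hU_meas N j T0) (hV_fin N Bv)).
- move=> i; apply: (wL2_scoreS hTheta hf hscore (hpi_meas N) hpi (hSigma_fin N Bv)).
- by move=> i j; rewrite VN_wip.
- exact: (MN_wip hTheta hf hf_diff hscore n (hpi_meas N) hpi (hSigma_fin N Bv)
   (fun j => hU_meas N j T0) (hV_fin N Bv) (hU_diff N v) hU_unbiased (hU_swap N v)
   (hM_fin N Bv)).
- exact: (SigmaN_wip hTheta hf hscore n (hpi_meas N) hpi (hSigma_fin N Bv)).
Qed.

Lemma V_sym : V^T = V.
Proof.
apply/matrixP => i j; rewrite mxE -!bilmx_delta.
have h1 := cvg_bilmx (a := delta_mx i 0) (b := delta_mx j 0) hV_cvg.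
have h2 := cvg_bilmx (a := delta_mx j 0) (b := delta_mx i 0) hV_cvg.
have E : (fun N => bilmx (VN PX mu f pi n U N theta vtp) (delta_mx j 0) (delta_mx i 0)) =
  (fun N => bilmx (VN PX mu f pi n U N theta vtp) (delta_mx i 0) (delta_mx j 0)).
  by apply/funext => N; rewrite !bilmx_delta !VN_wip wipC.
by rewrite E in h2; exact: cvg_unique h2 h1.
Qed.

Lemma limit_info a b :
  0 <= bilmx V a a - 2 * bilmx M a b + bilmx Sigma b b.
Proof.
have h1 := cvg_bilmx (a := a) (b := a) hV_cvg.
have h2 := cvg_bilmx (a := a) (b := b) hM_cvg.
have h3 := cvg_bilmx (a := b) (b := b) hSigma_cvg.
have h := cvgD (cvgB h1 (cvgM (cvg_cst (2 : R)) h2)) h3.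
have := @limr_ge_of_cvg R _ _ 0 (h _ _ _ _); apply.
apply: nearW => N; apply: moments_info.
exact: (nbhs_singleton (open_nbhs_nbhs hB)).
Qed.

Lemma M_unit : M \in unitmx.
Proof. by rewrite -row_free_unit /row_free hM_rank. Qed.

Lemma information_bound :
  loewner_ge (invmx M *m V *m (invmx M)^T) (invmx Sigma).
Proof.
have Su := posdef_unit hSigma_pd; have Ss := hSigma_pd.1.
have Sis : (invmx Sigma)^T = invmx Sigma by rewrite trmx_inv Ss.
split.
  by rewrite raddfB /= Sis !trmx_mul trmxK V_sym mulmxA.
move=> c; pose a := (invmx M)^T *m c; pose b := invmx Sigma *m c.
have := limit_info a b.
have -> : bilmx M a b = (c^T *m invmx Sigma *m c) 0 0.
  by rewrite /bilmx /a /b trmx_mul trmxK !mulmxA mulmxKV // M_unit.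
have -> : bilmx Sigma b b = (c^T *m invmx Sigma *m c) 0 0.
  by rewrite /bilmx /b trmx_mul Sis !mulmxA mulmxKV.
have -> : bilmx V a a = (c^T *m (invmx M *m V *m (invmx M)^T) *m c) 0 0.
  by rewrite /bilmx /a trmx_mul trmxK !mulmxA.
by rewrite mulmxBr mulmxBl !mxE => h; lra.
Qed.

Section pilot.
Variables (P : probability Om R) (pilot : nat -> Om -> borel R q).
Hypotheses (hpilot_meas : forall N, measurable_fun setT (pilot N))
  (hpilot_cvg : oP1 P (fun N w => frob ((pilot N w : 'cV[R]_q) - vtp))).

Lemma measurable_w_joint N :
  measurable_fun setT (fun z : borel R q * (X * Y) => w N z.1 z.2).
Proof.
apply: measurable_funM.
  apply: (measurableT_comp (f := fun z : X * Y * borel R q => pi N z.2 z.1.1 z.1.2)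
    (g := fun z : borel R q * (X * Y) => (z.2, z.1))) => //.
  exact: measurable_fun_pair.
apply: (measurableT_comp (f := fun z : X * Y => f theta z.1 z.2)) => //.
exact: measurable_density hTheta hf.
Qed.

Lemma measurable_U_joint N j :
  measurable_fun setT (fun z : borel R q * (X * Y) => u N z.1 j z.2).
Proof.
apply: (measurableT_comp (f := fun z : X * Y * borel R q => U N z.2 theta z.1.1 z.1.2 j 0)
    (g := fun z : borel R q * (X * Y) => (z.2, z.1))).
  exact: hU_meas (Theta_theta hTheta).
exact: measurable_fun_pair.
Qed.

Lemma measurable_scoreS_joint N j :
  measurable_fun setT (fun z : borel R q * (X * Y) => s N z.1 j z.2).
Proof.
have mswap : measurable_fun setT
    (fun t : borel R q * X * Y => (t.1.1, (t.1.2, t.2))).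
  apply: measurable_fun_pair; first exact: measurableT_comp.
  by apply: measurable_fun_pair => //; exact: measurableT_comp.
have mw3 : measurable_fun setT (fun t : borel R q * X * Y => w N t.1.1 (t.1.2, t.2)).
  exact: (measurableT_comp (measurable_w_joint N) mswap).
have ms3 : measurable_fun setT (fun t : borel R q * X * Y =>
    score_c theta f j (t.1.2, t.2)).
  apply: (measurableT_comp (hscore j) (g := fun t : borel R q * X * Y => (t.1.2, t.2))).
  by apply: measurable_fun_pair => //; exact: measurableT_comp.
have mproj : measurable_fun setT (fun t : borel R q * X =>
    wproj mu (w N t.1) (score_c theta f j) t.2).
  apply: measurable_funM.
    apply: (measurable_inv_pos (f := fun t : borel R q * X => wmass mu (w N t.1) t.2)).
      exact: (measurable_Rintegral mu mw3).
    by move=> t; exact: (wmass_gt0 hTheta hf _ (hpi_meas N) hpi).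
  apply: (measurable_Rintegral mu (f := fun t : borel R q * X * Y =>
    w N t.1.1 (t.1.2, t.2) * score_c theta f j (t.1.2, t.2))).
  exact: measurable_funM.
apply: measurable_funB.
  exact: (measurableT_comp (hscore j)).
apply: (measurableT_comp mproj (g := fun z : borel R q * (X * Y) => (z.1, z.2.1))).
by apply: measurable_fun_pair => //; exact: measurableT_comp.
Qed.

Lemma measurable_mean_sq_TN K N : measurable_fun [set: borel R q]
  (fun v : borel R q => mean_sq_TN PX mu f pi n U K Sigma N theta v).
Proof.
under eq_fun do rewrite mean_sq_TN_wip.
apply: measurable_funM => //.
apply: (measurable_Rintegral_prod PX mu (f := fun t : borel R q * (X * Y) =>
  w N t.1 t.2 *
  \sum_i (u N t.1 i t.2 + \sum_j (K *m invmx Sigma) i j * s N t.1 j t.2) ^+ 2)).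
apply: measurable_funM; first exact: measurable_w_joint.
apply: measurable_sum => i; apply: measurable_funX.
apply: measurable_funD; first exact: measurable_U_joint.
apply: measurable_sum => j; apply: measurable_funM => //.
exact: measurable_scoreS_joint.
Qed.

Variables (Vf Sf : 'cV[R]_q -> 'M[R]_d).
Hypotheses (VfE : Vf vtp = V) (SfE : Sf vtp = Sigma)
  (hV_cont : forall N, {for vtp, continuous (fun v => VN PX mu f pi n U N theta v)})
  (hSigma_cont : forall N, {for vtp, continuous (fun v => SigmaN PX mu f pi n N theta v)}).

Lemma information_equality :
  {uniform B, (fun N => VN PX mu f pi n U N theta) @ \oo --> Vf} ->
  {uniform B, (fun N => SigmaN PX mu f pi n N theta) @ \oo --> Sf} ->
  oP1 P (fun N w => mean_sq_TN PX mu f pi n U M Sigma N theta (pilot N w)) ->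
  invmx M *m V *m (invmx M)^T = invmx Sigma.
Proof.
move=> uV uS oT; have T0 := Theta_theta hTheta.
have Su := posdef_unit hSigma_pd; have Ss := hSigma_pd.1.
pose K := M *m invmx Sigma.
have key a : bilmx V a a = bilmx Sigma (K^T *m a) (K^T *m a).
  set b := K^T *m a.
  pose Ca := bilmx_bound a a; pose Cb := bilmx_bound b b.
  have Ca0 : 0 <= Ca by exact: bilmx_bound_ge0.
  have Cb0 : 0 <= Cb by exact: bilmx_bound_ge0.
  pose C := Ca + 2 * Ca + Cb * (`|Sigma| + 1) + Cb.
  have C0 : 0 <= C by rewrite !addr_ge0 // mulr_ge0 // ?addr_ge0.
  suff h e : 0 < e -> e < 1 -> `|bilmx V a a - bilmx Sigma b b| <= C * e.
    apply/eqP; rewrite -subr_eq0 -normr_le0 leNgt; apply/negP => D0.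
    set D := `|_| in h D0.
    have e0 : 0 < D / (2 * (C + D + 1)) by rewrite divr_gt0 // mulr_gt0 //; lra.
    have := h _ e0; rewrite ltr_pdivrMr ?mulr_gt0 //; [|lra].
    have -> : D < 1 * (2 * (C + D + 1)) by lra.
    move=> /(_ isT); apply/negP; rewrite -ltNge mulrA ltr_pdivrMr ?mulr_gt0 //; last lra.
    nra.
  move=> e0 e1.
  have [r1 r10 h1] := uniform_near_le hB hV_cont uV e0.
  have [r2 r20 h2] := uniform_near_le hB hSigma_cont uS e0.
  have mT N : measurable_fun setT (fun w =>
      mean_sq_TN PX mu f pi n U M Sigma N theta (pilot N w)).
    exact: (measurableT_comp (measurable_mean_sq_TN M N) (hpilot_meas N)).
  have mF N : measurable_fun setT (fun w => frob ((pilot N w : 'cV[R]_q) - vtp)).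
    exact: (measurableT_comp (measurable_frob_sub vtp) (hpilot_meas N)).
  have r0 : 0 < Num.min r1 r2 by rewrite lt_min r10.
  have e20 : 0 < e ^+ 2 by rewrite exprn_gt0.
  have h3 := oP1_near_le mF mT hpilot_cvg oT r0 e20.
  have [N [{}h1 {}h2 [wp []]]] := near_ex3 h1 h2 h3.
  rewrite ger0_norm ?frob_ge0 // le_min => /andP[d1 d2] tle.
  pose v := pilot N wp : 'cV[R]_q.
  have [Bv Vv] := h1 v (le_trans (norm_le_frob _) d1).
  have [_ Sv] := h2 v (le_trans (norm_le_frob _) d2).
  have defect := bilmx_linear_defect (mw N v) (w0 N v) (ratio_ge0 N)
    (fun i => wL2_U (fun j => hU_meas N j T0) (hV_fin N Bv) i)
    (fun i => wL2_scoreS hTheta hf hscore (hpi_meas N) hpi (hSigma_fin N Bv) i)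
    (VN_wip PX mu theta f pi n N v U)
    (SigmaN_wip hTheta hf hscore n (hpi_meas N) hpi (hSigma_fin N Bv))
    e0 (erefl b).
  rewrite -/v mean_sq_TN_wip -/K (wip_sum_sqr (mw N v) (w0 N v)
    (fun i => wL2_U (fun j => hU_meas N j T0) (hV_fin N Bv) i)
    (fun i => wL2_scoreS hTheta hf hscore (hpi_meas N) hpi (hSigma_fin N Bv) i)) in tle.
  set t := N%:R / n N * _ in tle defect.
  set Vn := VN _ _ _ _ _ _ _ _ _ in defect Vv.
  set Sn := SigmaN _ _ _ _ _ _ _ _ in defect Sv.
  rewrite VfE in Vv; rewrite SfE in Sv.
  have b1 : `|bilmx Vn a a - bilmx V a a| <= Ca * e.
    by rewrite -bilmxB (le_trans (bilmx_le _ _ _)) // ler_wpM2l.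
  have b2 : `|bilmx Sn b b - bilmx Sigma b b| <= Cb * e.
    by rewrite -bilmxB (le_trans (bilmx_le _ _ _)) // ler_wpM2l.
  have b3 : bilmx Sn b b <= Cb * (`|Sigma| + 1).
    rewrite (le_trans (ler_norm _)) // (le_trans (bilmx_le _ _ _)) // ler_wpM2l //.
    rewrite -[Sn](subrK Sigma) (le_trans (ler_normD _ _)) // addrC lerD2l.
    exact: le_trans Sv (ltW e1).
  have t1 : t <= e ^+ 2 by exact: le_trans (ler_norm _) tle.
  have t2 : (1 + e^-1) * Ca * t <= 2 * Ca * e.
    have -> : 2 * Ca * e = Ca * (2 * e) by ring.
    rewrite mulrAC mulrC ler_wpM2l // .
    apply: le_trans (_ : (1 + e^-1) * e ^+ 2 <= _).
      by rewrite ler_wpM2l // addr_ge0 // invr_ge0 ltW.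
    have ee : e^-1 * e ^+ 2 = e by rewrite expr2 mulrA mulVf ?mul1r // gt_eqF.
    rewrite mulrDl mul1r ee; nra.
  have t3 : e * bilmx Sn b b <= e * (Cb * (`|Sigma| + 1)) by rewrite ler_wpM2l // ltW.
  have -> : bilmx V a a - bilmx Sigma b b = (bilmx Vn a a - bilmx Sn b b)
    - (bilmx Vn a a - bilmx V a a) + (bilmx Sn b b - bilmx Sigma b b) by ring.
  have n1 := ler_normD (bilmx Vn a a - bilmx Sn b b
    - (bilmx Vn a a - bilmx V a a)) (bilmx Sn b b - bilmx Sigma b b).
  have n2 := ler_normB (bilmx Vn a a - bilmx Sn b b) (bilmx Vn a a - bilmx V a a).
  rewrite -/Ca in defect; have CE : C * e = Ca * e + 2 * Ca * e +
    e * (Cb * (`|Sigma| + 1)) + Cb * e by rewrite /C; ring.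
  rewrite CE; lra.
have VE : V = K *m Sigma *m K^T.
  apply/eqP; rewrite -subr_eq0; apply/eqP; apply: bilmx_sym_polar.
    by rewrite raddfB /= V_sym [in LHS]trmx_mul trmxK [(K *m _)^T]trmx_mul Ss mulmxA.
  move=> a; rewrite bilmxB key; apply/eqP; rewrite subr_eq0; apply/eqP.
  by rewrite /bilmx trmx_mul trmxK !mulmxA.
have Sis : (invmx Sigma)^T = invmx Sigma by rewrite trmx_inv Ss.
rewrite VE /K trmx_mul Sis !mulmxA mulVmx ?M_unit // mul1mx mulVmx // mul1mx.
by rewrite -mulmxA -trmx_mul mulVmx ?M_unit // trmx1 mulmx1.
Qed.

End pilot.

End sampled_information.

Lemma measurable_to_borel {R : realType} d dT (T : measurableType dT)
    (phi : T -> borel R d) :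
  (forall i, measurable_fun setT (fun t => (phi t : 'cV[R]_d) i 0)) ->
  measurable_fun setT phi.
Proof.
move=> mphi; apply: (@measurability _ _ T (borel R d) setT phi (@open 'cV[R]_d)) => //.
move=> _ [A oA <-]; rewrite setTI.
pose box (c : 'cV[rat]_d * nat) : set 'cV[R]_d :=
  [set x | forall i, `|x i 0 - ratr (c.1 i 0)| < c.2.+1%:R^-1].
have mbox c : measurable (phi @^-1` box c).
  have -> : phi @^-1` box c = \bigcap_(i in [set: 'I_d])
      [set t | `|(phi t : 'cV[R]_d) i 0 - ratr (c.1 i 0)| < c.2.+1%:R^-1].
    by apply/seteqP; split => [t h i _|t h i]; [exact: h|exact: (h i I)].
  apply: fin_bigcap_measurable; first exact: finite_finset.
  move=> i _.
  rewrite (_ : [set t | _] =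
     (fun t => `|(phi t : 'cV[R]_d) i 0 - ratr (c.1 i 0)|) @^-1` `]-oo, c.2.+1%:R^-1[).
    rewrite -[X in measurable X]setTI; apply: measurableT_comp => //.
    by apply: measurable_funB => //; exact: mphi.
  by apply/seteqP; split => t /=; rewrite in_itv.
have -> : phi @^-1` A = \bigcup_(c in [set c | box c `<=` A]) (phi @^-1` box c).
  apply/seteqP; split => [t At|t [c cA ct]]; last exact: cA.
  have [e /= e0 eA] := (nbhs_ballP _ _).1 (open_nbhs_nbhs (conj oA At)).
  have e2 : 0 < e / 2 by rewrite divr_gt0.
  have [k _ hk] := near_infty_natSinv_lt (PosNum e2).
  pose r : R := k.+1%:R^-1.
  have r0 : 0 < r by rewrite invr_gt0.
  have re : r < e / 2 by exact: hk k (leqnn k).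
  have ex i : exists c : rat, `|(phi t : 'cV[R]_d) i 0 - ratr c| < r.
    have := @rat_in_itvoo R ((phi t : 'cV[R]_d) i 0 - r) ((phi t : 'cV[R]_d) i 0 + r).
    case; first by rewrite ltrD2l gtrN.
    move=> c; rewrite in_itv /= => /andP[c1 c2]; exists c.
    by rewrite ltr_norml; apply/andP; split; lra.
  pose c : 'cV[rat]_d := \col_i xchoose (ex i).
  have cP i : `|(phi t : 'cV[R]_d) i 0 - ratr (c i 0)| < r.
    by rewrite mxE; exact: (xchooseP (ex i)).
  exists (c, k) => //= x bx; apply: eA.
  rewrite -ball_normE /ball_ /=; apply: le_lt_trans (_ : _ <= 2 * r) _; last lra.
  apply: mx_norm_le => [|i j]; first by rewrite mulr_ge0 // ltW.
  rewrite ord1 !mxE; have := cP i; have := bx i; rewrite /= -/r.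
  rewrite !ltr_norml ler_norml => /andP[? ?] /andP[? ?].
  by apply/andP; split; lra.
rewrite bigcup_mkcond; apply: countable_bigcupT_measurable; first exact: countableP.
by move=> c; case: ifP.
Qed.

Section density_measure.
Local Open Scope ereal_scope.
Context {R : realType} {dT dS : measure_display} {T : measurableType dT}
  {S : measurableType dS}.
Variables (m : {measure set T -> \bar R}) (k : T -> R) (phi : T -> S).
Hypotheses (mphi : measurable_fun setT phi) (mk : measurable_fun setT k) (k0 : forall x, (0 <= k x)%R).

Definition mdensity (A : set S) : \bar R := \int[m]_(x in phi @^-1` A) (k x)%:E.

Let mphi_preimage A : measurable A -> measurable (phi @^-1` A).
Proof. by move=> mA; rewrite -[X in measurable X]setTI; exact: mphi. Qed.

Let mdensity0 : mdensity set0 = 0.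
Proof. by rewrite /mdensity preimage_set0 integral_set0. Qed.

Let mdensity_ge0 A : 0 <= mdensity A.
Proof. by apply: integral_ge0 => x _; rewrite lee_fin. Qed.

Let mkE : measurable_fun setT (EFin \o k).
Proof. exact/measurable_EFinP. Qed.

Let mdensity_sigma : semi_sigma_additive mdensity.
Proof.
move=> F mF tF mUF; rewrite /mdensity preimage_bigcup ge0_integral_bigcup //.
- by apply: is_cvg_ereal_nneg_natsum_cond => i _ _; exact: mdensity_ge0.
- by move=> i; exact: mphi_preimage.
- exact: measurable_funTS.
- by move=> x _; rewrite lee_fin.
- apply/trivIsetP => i j _ _ ij; rewrite -preimage_setI.
  by move/trivIsetP : tF => /(_ _ _ I I ij) ->; rewrite preimage_set0.
Qed.

HB.instance Definition _ := isMeasure.Build _ _ _ mdensity mdensity0 mdensity_ge0 mdensity_sigma.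

Import HBNNSimple.

Let integral_mdensity_nnsfun (h : {nnsfun S >-> R}) :
  \int[mdensity]_x (h x)%:E = \int[m]_x ((h (phi x))%:E * (k x)%:E).
Proof.
have Eh x : (h x)%:E = \sum_(y \in range h) (y * \1_(h @^-1` [set y]) x)%:E.
  by rewrite fsumEFin // -fimfunE.
have ind y : measurable_fun setT (fun x => (y * \1_(h @^-1` [set y]) x)%:E).
  by apply/measurable_EFinP; apply: measurable_funM.
have indp y : measurable_fun setT (fun x => (y * \1_(h @^-1` [set y]) (phi x))%:E).
  exact: (measurableT_comp (ind y) mphi).
under [LHS]eq_integral do rewrite Eh.
rewrite ge0_integral_fsum //; last by move=> y x _; exact: nnfun_muleindic_ge0.
transitivity (\int[m]_x (\sum_(y \in range h)
    ((y * \1_(h @^-1` [set y]) (phi x))%:E * (k x)%:E))); last first.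
  apply: eq_integral => x _; rewrite Eh ge0_mule_fsuml // => y.
  exact: nnfun_muleindic_ge0.
rewrite ge0_integral_fsum //; first last.
- by move=> y x _; apply: mule_ge0; [exact: nnfun_muleindic_ge0|rewrite lee_fin].
- by move=> y; apply: emeasurable_funM.
apply: eq_fsbigr => y; rewrite inE => -[t _ <-].
under [LHS]eq_integral do rewrite EFinM.
have i1 : measurable_fun setT (fun x => (\1_(h @^-1` [set h t]) x)%:E : \bar R).
  exact/measurable_EFinP.
have i1p := measurableT_comp i1 mphi.
have i0 x : setT x -> (0 : \bar R) <= (\1_(h @^-1` [set h t]) x)%:E by rewrite lee_fin.
have ik0 x : setT x -> 0 <= (\1_(h @^-1` [set h t]) (phi x))%:E * (k x)%:E.
  by move=> _; rewrite mule_ge0 ?lee_fin.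
rewrite (ge0_integralZl _ measurableT i1 i0) ?lee_fin // integral_indic // setIT.
under [RHS]eq_integral do rewrite EFinM -muleA.
rewrite (ge0_integralZl _ measurableT (emeasurable_funM i1p mkE) ik0) ?lee_fin //.
congr (_ * _); rewrite -[LHS]/(\int[m]_(x in phi @^-1` (h @^-1` [set h t])) (k x)%:E).
rewrite [LHS]integral_mkcond.
by apply: eq_integral => x _; rewrite muleC epatch_indic /= !indicE.
Qed.

Lemma integral_mdensity (f : S -> \bar R) : measurable_fun setT f ->
  (forall x, 0 <= f x) -> \int[mdensity]_x f x = \int[m]_x (f (phi x) * (k x)%:E).
Proof.
move=> mf f0; pose h := nnsfun_approx measurableT mf.
have cvgf x : (EFin \o h i) x @[i --> \oo] --> f x by exact: cvg_nnsfun_approx.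
transitivity (lim (\int[mdensity]_x (h i x)%:E @[i --> \oo])).
  rewrite -monotone_convergence //.
  - by apply: eq_integral => x _; apply/esym/cvg_lim => //; exact: cvgf.
  - by move=> i; apply/measurable_EFinP.
  - by move=> i x _; rewrite lee_fin.
  - by move=> x _ a b ab; rewrite lee_fin; exact/lefP/nd_nnsfun_approx.
under eq_fun do rewrite integral_mdensity_nnsfun.
rewrite -monotone_convergence //.
- apply: eq_integral => x _; apply/cvg_lim => //; apply: cvgeZr => //.
  exact: cvgf.
- move=> i; apply: emeasurable_funM => //; apply/measurable_EFinP.
  exact: measurableT_comp.
- by move=> i x _; rewrite mule_ge0 ?lee_fin.
- move=> x _ a b ab; rewrite lee_wpmul2r ?lee_fin //.
  exact/lefP/nd_nnsfun_approx.
Qed.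

Definition density_measure : {measure set S -> \bar R} := mdensity.

End density_measure.

Section pi_system_integrals.
Local Open Scope ereal_scope.
Context {R : realType} {d1 d2 dS : measure_display} {T1 : measurableType d1}
  {T2 : measurableType d2} {S : measurableType dS}.
Variables (m1 : {measure set T1 -> \bar R}) (m2 : {measure set T2 -> \bar R})
  (k1 : T1 -> R) (k2 : T2 -> R) (phi1 : T1 -> S) (phi2 : T2 -> S)
  (G : set (set S)).
Hypotheses (mk1 : measurable_fun setT k1) (mk2 : measurable_fun setT k2)
  (k10 : forall x, (0 <= k1 x)%R) (k20 : forall x, (0 <= k2 x)%R)
  (mphi1 : measurable_fun setT phi1) (mphi2 : measurable_fun setT phi2).
Hypotheses (mG : measurable = <<s G >>) (GI : setI_closed G) (GT : G setT)
  (fin1 : \int[m1]_x (k1 x)%:E < +oo)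
  (eqG : forall A, G A -> \int[m1]_(x in phi1 @^-1` A) (k1 x)%:E =
                          \int[m2]_(x in phi2 @^-1` A) (k2 x)%:E).

Lemma pi_system_integral_eq (F : S -> \bar R) : measurable_fun setT F ->
  (forall x, 0 <= F x) ->
  \int[m1]_x (F (phi1 x) * (k1 x)%:E) = \int[m2]_x (F (phi2 x) * (k2 x)%:E).
Proof.
move=> mF F0.
rewrite -(integral_mdensity m1 mphi1 mk1 k10 mF F0).
rewrite -(integral_mdensity m2 mphi2 mk2 k20 mF F0).
apply: eq_measure_integral => A mA _.
apply: (@measure_unique _ _ _ G (fun=> setT) mG GI (fun=> GT) _
  (density_measure m1 mphi1 mk1 k10) (density_measure m2 mphi2 mk2 k20)) => //.
by rewrite bigcup_const.
Qed.

End pi_system_integrals.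

Section pi_system_Rintegrals.
Context {R : realType} {d1 d2 dS : measure_display} {T1 : measurableType d1}
  {T2 : measurableType d2} {S : measurableType dS}.
Variables (m1 : {measure set T1 -> \bar R}) (m2 : {measure set T2 -> \bar R})
  (k1 : T1 -> R) (k2 : T2 -> R) (phi1 : T1 -> S) (phi2 : T2 -> S)
  (G : set (set S)).
Hypotheses (mk1 : measurable_fun setT k1) (mk2 : measurable_fun setT k2)
  (k10 : forall x, (0 <= k1 x)%R) (k20 : forall x, (0 <= k2 x)%R)
  (mphi1 : measurable_fun setT phi1) (mphi2 : measurable_fun setT phi2).
Hypotheses (mG : measurable = <<s G >>) (GI : setI_closed G) (GT : G setT)
  (fin1 : (\int[m1]_x (k1 x)%:E < +oo)%E)
  (eqG : forall A, G A -> (\int[m1]_(x in phi1 @^-1` A) (k1 x)%:E =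
                          \int[m2]_(x in phi2 @^-1` A) (k2 x)%:E)%E).

Let ge0_eq (F : S -> R) : measurable_fun setT F -> (forall x, 0 <= F x) ->
  (\int[m1]_x (F (phi1 x) * k1 x)%:E = \int[m2]_x (F (phi2 x) * k2 x)%:E)%E.
Proof.
move=> mF F0; under eq_integral do rewrite EFinM.
under [RHS]eq_integral do rewrite EFinM.
have mFE : measurable_fun setT (EFin \o F) by exact/measurable_EFinP.
apply: (pi_system_integral_eq mk1 mk2 k10 k20 mphi1 mphi2 mG GI GT fin1 eqG mFE).
by move=> x; rewrite lee_fin.
Qed.

Lemma pi_system_Rintegral_eq (F : S -> R) : measurable_fun setT F ->
  \int[m1]_x (F (phi1 x) * k1 x) = \int[m2]_x (F (phi2 x) * k2 x).
Proof.
move=> mF; rewrite /Rintegral integralE [in RHS]integralE; congr (fine (_ - _)).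
  have := @ge0_eq (fun x => Num.max (F x) 0) (measurable_maxr mF (measurable_cst _)).
  have E d' (T : measurableType d') (m : {measure set T -> \bar R}) k (phi : T -> S) :
     (forall x, 0 <= k x) -> (\int[m]_x (Num.max (F (phi x)) 0 * k x)%:E =
      \int[m]_x (fun x => (F (phi x) * k x)%:E)^\+ x)%E.
    move=> k0; apply: eq_integral => x _; rewrite unlock /= -EFin_max.
    by rewrite maxr_pMl // mul0r.
  by rewrite !E // => -> // x; rewrite le_max lexx orbT.
have := @ge0_eq (fun x => Num.max (- F x) 0) (measurable_maxr (measurable_funN mF) (measurable_cst _)).
have E d' (T : measurableType d') (m : {measure set T -> \bar R}) k (phi : T -> S) :
   (forall x, 0 <= k x) -> (\int[m]_x (Num.max (- F (phi x)) 0 * k x)%:E =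
    \int[m]_x (fun x => (F (phi x) * k x)%:E)^\- x)%E.
  move=> k0; apply: eq_integral => x _; rewrite unlock /= -EFin_max.
  by rewrite maxr_pMl // mul0r mulNr.
by rewrite !E // => -> // x; rewrite le_max lexx orbT.
Qed.

Lemma pi_system_Rintegrable (F : S -> R) : measurable_fun setT F ->
  Rintegrable m1 (fun x => F (phi1 x) * k1 x) ->
  Rintegrable m2 (fun x => F (phi2 x) * k2 x).
Proof.
move=> mF /integrableP[_ i1]; apply/integrableP; split.
  apply/measurable_EFinP; apply: measurable_funM => //.
  exact: measurableT_comp.
apply: le_lt_trans i1; rewrite le_eqVlt; apply/orP; left; apply/eqP.
have mn : measurable_fun setT (fun x => `|F x|) by exact: measurableT_comp.
have := @ge0_eq (fun x => `|F x|) mn (fun x => normr_ge0 _).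
have E d' (T : measurableType d') (m : {measure set T -> \bar R}) k (phi : T -> S) :
   (forall x, 0 <= k x) -> (\int[m]_x `|(F (phi x) * k x)%:E| =
    \int[m]_x (`|F (phi x)| * k x)%:E)%E.
  by move=> k0; apply: eq_integral => x _; rewrite /= normrM (ger0_norm (k0 x)).
by rewrite /= !E.
Qed.

End pi_system_Rintegrals.

Section conditionally_iid.
Context {R : realType} {dO dQ dW : measure_display} {Om : measurableType dO}
  {Q : measurableType dQ} {W : measurableType dW}.
Variables (P : probability Om R) (lam : probability W R).
Variables (pil : Om -> Q) (y : nat -> Om -> W) (kap : Q * W -> R) (C : R) (N : nat).
Hypotheses (mpil : measurable_fun setT pil)
  (my : forall i, measurable_fun setT (y i))
  (mkap : measurable_fun setT kap) (kap0 : forall t, 0 <= kap t)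
  (kapC : forall t, kap t <= C) (kap1 : forall v, \int[lam]_t kap (v, t) = 1).
Variable BB : set (set W).
Hypotheses (mBB : measurable = <<s BB >>) (BBI : setI_closed BB) (BBT : BB setT).

Definition history k (A : set Q) (B : nat -> set W) : set Om :=
  [set w | A (pil w) /\ forall i, (i < k)%N -> B i (y i w)].

Definition cond_mass (B : set W) v : R := \int[lam]_t (kap (v, t) * \1_B t).

Hypothesis law : forall A B, measurable A -> (forall i, BB (B i)) ->
  P (history N A B) =
  (\int[P]_(w in pil @^-1` A) (\prod_(i < N) cond_mass (B i) (pil w))%:E)%E.

Let BBm B : BB B -> measurable B.
Proof. by move=> BB_B; rewrite mBB; exact: sub_sigma_algebra. Qed.

Let kap_norm t : `|kap t| <= C. Proof. by rewrite ger0_norm. Qed.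

Let cond_massT v : cond_mass setT v = 1.
Proof. by rewrite -(kap1 v); apply: eq_Rintegral => t _; rewrite indicT mulr1. Qed.

Let cond_mass_ge0 B v : 0 <= cond_mass B v.
Proof. by apply: Rintegral_ge0 => t _; rewrite mulr_ge0. Qed.

Let measurable_kap_indic B : measurable B ->
  measurable_fun setT (fun t : Q * W => kap t * \1_B t.2).
Proof.
move=> mB; apply: measurable_funM => //.
by apply: (measurableT_comp (f := (\1_B : W -> R)) (g := snd)).
Qed.

Lemma measurable_cond_mass B : measurable B -> measurable_fun setT (cond_mass B).
Proof.
by move=> mB; exact: (measurable_Rintegral lam (measurable_kap_indic mB)).
Qed.

Let measurable_history k A B : measurable A -> (forall i, BB (B i)) ->
  measurable (history k A B).
Proof.
move=> mA mB.
have -> : history k A B = pil @^-1` A `&` \bigcap_(i in `I_k) (y i @^-1` B i).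
  by apply/seteqP; split => w [h1 h2]; split => // i; exact: h2.
apply: measurableI; first by rewrite -[X in measurable X]setTI; exact: mpil.
apply: bigcap_measurableType => i _.
by rewrite -[X in measurable X]setTI; apply: my => //; exact: BBm.
Qed.

Let law_k k A B : (k <= N)%N -> measurable A -> (forall i, BB (B i)) ->
  P (history k A B) =
  (\int[P]_(w in pil @^-1` A) (\prod_(i < k) cond_mass (B i) (pil w))%:E)%E.
Proof.
move=> kN mA mB; pose B' i := if (i < k)%N then B i else setT.
have -> : history k A B = history N A B'.
  apply/seteqP; split => w [Aw h]; split => // i ik.
    by rewrite /B'; case: ifP => // /h.
  by have := h i (leq_trans ik kN); rewrite /B' ik.
rewrite law //; last by move=> i; rewrite /B'; case: ifP.
apply: eq_integral => w _; congr EFin.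
rewrite -(subnKC kN) big_split_ord /= [X in _ * X]big1 ?mulr1 => [|i _].
  by apply: eq_bigr => i _; rewrite /B' ltn_ord.
by rewrite /B' ltnNge leq_addr /= cond_massT.
Qed.

Let prod_mass (B : nat -> set W) k v := \prod_(i < k) cond_mass (B i) v.

Let measurable_prod_mass (B : nat -> set W) k : (forall i, BB (B i)) ->
  measurable_fun setT (prod_mass B k).
Proof.
move=> mB; apply: measurable_prod => i _; apply: measurable_cond_mass.
exact: BBm.
Qed.

Let law_ext k (B : nat -> set W) (F : Q -> R) : (k <= N)%N -> (forall i, BB (B i)) ->
  measurable_fun setT F -> (forall v, 0 <= F v) ->
  (\int[P]_w (F (pil w) * \1_(history k setT B) w)%:E =
   \int[P]_w (F (pil w) * prod_mass B k (pil w))%:E)%E.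
Proof.
move=> kN mB mF F0.
under eq_integral do rewrite EFinM.
under [RHS]eq_integral do rewrite EFinM.
have mh := measurable_history k measurableT mB.
have mp : measurable_fun setT (fun w => prod_mass B k (pil w)).
  exact: (measurableT_comp (measurable_prod_mass k mB) mpil).
have mFE : measurable_fun setT (EFin \o F) by exact/measurable_EFinP.
apply: (pi_system_integral_eq (G := @measurable _ Q) (measurable_indic mh) mp
  _ _ mpil mpil _ (@measurableI _ _) measurableT _ _ mFE).
- by [].
- by move=> w; apply: prodr_ge0.
- by apply/esym/sigma_algebra_id; exact: sigma_algebra_measurable.
- by rewrite integral_indic // setIT (le_lt_trans (probability_le1 P mh)) ?ltry.
- move=> A mA; have mA' : measurable (pil @^-1` A).
    by rewrite -[X in measurable X]setTI; exact: mpil.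
  rewrite integral_indic // -(law_k kN mA mB); congr (P _).
  by apply/seteqP; split => w /= => [[[_ h] Aw]|[Aw h]].
- by move=> v; rewrite lee_fin.
Qed.

Definition history_rect k : set (set (Om * W)) :=
  [set D | exists A B E, [/\ measurable A, forall i, BB (B i), BB E &
     D = history k A B `*` E]].

Definition history_space k := g_sigma_algebraType (history_rect k).

Let history_rectI k : setI_closed (history_rect k).
Proof.
move=> _ _ [A [B [E [mA mB mE ->]]]] [A' [B' [E' [mA' mB' mE' ->]]]].
exists (A `&` A'), (fun i => B i `&` B' i), (E `&` E'); split.
- exact: measurableI.
- by move=> i; exact: BBI.
- exact: BBI.
- apply/seteqP; split => [[w t] [[[? h] ?] [[? h'] ?]]|[w t] [[[? ?] h] [? ?]]] /=.
    by split => //; split => // i ik; split; [exact: h|exact: h'].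
  by split; split => //; split => // i ik; have [] := h i ik.
Qed.

Let history_rectT k : history_rect k setT.
Proof.
exists setT, (fun=> setT), setT; split => //.
by apply/seteqP; split.
Qed.

Lemma history_measurable k (D : set (Om * W)) : history_rect k D -> measurable D.
Proof.
move=> [A [B [E [mA mB mE ->]]]]; apply: measurableX; last exact: BBm.
exact: measurable_history.
Qed.

Lemma measurable_id_history k :
  @measurable_fun _ _ (Om * W)%type (history_space k) setT id.
Proof.
apply: (@measurability _ _ _ (history_space k) setT _ (history_rect k)) => //.
by move=> _ [D hD <-]; rewrite setTI; exact: (history_measurable hD).
Qed.

Lemma history_pil k : measurable_fun setT (fun t : history_space k => pil t.1).
Proof.
move=> _ A mA; rewrite setTI; apply: sub_sigma_algebra.
exists A, (fun=> setT), setT; split => //.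
by apply/seteqP; split => [[w t] /= h|[w t] [[]]].
Qed.

Lemma history_snd k : measurable_fun setT (fun t : history_space k => t.2).
Proof.
apply: (@measurability _ _ (history_space k) W setT _ BB) => //.
move=> _ [E mE <-]; rewrite setTI; apply: sub_sigma_algebra.
exists setT, (fun=> setT), E; split => //.
by apply/seteqP; split => [[w t] /= h|[w t] [[]]].
Qed.

Lemma history_y k j : (j < k)%N ->
  measurable_fun setT (fun t : history_space k => y j t.1).
Proof.
move=> jk; apply: (@measurability _ _ (history_space k) W setT _ BB) => //.
move=> _ [E mE <-]; rewrite setTI; apply: sub_sigma_algebra.
exists setT, (fun i => if i == j then E else setT), setT; split => //.
  by move=> i; case: eqP.
apply/seteqP; split => [[w t] /= h|[w t] [[_ h] _]].
  by split => //; split => // i _; case: eqP => // ->.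
by have := h j jk; rewrite eqxx.
Qed.

Let mu2 := (P \x lam)%E.

Lemma conditional_step k (F : Om * W -> R) : (k < N)%N ->
  measurable_fun setT (F : history_space k -> R) ->
  \int[P]_w F (w, y k w) = \int[mu2]_t (F t * kap (pil t.1, t.2)).
Proof.
move=> kN mF.
have mk2 : measurable_fun setT (fun t : Om * W => kap (pil t.1, t.2)).
  apply: (measurableT_comp mkap); apply: measurable_fun_pair => //.
  exact: measurableT_comp.
have mphi1 : @measurable_fun _ _ Om (history_space k) setT (fun w => (w, y k w)).
  have h : measurable_fun setT (fun w : Om => (w, y k w)).
    by apply: measurable_fun_pair.
  exact: (measurableT_comp (@measurable_id_history k) h).
have := @pi_system_Rintegral_eq R _ _ _ Om (Om * W)%type (history_space k) P mu2
  (fun=> 1) (fun t => kap (pil t.1, t.2)) (fun w => (w, y k w)) id (history_rect k)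
  (measurable_cst _) mk2 (fun=> ler01) (fun=> kap0 _) mphi1 (@measurable_id_history k)
  erefl (@history_rectI k) (history_rectT k) _ _ F mF.
rewrite (_ : \int[P]_w F (w, y k w) = \int[P]_x (F (x, y k x) * 1)); last first.
  by apply: eq_Rintegral => w _; rewrite mulr1.
apply.
  by rewrite integral_cst //= mul1e probability_setT ltry.
move=> D [A [B [E [mA mB mE ->]]]].
have mh := measurable_history k measurableT mB.
pose B' i := if i == k then E else B i.
have mB' i : BB (B' i) by rewrite /B'; case: ifP.
have pE : (fun w => (w, y k w)) @^-1` (history k A B `*` E) = history k.+1 A B'.
  apply/seteqP; split => [w [[Aw h] Ew]|w [Aw h]].
    split=> // i; rewrite ltnS leq_eqVlt /B' => /predU1P[->|ik]; first by rewrite eqxx.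
    by rewrite ltn_eqF //; exact: h.
  split; last by have := h k (ltnSn k); rewrite /B' eqxx.
  split => // i ik; have := h i (ltnW ik).
  by rewrite /B' ltn_eqF.
rewrite pE integral_cst ?mul1e; last exact: measurable_history.
rewrite -[LHS]/(P (history k.+1 A B')) law_k //.
pose G v : R := \1_A v * cond_mass E v.
have mE' := BBm mE.
have mG : measurable_fun setT G.
  by apply: measurable_funM => //; exact: measurable_cond_mass.
have G0 v : 0 <= G v by rewrite mulr_ge0.
transitivity (\int[P]_w (G (pil w) * \1_(history k setT B) w)%:E)%E.
  rewrite law_ext //; last exact: ltnW.
  rewrite [LHS]integral_mkcond.
  apply: eq_integral => w _; rewrite epatch_indic -EFinM; congr EFin.
  rewrite big_ord_recr /= {2}/B' eqxx /G /prod_mass.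
  rewrite (eq_bigr (fun i : 'I_k => cond_mass (B i) (pil w))) => [|i _].
    have -> : \1_(pil @^-1` A) w = \1_A (pil w) :> R by rewrite !indicE.
    by ring.
  by rewrite /B' ltn_eqF.
rewrite [RHS]integral_mkcond.
have -> : (fun t : Om * W => (kap (pil t.1, t.2))%:E) \_ (id @^-1` (history k A B `*` E)) =
    (fun t => (\1_(history k A B) t.1 * (kap (pil t.1, t.2) * \1_E t.2))%:E).
  apply/funext => -[w t]; rewrite epatch_indic -EFinM; congr EFin.
  by rewrite !indicE /= in_setX -mulnb natrM /=; ring.
have mint : measurable_fun setT (fun t : Om * W =>
     \1_(history k A B) t.1 * (kap (pil t.1, t.2) * \1_E t.2) : R).
  apply: measurable_funM.
    apply: (measurableT_comp (f := (\1_(history k A B) : Om -> R)) (g := fst)) => //.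
    exact/measurable_indic/measurable_history.
  apply: measurable_funM => //.
  by apply: (measurableT_comp (f := (\1_E : W -> R)) (g := snd)).
rewrite fubini_tonelli1 /=; first last.
- by move=> t; rewrite lee_fin !mulr_ge0.
- exact/measurable_EFinP.
apply: eq_integral => w _; rewrite /fubini_F /=.
have ki : Rintegrable lam (fun t => kap (pil w, t) * \1_E t).
  apply: (Rintegrable_bounded lam (K := C)).
    exact: (measurableT_comp (measurable_kap_indic mE') (pair1_measurable (pil w))).
  move=> t; rewrite ger0_norm ?mulr_ge0 //.
  by rewrite (le_trans _ (kapC (pil w, t))) // ler_piMr // indicE; case: (_ \in _).
rewrite RintegralE; last exact: RintegrableZ.
congr EFin; rewrite RintegralZ // -/(cond_mass E (pil w)) /G.
have -> : \1_(history k A B) w = \1_A (pil w) * \1_(history k setT B) w :> R.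
  rewrite !indicE -natrM mulnb; congr (_%:R); congr nat_of_bool.
  apply/idP/andP => [|[]]; rewrite !inE.
    by move=> [? h]; split; [|split].
  by move=> ? [_ h]; split.
by ring.
Qed.

End conditionally_iid.

Section subsampled_data.
Context {R : realType} {dO dQ dZ : measure_display} {Om : measurableType dO}
  {Q : measurableType dQ} {Z : measurableType dZ}.
Variables (P : probability Om R) (nu : probability Z R).
Variables (pil : Om -> Q) (z : nat -> Om -> Z) (del : nat -> Om -> bool)
  (p : Q * Z -> R) (N : nat).
Hypotheses (mpil : measurable_fun setT pil)
  (mz : forall i, measurable_fun setT (z i))
  (mdel : forall i, measurable_fun setT (del i))
  (mp : measurable_fun setT p) (p01 : forall t, 0 <= p t <= 1).

Definition bern_wt (b : bool) (r : R) : R := if b then r else 1 - r.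

Hypothesis hdata : forall A (C : nat -> set Z), measurable A ->
  (forall i, measurable (C i)) ->
  P (pil @^-1` A `&` [set w | forall i, (i < N)%N -> C i (z i w)]) =
  (P (pil @^-1` A) * \prod_(i < N) nu (C i))%E.

Hypothesis hdel : forall A (C : nat -> set Z) (b : nat -> bool), measurable A ->
  (forall i, measurable (C i)) ->
  P (pil @^-1` A `&` [set w | forall i, (i < N)%N -> C i (z i w)]
     `&` [set w | forall i, (i < N)%N -> del i w = b i]) =
  (\int[P]_(w in pil @^-1` A `&` [set w | forall i, (i < N)%N -> C i (z i w)])
     (\prod_(i < N) bern_wt (b i) (p (pil w, z i w)))%:E)%E.

Let indic_setI (T : Type) (S1 S2 : set T) x : \1_(S1 `&` S2) x = \1_S1 x * \1_S2 x :> R.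
Proof. by rewrite !indicE in_setI -mulnb natrM. Qed.

Let mpil_pre A : measurable A -> measurable (pil @^-1` A).
Proof. by move=> mA; rewrite -[X in measurable X]setTI; exact: mpil. Qed.

Let mz_pre i A : measurable A -> measurable (z i @^-1` A).
Proof. by move=> mA; rewrite -[X in measurable X]setTI; exact: mz. Qed.

Lemma bern_wt_ge0 b t : 0 <= bern_wt b (p t).
Proof. by case: b; rewrite /bern_wt ?subr_ge0; have /andP[] := p01 t. Qed.

Lemma bern_wt_le1 b t : bern_wt b (p t) <= 1.
Proof. by case: b; rewrite /bern_wt ?gerBl; have /andP[] := p01 t. Qed.

Lemma bern_wtE b r : bern_wt b r = b%:R * r + (1 - b%:R) * (1 - r).
Proof. by case: b => /=; rewrite /bern_wt /=; ring. Qed.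

Let one_mass B v : cond_mass nu (fun _ : Q * Z => 1) B v = \int[nu]_t \1_B t.
Proof. by apply: eq_Rintegral => t _; rewrite mul1r. Qed.

Let Rint_indic B : measurable B -> (\int[nu]_t \1_B t)%:E = nu B.
Proof.
move=> mB; rewrite -RintegralE; first by rewrite integral_indic // setIT.
by apply: (Rintegrable_bounded nu (K := 1)) => // t; rewrite indicE; case: (_ \in _);
  rewrite ?normr1 ?normr0.
Qed.

Lemma data_step k (F : Om * Z -> R) : (k < N)%N ->
  measurable_fun setT (F : history_space pil z measurable k -> R) ->
  \int[P]_w F (w, z k w) = \int[(P \x nu)%E]_t F t.
Proof.
move=> kN mF.
rewrite (conditional_step (lam := nu) (kap := fun=> 1) (C := 1) (N := N) mpil mz _ _ _ _
  _ _ _ _ kN mF) //.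
- by apply: eq_Rintegral => t _; rewrite mulr1.
- by move=> v; rewrite Rintegral_cstT.
- by apply/esym/sigma_algebra_id; exact: sigma_algebra_measurable.
- exact: measurableI.
move=> A B mA mB; transitivity (P (pil @^-1` A) * \prod_(i < N) nu (B i))%E.
  rewrite -hdata //; congr (P _).
under eq_integral do under eq_bigr do rewrite one_mass.
rewrite integral_cst; last exact: mpil_pre.
rewrite muleC; congr (_ * _)%E.
rewrite -prodEFin; apply: eq_bigr => i _.
by rewrite Rint_indic.
Qed.

Let q (D : set bool) (t : Q * Z) : R := \sum_(b : bool) \1_D b * bern_wt b (p t).

Let q_ge0 D t : 0 <= q D t.
Proof. by apply: sumr_ge0 => b _; rewrite mulr_ge0 // bern_wt_ge0. Qed.

Let q_le1 D t : q D t <= 1.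
Proof.
rewrite /q big_bool /bern_wt !indicE.
by have /andP[? ?] := p01 t; case: (true \in D); case: (false \in D) => /=; lra.
Qed.

Let mq D : measurable_fun setT (q D).
Proof.
apply: measurable_sum => b; apply: measurable_funM => //.
under eq_fun do rewrite bern_wtE.
by apply: measurable_funD; apply: measurable_funM => //; exact: measurable_funB.
Qed.

Let data_set A (C : nat -> set Z) : set Om :=
  pil @^-1` A `&` [set w | forall i, (i < N)%N -> C i (z i w)].

Let mdata_set A C : measurable A -> (forall i, measurable (C i)) ->
  measurable (data_set A C).
Proof.
move=> mA mC; apply: measurableI; first exact: mpil_pre.
rewrite (_ : [set w | _] = \bigcap_(i in `I_N) (z i @^-1` C i)).
  by apply: bigcap_measurableType => i _; exact: mz_pre.
by apply/seteqP; split.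
Qed.

Let prod_le1 (I : finType) (F : I -> R) : (forall i, 0 <= F i <= 1) ->
  0 <= \prod_i F i <= 1.
Proof.
move=> F01; rewrite prodr_ge0 /= => [|i _]; last by have /andP[] := F01 i.
by apply: prodr_ile1 => i _; exact: F01.
Qed.

(* Summing the Bernoulli law over all indicator patterns compatible with the
   marks [D]. *)
Let marked_law A C (D : nat -> set bool) : measurable A -> (forall i, measurable (C i)) ->
  P (data_set A C `&` [set w | forall i, (i < N)%N -> D i (del i w)]) =
  (\int[P]_w (\1_(data_set A C) w * \prod_(i < N) q (D i) (pil w, z i w))%:E)%E.
Proof.
move=> mA mC; have mdC := mdata_set mA mC.
pose bset (b : {ffun 'I_N -> bool}) : set Om := [set w | forall i : 'I_N, del i w = b i].
pose bn (b : {ffun 'I_N -> bool}) i : bool :=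
  if insub i is Some i' then b i' else false.
have bnE b (i : 'I_N) : bn b i = b i by rewrite /bn valK.
have mbset b : measurable (bset b).
  rewrite (_ : bset b = \bigcap_(i in [set: 'I_N]) (del i @^-1` [set b i])).
    apply: fin_bigcap_measurable; first exact: finite_finset.
    by move=> i _; rewrite -[X in measurable X]setTI; exact: mdel.
  by apply/seteqP; split => w h i; [move=> _; exact: h|exact: (h i I)].
pose c (b : {ffun 'I_N -> bool}) : R := \prod_(i < N) \1_(D i) (b i).
have c01 b : 0 <= c b by apply: prodr_ge0.
have mDset : measurable [set w | forall i, (i < N)%N -> D i (del i w)].
  rewrite (_ : [set w | _] = \bigcap_(i in `I_N) (del i @^-1` D i)).
    by apply: bigcap_measurableType => i _; rewrite -[X in measurable X]setTI; exact: mdel.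
  by apply/seteqP; split.
have E w : \1_(data_set A C `&` [set w | forall i, (i < N)%N -> D i (del i w)]) w =
    \sum_(b : {ffun 'I_N -> bool}) c b * \1_(data_set A C `&` bset b) w :> R.
  pose b0 : {ffun 'I_N -> bool} := [ffun i : 'I_N => del i w].
  have z0 b : b != b0 -> \1_(data_set A C `&` bset b) w = 0 :> R.
    move=> bb0; rewrite indicE memNset // => -[_ h].
    by move/eqP: bb0; apply; apply/ffunP => i; rewrite ffunE -h.
  rewrite (bigD1 b0) //= [X in _ = _ + X]big1 ?addr0 => [|b bb0]; last first.
    by rewrite z0 ?mulr0.
  rewrite (indic_setI (data_set A C) (bset b0)) (indic_setI (data_set A C)) mulrCA.
  congr (_ * _); rewrite [\1_(bset b0) w]indicE (@mem_set _ (bset b0)) ?mulr1; last first.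
    by move=> i; rewrite ffunE.
  rewrite /c; under eq_bigr do rewrite ffunE.
  have [h|nh] := pselect (forall i, (i < N)%N -> D i (del i w)).
    by rewrite indicE mem_set // big1 // => i _; rewrite indicE mem_set //; exact: h.
  have [i ni] : exists i : 'I_N, ~ (D i (del i w)).
    apply: contrapT => /forallNP h; apply: nh => i iN.
    by apply: contrapT => nDi; exact: (h (Ordinal iN)).
  by rewrite indicE memNset // (bigD1 i) //= indicE memNset ?mul0r.
have i1 b : measurable (data_set A C `&` bset b) by exact: measurableI.
rewrite -[LHS]fineK ?fin_num_measure //; last exact: measurableI.
rewrite -[LHS]/((fine (P (data_set A C `&` _)))%:E).
have -> : fine (P (data_set A C `&` [set w | forall i, (i < N)%N -> D i (del i w)])) =
   \int[P]_w \1_(data_set A C `&` [set w | forall i, (i < N)%N -> D i (del i w)]) w.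
  by rewrite /Rintegral integral_indic ?setIT //; exact: measurableI.
under eq_Rintegral do rewrite E.
have bi b : Rintegrable P (\1_(data_set A C `&` bset b) : Om -> R).
  by have := integrable_indic P (i1 b).
rewrite Rintegral_sum => [|b _]; last exact: RintegrableZ.
have mt b : measurable_fun setT (fun w => \prod_(i < N) bern_wt (b i) (p (pil w, z i w)) : R).
  apply: measurable_prod => i _; under eq_fun do rewrite bern_wtE.
  have mpi : measurable_fun setT (fun w => p (pil w, z i w)).
    by apply: (measurableT_comp mp); exact: measurable_fun_pair.
  by apply: measurable_funD; apply: measurable_funM => //; exact: measurable_funB.
pose t (b : {ffun 'I_N -> bool}) w := \1_(data_set A C) w *
  \prod_(i < N) bern_wt (b i) (p (pil w, z i w)) : R.
have ti b : Rintegrable P (t b).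
  apply: (Rintegrable_bounded P (K := 1)).
    by apply: measurable_funM => //; exact: (mt (fun i => bn b i)).
  move=> w; have /andP[h1 h2] := prod_le1 (fun i : 'I_N =>
     introT andP (conj (bern_wt_ge0 (b i) (pil w, z i w)) (bern_wt_le1 (b i) (pil w, z i w)))).
  by rewrite /t ger0_norm ?mulr_ge0 // indicE; case: (_ \in _); rewrite ?mul1r ?mul0r.
have Eb b : \int[P]_w \1_(data_set A C `&` bset b) w = \int[P]_w t b w.
  transitivity (fine (P (data_set A C `&` bset b))).
    by rewrite /Rintegral integral_indic ?setIT.
  have bsetE : bset b = [set w | forall i, (i < N)%N -> del i w = bn b i].
    apply/seteqP; split => w h i; last by rewrite (h i) ?bnE.
    by move=> iN; rewrite (h (Ordinal iN)) -bnE.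
  move: (@hdel A C (bn b) mA mC); rewrite -/(data_set A C) -bsetE => ->.
  rewrite integral_mkcond /Rintegral; congr fine.
  apply: eq_integral => w _; rewrite epatch_indic -EFinM mulrC /t; congr (_ * _)%:E.
  by apply: eq_bigr => i _; rewrite bnE.
under eq_bigr do rewrite RintegralZ // Eb -RintegralZ //.
rewrite -Rintegral_sum => [|b _]; last exact: RintegrableZ.
rewrite -RintegralE; last first.
  by apply: Rintegrable_sum => b _; exact: RintegrableZ.
apply: eq_integral => w _; congr EFin.
under eq_bigr do rewrite /t mulrCA.
rewrite -mulr_sumr; congr (_ * _).
rewrite /q bigA_distr_bigA; apply: eq_bigr => b _.
by rewrite /c -big_split.
Qed.

Let rho C D v : R := \int[nu]_t (\1_C t * q D (v, t)).

Let mCq C D : measurable C -> measurable_fun setT (fun t : Q * Z => \1_C t.2 * q D t).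
Proof.
move=> mC; apply: measurable_funM => //.
by apply: (measurableT_comp (f := (\1_C : Z -> R)) (g := snd)).
Qed.

Let Cq01 C D t : 0 <= \1_C t.2 * q D t <= 1.
Proof.
have := q_ge0 D t; have := q_le1 D t.
by rewrite indicE; case: (_ \in _); rewrite ?mul1r ?mul0r ?lexx ?ler01 // => -> ->.
Qed.

Let mrho C D : measurable C -> measurable_fun setT (rho C D).
Proof. by move=> mC; exact: (measurable_Rintegral nu (mCq D mC)). Qed.

Let rho01 C D v : measurable C -> 0 <= rho C D v <= 1.
Proof.
move=> mC; rewrite Rintegral_ge0 /= => [|t _]; last by have /andP[] := Cq01 C D (v, t).
have := @Rintegral_norm_bounded R _ Z nu (fun t => \1_C t * q D (v, t)) 1.
move=> h; apply: le_trans (ler_norm _) (h _ _).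
  exact: (measurableT_comp (mCq D mC) (pair1_measurable v)).
by move=> t; have /andP[? ?] := Cq01 C D (v, t); rewrite ger0_norm.
Qed.

Let chain A (C : nat -> set Z) (D : nat -> set bool) j w : R := \1_A (pil w) *
  (\prod_(i < N) (if (i < j)%N then \1_(C i) (z i w) * q (D i) (pil w, z i w)
                  else rho (C i) (D i) (pil w))).

Let chain_step A (C : nat -> set Z) (D : nat -> set bool) j : measurable A -> (forall i, measurable (C i)) -> (j < N)%N ->
  \int[P]_w chain A C D j.+1 w = \int[P]_w chain A C D j w.
Proof.
move=> mA mC jN.
have mZ : @measurable _ Z = <<s @measurable _ Z >>.
  by apply/esym/sigma_algebra_id; exact: sigma_algebra_measurable.
pose F (t : Om * Z) : R := \1_A (pil t.1) *
  (\prod_(i < N) (if (i < j)%N then \1_(C i) (z i t.1) * q (D i) (pil t.1, z i t.1)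
                  else if i == j :> nat then \1_(C i) t.2 * q (D i) (pil t.1, t.2)
                  else rho (C i) (D i) (pil t.1))).
have mF : measurable_fun setT (F : history_space pil z measurable j -> R).
  have hp : measurable_fun setT (fun t : history_space pil z measurable j => pil t.1).
    exact: history_pil.
  have hs : measurable_fun setT (fun t : history_space pil z measurable j => t.2).
    exact: (history_snd mZ).
  have hy i : (i < j)%N ->
      measurable_fun setT (fun t : history_space pil z measurable j => z i t.1).
    by move=> ij; exact: (history_y mZ measurableT ij).
  have comp2 i g : measurable_fun setT (g : history_space pil z measurable j -> Z) ->
      measurable_fun setT (fun t : history_space pil z measurable j =>
        \1_(C i) (g t) * q (D i) (pil t.1, g t) : R).
    move=> mg; apply: (measurableT_comp (mCq (D i) (mC i))
       (g := fun t : history_space pil z measurable j => (pil t.1, g t))).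
    exact: measurable_fun_pair.
  apply: measurable_funM.
    by apply: (measurableT_comp (f := (\1_A : Q -> R))).
  apply: measurable_prod => i _.
  case: (boolP (i < j)%N) => ij; first exact: (comp2 i _ (hy i ij)).
  case: (boolP (i == j :> nat)) => _; first exact: (comp2 i _ hs).
  exact: (measurableT_comp (mrho (D i) (mC i)) hp).
transitivity (\int[P]_w F (w, z j w)).
  apply: eq_Rintegral => w _; rewrite /chain /F /=; congr (_ * _).
  apply: eq_bigr => i _; rewrite ltnS leq_eqVlt.
  by case: eqP => [->|_] //=; rewrite ltnn.
have mFP : measurable_fun setT (F : Om * Z -> R).
  exact: (measurableT_comp mF (measurable_id_history mpil mz mZ (k := j))).
have Fb t : `|F t| <= 1.
  have /andP[h1 h2] : 0 <= \prod_(i < N) (if (i < j)%N then \1_(C i) (z i t.1) * q (D i) (pil t.1, z i t.1)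
       else if i == j :> nat then \1_(C i) t.2 * q (D i) (pil t.1, t.2)
       else rho (C i) (D i) (pil t.1)) <= 1.
    apply: prod_le1 => i; case: ifP => _; first exact: (Cq01 (C i) (D i) (pil t.1, z i t.1)).
    by case: ifP => _; [exact: (Cq01 (C i) (D i) (pil t.1, t.2))|exact: rho01].
  rewrite /F normrM (ger0_norm h1) indicE.
  by case: (_ \in _); rewrite ?normr1 ?normr0 ?mul1r ?mul0r.
rewrite (data_step jN mF) Rfubini; last exact: (Rintegrable_bounded _ mFP Fb).
apply: eq_Rintegral => w _.
pose jj := Ordinal jN.
pose cst : R := \1_A (pil w) * \prod_(i < N | i != jj)
   (if (i < j)%N then \1_(C i) (z i w) * q (D i) (pil w, z i w)
    else rho (C i) (D i) (pil w)).
transitivity (\int[nu]_t (cst * (\1_(C j) t * q (D j) (pil w, t)))).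
  apply: eq_Rintegral => t _; rewrite /F (bigD1 jj) //= ltnn eqxx /cst.
  rewrite (eq_bigr (fun i : 'I_N =>
     if (i < j)%N then \1_(C i) (z i w) * q (D i) (pil w, z i w)
     else rho (C i) (D i) (pil w))) => [|i ij]; first by ring.
  by case: ifP => // _; case: eqP => // e; rewrite -(inj_eq val_inj) /= e eqxx in ij.
rewrite RintegralZ.
  rewrite -/(rho (C j) (D j) (pil w)) /chain (bigD1 jj) //= ltnn /cst; ring.
apply: (Rintegrable_bounded _ (K := 1)).
  exact: (measurableT_comp (mCq (D j) (mC j)) (pair1_measurable (pil w))).
by move=> t; have /andP[? ?] := Cq01 (C j) (D j) (pil w, t); rewrite ger0_norm.
Qed.

Let mark := bernoulli_prob (2^-1 : R).

Let mark_int (g : bool -> R) : \int[mark]_b g b = (g true + g false) / 2.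
Proof.
pose K := `|g true| + `|g false|.
have gK b : 0 <= g b + K.
  have := ler_norm (- g b); rewrite normrN; rewrite /K.
  by have := normr_ge0 (g true); have := normr_ge0 (g false); case: b; lra.
have mg (h : bool -> R) : Rintegrable mark h.
  apply: (Rintegrable_bounded _ (K := `|h true| + `|h false|)) => [|b].
    by move=> _ B mB.
  by have := normr_ge0 (h true); have := normr_ge0 (h false); case: b; lra.
have h2 : (0 : R) <= (2^-1 : R) <= 1 by rewrite invr_ge0 ler0n invf_le1 ?ler1n ?ltr0n.
have : \int[mark]_b (g b + K) = (g true + K + (g false + K)) / 2.
  rewrite /Rintegral integral_bernoulli_prob //=.
  transitivity (2^-1 * (g true + K) + (1 - 2^-1) * (g false + K)); first by [].
  by field.
rewrite RintegralD //; [|exact: mg|exact: mg].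
by rewrite Rintegral_cstT => h; apply: (addIr K); rewrite h; field.
Qed.

Definition marked_weight (t : Q * (Z * bool)) : R := 2 * bern_wt t.2.2 (p (t.1, t.2.1)).
Local Notation kap := marked_weight.
Let lam := (nu \x mark)%E.
Definition marked_pair i w := (z i w, del i w).
Local Notation ymark := marked_pair.
Definition mark_rects : set (set (Z * bool)) := [set A `*` B | A in measurable & B in measurable].
Local Notation BB := mark_rects.

Let mkap : measurable_fun setT kap.
Proof.
apply: measurable_funM => //; under eq_fun do rewrite bern_wtE.
have mb : measurable_fun setT (fun t : Q * (Z * bool) => t.2.2%:R : R).
  by apply: (measurableT_comp (f := fun b : bool => b%:R : R) (g := fun t : Q * (Z * bool) => t.2.2));
   [move=> _ B mB|exact: measurableT_comp].
have mpp : measurable_fun setT (fun t : Q * (Z * bool) => p (t.1, t.2.1)).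
  apply: (measurableT_comp mp); apply: measurable_fun_pair => //.
  exact: measurableT_comp.
by apply: measurable_funD; apply: measurable_funM => //; exact: measurable_funB.
Qed.

Let kap0 t : 0 <= kap t. Proof. by rewrite mulr_ge0 // bern_wt_ge0. Qed.

Let kap2 t : kap t <= 2.
Proof. by rewrite /kap ler_piMr // bern_wt_le1. Qed.

Let mymark i : measurable_fun setT (ymark i).
Proof. exact: measurable_fun_pair. Qed.

Let kapf (g : Z * bool -> R) K v : measurable_fun setT g -> (forall t, `|g t| <= K) ->
  \int[lam]_t (kap (v, t) * g t) =
  \int[nu]_t (p (v, t) * g (t, true) + (1 - p (v, t)) * g (t, false)).
Proof.
move=> mg gK; rewrite Rfubini; last first.
  apply: (Rintegrable_bounded _ (K := 2 * K)).
    apply: measurable_funM => //.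
    exact: (measurableT_comp mkap (pair1_measurable v)).
  by move=> t; rewrite normrM ler_pM // ger0_norm.
apply: eq_Rintegral => t _; by rewrite mark_int /kap /bern_wt /=; field.
Qed.

Let kap1 v : \int[lam]_t kap (v, t) = 1.
Proof.
have := @kapf (fun=> 1) 1 v (measurable_cst _) (fun=> _).
under eq_Rintegral do rewrite mulr1.
move=> ->; last by rewrite normr1.
rewrite -[RHS](Rintegral_cstT nu 1); apply: eq_Rintegral => t _; ring.
Qed.

Let mBB : measurable = <<s BB >>.
Proof. exact: measurable_prod_measurableType. Qed.

Let BBI : setI_closed BB.
Proof.
move=> _ _ [A mA [B mB <-]] [A' mA' [B' mB' <-]].
exists (A `&` A'); first exact: measurableI.
by exists (B `&` B'); [exact: measurableI|rewrite setXI].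
Qed.

Let BBT : BB setT.
Proof. by exists setT => //; exists setT => //; rewrite setXTT. Qed.

Let law A B : measurable A -> (forall i, BB (B i)) ->
  P (history pil ymark N A B) =
  (\int[P]_(w in pil @^-1` A) (\prod_(i < N) cond_mass lam kap (B i) (pil w))%:E)%E.
Proof.
move=> mA mB.
have exC i : exists C, exists D, measurable C /\ B i = C `*` D.
  by have [C mC [D _ <-]] := mB i; exists C, D.
pose C i := projT1 (cid (exC i)).
have exD i : exists D, measurable (C i) /\ B i = C i `*` D by exact: projT2 (cid (exC i)).
pose D i := projT1 (cid (exD i)).
have mC i : measurable (C i) by have [] := projT2 (cid (exD i)).
have BE i : B i = C i `*` D i by have [] := projT2 (cid (exD i)).
have cmE i v : cond_mass lam kap (B i) v = rho (C i) (D i) v.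
  rewrite /cond_mass BE.
  have mi : measurable_fun setT (\1_(C i `*` D i) : Z * bool -> R).
    by apply: measurable_indic; apply: measurableX.
  rewrite (@kapf _ 1 v mi) => [|t]; last first.
    by rewrite indicE; case: (_ \in _); rewrite ?normr1 ?normr0.
  apply: eq_Rintegral => t _; rewrite /q big_bool /bern_wt !indicE !in_setX /= -!mulnb !natrM.
  by ring.
have -> : history pil ymark N A B = data_set A C `&`
     [set w | forall i, (i < N)%N -> D i (del i w)].
  apply/seteqP; split => [w [Aw h]|w [[Aw h] h']].
    by split; [split => // i iN|move=> i iN]; have := h i iN; rewrite BE => -[].
  by split => // i iN; rewrite BE; split; [exact: h|exact: h'].
rewrite marked_law //.
have chN : forall j, (j <= N)%N -> \int[P]_w chain A C D j w = \int[P]_w chain A C D 0 w.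
  by elim=> // j IH jN; rewrite chain_step // IH // ltnW.
have := chN N (leqnn N).
have mchain j : measurable_fun setT (chain A C D j).
  apply: measurable_funM.
    by apply: (measurableT_comp (f := (\1_A : Q -> R))).
  apply: measurable_prod => i _; case: (boolP (i < j)%N) => ij.
    apply: (measurableT_comp (mCq (D i) (mC i)) (g := fun w => (pil w, z i w))).
    exact: measurable_fun_pair.
  exact: (measurableT_comp (mrho (D i) (mC i)) mpil).
have chi j : Rintegrable P (chain A C D j).
  apply: (Rintegrable_bounded _ (K := 1)) => // w.
  have /andP[h1 h2] : 0 <= \prod_(i < N) (if (i < j)%N
      then \1_(C i) (z i w) * q (D i) (pil w, z i w) else rho (C i) (D i) (pil w)) <= 1.
    apply: prod_le1 => i; case: ifP => _; last exact: rho01.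
    exact: (Cq01 (C i) (D i) (pil w, z i w)).
  rewrite /chain normrM (ger0_norm h1) indicE.
  by case: (_ \in _); rewrite ?normr1 ?normr0 ?mul1r ?mul0r.
move=> e.
transitivity ((\int[P]_w chain A C D N w)%:E).
  rewrite -RintegralE //; apply: eq_integral => w _; congr EFin.
  have e1 : \1_(pil @^-1` A) w = \1_A (pil w) :> R by rewrite !indicE.
  rewrite (indic_setI (pil @^-1` A)) e1 /chain -mulrA; congr (_ * _).
  under [RHS]eq_bigr do rewrite ltn_ord.
  rewrite big_split /=; congr (_ * _).
  have [h|nh] := pselect (forall i, (i < N)%N -> C i (z i w)).
    by rewrite indicE mem_set // big1 // => i _; rewrite indicE mem_set //; exact: h.
  have [i ni] : exists i : 'I_N, ~ (C i (z i w)).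
    apply: contrapT => /forallNP h; apply: nh => i iN.
    by apply: contrapT => nDi; exact: (h (Ordinal iN)).
  by rewrite indicE memNset // (bigD1 i) //= indicE memNset ?mul0r.
rewrite e -RintegralE // [RHS]integral_mkcond; apply: eq_integral => w _.
rewrite epatch_indic -EFinM; congr EFin; rewrite /chain mulrC; congr (_ * _).
  by apply: eq_bigr => i _; rewrite cmE.
Qed.

Lemma subsampling_step k (F : Om * (Z * bool) -> R) K : (k < N)%N ->
  measurable_fun setT (F : history_space pil ymark BB k -> R) ->
  (forall t, `|F t| <= K) ->
  \int[P]_w F (w, (z k w, del k w)) =
  \int[P]_w \int[nu]_t (p (pil w, t) * F (w, (t, true)) +
                        (1 - p (pil w, t)) * F (w, (t, false))).
Proof.
move=> kN mF FK.
rewrite (conditional_step (lam := lam) (kap := kap) mpil mymark mkap kap0 kap2 kap1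
  mBB BBI BBT law kN mF).
have mFP : measurable_fun setT (F : Om * (Z * bool) -> R).
  exact: (measurableT_comp mF (measurable_id_history mpil mymark mBB (k := k))).
rewrite Rfubini; last first.
  apply: (Rintegrable_bounded _ (K := K * 2)).
    apply: measurable_funM => //; apply: (measurableT_comp mkap).
    by apply: measurable_fun_pair => //; exact: measurableT_comp.
  by move=> t; rewrite normrM ler_pM // ger0_norm.
apply: eq_Rintegral => w _ /=.
rewrite -(@kapf (fun t => F (w, t)) K) //.
  by apply: eq_Rintegral => t _; rewrite mulrC.
exact: (measurableT_comp mFP (pair1_measurable w)).
Qed.

Variables (d : nat) (u : Q * Z -> 'cV[R]_d).
Hypothesis mu_ : forall i, measurable_fun setT (fun t => u t i 0).

Definition partial_sum k w : 'cV[R]_d := \sum_(i < k) (del i w)%:R *: u (pil w, z i w).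

Lemma partial_sum_step k (h : 'cV[R]_d -> R) A K : (k < N)%N ->
  measurable_fun [set: borel R d] h -> (forall x, `|h x| <= K) -> measurable A ->
  \int[P]_w (\1_A (pil w) * h (partial_sum k.+1 w)) =
  \int[P]_w (\1_A (pil w) * \int[nu]_t (p (pil w, t) * h (partial_sum k w + u (pil w, t)) +
     (1 - p (pil w, t)) * h (partial_sum k w))).
Proof.
move=> kN mh hK mA.
pose F (t : Om * (Z * bool)) : R :=
  \1_A (pil t.1) * h (partial_sum k t.1 + t.2.2%:R *: u (pil t.1, t.2.1)).
pose HS := history_space pil ymark BB k.
have mF : measurable_fun setT (F : HS -> R).
  have hp : measurable_fun setT (fun t : HS => pil t.1) by exact: (history_pil BBT).
  have hs : measurable_fun setT (fun t : HS => t.2) by exact: (history_snd mBB BBT).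
  have hy i : (i < k)%N -> measurable_fun setT (fun t : HS => ymark i t.1).
    by move=> ik; exact: (history_y mBB BBT ik).
  have mnat T' (b : HS -> bool) : measurable_fun setT b ->
      measurable_fun setT (fun t => (b t)%:R : R).
    move=> mb; apply: (measurableT_comp (f := fun b : bool => b%:R : R)) => //.
  have mterm j (b : HS -> bool) (g : HS -> Z) : measurable_fun setT b ->
      measurable_fun setT g ->
      measurable_fun setT (fun t => (b t)%:R * u (pil t.1, g t) j 0 : R).
    move=> mb mg; apply: measurable_funM; first exact: mnat.
    apply: (measurableT_comp (mu_ j) (g := fun t : HS => (pil t.1, g t))).
    exact: measurable_fun_pair.
  apply: measurable_funM; first by apply: (measurableT_comp (f := (\1_A : Q -> R))).
  apply: (measurableT_comp (f := (h : borel R d -> R))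
    (g := fun t : HS => (partial_sum k t.1 + t.2.2%:R *: u (pil t.1, t.2.1)) : borel R d)) => //.
  apply: measurable_to_borel => j.
  have -> : (fun t : HS => (partial_sum k t.1 + t.2.2%:R *: u (pil t.1, t.2.1)) j 0) =
     (fun t : HS => \sum_(i < k) (del i t.1)%:R * u (pil t.1, z i t.1) j 0 +
       t.2.2%:R * u (pil t.1, t.2.1) j 0).
    apply/funext => t; rewrite mxE summxE mxE; congr (_ + _).
    by apply: eq_bigr => i _; rewrite mxE.
  apply: measurable_funD; last first.
    by apply: mterm; apply: measurableT_comp hs.
  apply: measurable_sum => i; apply: mterm.
    exact: (measurableT_comp measurable_snd (hy i (ltn_ord i))).
  exact: (measurableT_comp measurable_fst (hy i (ltn_ord i))).
have FK t : `|F t| <= K.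
  rewrite /F normrM indicE; case: (_ \in _); rewrite ?normr1 ?mul1r //.
  by rewrite normr0 mul0r (le_trans (normr_ge0 _) (hK 0)).
have := subsampling_step kN mF FK; rewrite /F /= => E.
transitivity (\int[P]_w (\1_A (pil w) * h (partial_sum k w + (del k w)%:R *: u (pil w, z k w)))).
  by apply: eq_Rintegral => w _; rewrite /partial_sum big_ord_recr.
rewrite E; apply: eq_Rintegral => w _.
have mu1 : measurable_fun setT (fun t => h (partial_sum k w + u (pil w, t))).
  apply: (measurableT_comp (f := (h : borel R d -> R))
    (g := fun t => (partial_sum k w + u (pil w, t)) : borel R d)) => //.
  apply: measurable_to_borel => j; under eq_fun do rewrite mxE.
  apply: measurable_funD => //.
  exact: (measurableT_comp (mu_ j) (pair1_measurable (pil w))).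
have mp1 : measurable_fun setT (fun t => p (pil w, t)).
  exact: (measurableT_comp mp (pair1_measurable (pil w))).
rewrite -RintegralZ.
  by apply: eq_Rintegral => t _; rewrite scale1r scale0r addr0; ring.
apply: (Rintegrable_bounded _ (K := K)).
  by apply: measurable_funD; apply: measurable_funM => //; exact: measurable_funB.
move=> t; have /andP[p0 p1] := p01 (pil w, t).
rewrite (le_trans (ler_normD _ _)) // !normrM (ger0_norm p0) (@ger0_norm _ (1 - _)) ?subr_ge0 //.
have -> : K = p (pil w, t) * K + (1 - p (pil w, t)) * K by ring.
by rewrite lerD // ler_wpM2l // subr_ge0.
Qed.

End subsampled_data.

Section lebesgue_affine.
Context {R : realType}.
Local Notation leb := (@lebesgue_measure R).

Lemma measurable_affine (a c : R) : measurable_fun setT (fun x : R => a * x + c).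
Proof. by apply: measurable_funD => //; exact: measurable_funM. Qed.

(* The image of |a| dx under x |-> a x + c agrees with Lebesgue measure on
   intervals. *)
Lemma integral_lebesgue_affine (a c : R) (f : R -> \bar R) : a != 0 ->
  measurable_fun setT f -> (forall x, 0 <= f x)%E ->
  (\int[leb]_x f x = \int[leb]_x (f (a * x + c)%R * `|a|%:E))%E.
Proof.
move=> a0 mf f0; have mphi := measurable_affine a c.
have na0 : 0 < `|a| by rewrite normr_gt0.
pose M := @density_measure R _ _ (measurableTypeR R) (measurableTypeR R) leb
  (fun=> `|a|) (fun x => a * x + c) mphi (measurable_cst _) (fun=> normr_ge0 a).
transitivity (\int[M]_x f x)%E; last first.
  exact: (@integral_mdensity R _ _ (measurableTypeR R) (measurableTypeR R) leb
    (fun=> `|a|) (fun x => a * x + c) mphi (measurable_cst _) (fun=> normr_ge0 _) f mf f0).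
apply: eq_measure_integral => A mA _.
apply: (@lebesgue_measure_unique R M) => // X [[l r] /= _ <-] /=.
have mphi2 := measurable_affine a c.
rewrite /mdensity integral_cst //=; last first.
  by rewrite -[X in measurable X]setTI; exact: mphi2.
have [lr|rl] := leP l r; last first.
  rewrite set_itv_ge ?bnd_simp -?leNgt ?(ltW rl) // preimage_set0 !measure0 mule0 //.
move: a0; rewrite neq_lt => /orP[a0|a0].
  have -> : (fun x => a * x + c) @^-1` `]l, r] = [set` `[(r - c) / a, (l - c) / a[].
    apply/seteqP; split => x /=; rewrite !in_itv /= => /andP[h1 h2]; apply/andP; split.
    - by rewrite ler_ndivrMr // mulrC; lra.
    - by rewrite ltr_ndivlMr // mulrC; lra.
    - by move: h2; rewrite ltr_ndivlMr // mulrC; lra.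
    - by move: h1; rewrite ler_ndivrMr // mulrC; lra.
  rewrite !lebesgue_measure_itv /= !lte_fin.
  have -> : ((r - c) / a < (l - c) / a) = (l < r) by rewrite ltr_nM2r ?invr_lt0 // ltrD2r.
  case: ifP => _; rewrite ?mule0 // -!EFinB -EFinM (ltr0_norm a0); congr EFin; field.
  by rewrite lt_eqF.
have -> : (fun x => a * x + c) @^-1` `]l, r] = [set` `](l - c) / a, (r - c) / a]].
  apply/seteqP; split => x /=; rewrite !in_itv /= => /andP[h1 h2]; apply/andP; split.
  - by rewrite ltr_pdivrMr // mulrC; lra.
  - by rewrite ler_pdivlMr // mulrC; lra.
  - by move: h1; rewrite ltr_pdivrMr // mulrC; lra.
  - by move: h2; rewrite ler_pdivlMr // mulrC; lra.
rewrite !lebesgue_measure_itv /= !lte_fin.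
have -> : ((l - c) / a < (r - c) / a) = (l < r) by rewrite ltr_pM2r ?invr_gt0 // ltrD2r.
case: ifP => _; rewrite ?mule0 // -!EFinB -EFinM (gtr0_norm a0); congr EFin; field.
by rewrite gt_eqF.
Qed.

End lebesgue_affine.

Section normal_law.
Context {R : realType}.
Local Notation leb := (@lebesgue_measure R).
Local Notation gauss := (normal_prob (0 : R) 1).

Lemma integral_normal_prob (m s : R) (f : R -> \bar R) : measurable_fun setT f ->
  (forall x, 0 <= f x)%E ->
  (\int[normal_prob m s]_x f x = \int[leb]_x (f x * (normal_pdf m s x)%:E))%E.
Proof.
move=> mf f0.
pose M := @density_measure R _ _ (measurableTypeR R) (measurableTypeR R) leb
  (normal_pdf m s) id (@measurable_id _ _ _) (measurable_normal_pdf m s)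
  (fun x => normal_pdf_ge0 m s x).
transitivity (\int[M]_x f x)%E; first exact: eq_measure_integral.
exact: (@integral_mdensity R _ _ (measurableTypeR R) (measurableTypeR R) leb
  (normal_pdf m s) id (@measurable_id _ _ _) (measurable_normal_pdf m s)
  (fun x => normal_pdf_ge0 m s x) f mf f0).
Qed.

Lemma normal_pdf_fun (m s x : R) : 0 < s ->
  normal_pdf m s x = normal_peak s * normal_fun m s x.
Proof. by move=> s0; rewrite /normal_pdf gt_eqF. Qed.

Lemma normal_peakE (s : R) : 0 < s -> normal_peak s = s^-1 * normal_peak 1.
Proof.
move=> s0; rewrite /normal_peak -!mulrnAr sqrtrM ?sqr_ge0 // sqrtr_sqr gtr0_norm //.
by rewrite expr1n mul1r invfM.
Qed.

Lemma normal_pdf_affine (a c x : R) : 0 < a ->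
  normal_pdf 0 1 x = normal_pdf c a (a * x + c) * a.
Proof.
move=> a0; rewrite !normal_pdf_fun // /normal_fun.
rewrite (normal_peakE a0) addrK subr0 mulrAC [_^-1 * _ * a]mulrAC mulVf ?gt_eqF // mul1r.
congr (_ * expR _); rewrite expr1n exprMn -[1 *+ 2]mulr_natr -[a ^+ 2 *+ 2]mulr_natr mul1r.
by rewrite !mulNr -mulf_div divff ?mul1r // expf_neq0 // gt_eqF.
Qed.

Lemma normal_affine (a c : R) (f : R -> \bar R) : 0 < a ->
  measurable_fun setT f -> (forall x, 0 <= f x)%E ->
  (\int[gauss]_x f (a * x + c)%R = \int[normal_prob c a]_x f x)%E.
Proof.
move=> a0 mf f0.
have mfa : measurable_fun setT (fun x => f (a * x + c)).
  exact: (measurableT_comp mf (measurable_affine a c)).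
pose h x := (f x * (normal_pdf c a x)%:E)%E.
have mh : measurable_fun setT h.
  apply: emeasurable_funM; first exact: mf.
  by apply/measurable_EFinP; exact: measurable_normal_pdf.
have h0 x : (0 <= h x)%E by rewrite mule_ge0 // lee_fin normal_pdf_ge0.
have an : a != 0 by rewrite gt_eqF.
transitivity (\int[leb]_x (f (a * x + c)%R * (normal_pdf 0 1 x)%:E))%E.
  exact: (integral_normal_prob 0 1 mfa (fun x => f0 _)).
transitivity (\int[leb]_x h x)%E; last first.
  exact: (esym (integral_normal_prob c a mf f0)).
rewrite (integral_lebesgue_affine c an mh h0).
apply: eq_integral => x _; rewrite (normal_pdf_affine c x a0) EFinM muleA.
by rewrite gtr0_norm.
Qed.

Lemma complete_square (A b x y : R) : A != 0 -> A + b ^+ 2 != 0 ->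
  (x - b * y) ^+ 2 / (A * 2) + y ^+ 2 / 2 = x ^+ 2 / ((A + b ^+ 2) * 2) +
  (y - b * x / (A + b ^+ 2)) ^+ 2 / (A / (A + b ^+ 2) * 2).
Proof. by move=> A0 G0; field; rewrite A0 G0. Qed.
Lemma normal_pdf_conv (a b x y : R) : 0 < a -> 0 < b ->
  let g := Num.sqrt (a ^+ 2 + b ^+ 2) in
  normal_pdf (b * y) a x * normal_pdf 0 1 y =
  normal_pdf 0 g x * normal_pdf (b * x / g ^+ 2) (a / g) y.
Proof.
move=> a0 b0 g.
have g20 : 0 < a ^+ 2 + b ^+ 2 by rewrite addr_gt0 // exprn_gt0.
have g0 : 0 < g by rewrite sqrtr_gt0.
have g2 : g ^+ 2 = a ^+ 2 + b ^+ 2 by rewrite sqr_sqrtr // ltW.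
have ag0 : 0 < a / g by rewrite divr_gt0.
rewrite !normal_pdf_fun // /normal_fun.
rewrite (normal_peakE a0) (normal_peakE g0) (normal_peakE ag0).
set e1 := expR _; set e2 := expR _; set e3 := expR _; set e4 := expR _.
have ee : e1 * e2 = e3 * e4.
  rewrite /e1 /e2 /e3 /e4 -!expRD; congr expR.
  rewrite !mulNr -!opprD; congr (- _); rewrite expr1n exprMn exprVn g2 !subr0.
  rewrite -[1 *+ 2]mulr_natr mul1r -[a ^+ 2 *+ 2]mulr_natr -[(a ^+ 2 + b ^+ 2) *+ 2]mulr_natr.
  rewrite -[(a ^+ 2 / (a ^+ 2 + b ^+ 2)) *+ 2]mulr_natr.
  by apply: complete_square; rewrite gt_eqF // exprn_gt0.
have -> : a^-1 * normal_peak 1 * e1 * (normal_peak 1 * e2) =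
  a^-1 * normal_peak 1 ^+ 2 * (e1 * e2) by ring.
rewrite ee; have gn : g != 0 by rewrite gt_eqF.
have an : a != 0 by rewrite gt_eqF.
by field; rewrite gn an.
Qed.

Lemma normal_stable (a b : R) (f : R -> \bar R) : 0 <= a -> 0 <= b ->
  measurable_fun setT f -> (forall x, 0 <= f x)%E ->
  (\int[gauss]_x \int[gauss]_y f (a * x + b * y)%R =
   \int[gauss]_x f (Num.sqrt (a ^+ 2 + b ^+ 2) * x)%R)%E.
Proof.
move=> a0 b0 mf f0.
have sc (c : R) : measurable_fun setT (fun x => f (c * x)%R).
  by apply: (measurableT_comp mf); exact: measurable_funM.
have [a00|an] := eqVneq a 0.
  rewrite a00 expr0n add0r sqrtr_sqr ger0_norm //.
  under eq_integral do under eq_integral do rewrite mul0r add0r.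
  by rewrite integral_cst //= probability_setT mule1.
have [b00|bn] := eqVneq b 0.
  rewrite b00 expr0n addr0 sqrtr_sqr ger0_norm //.
  apply: eq_integral => x _; under eq_integral do rewrite mul0r addr0.
  by rewrite integral_cst //= probability_setT mule1.
have {a0 an}a0 : 0 < a by rewrite lt0r an.
have {b0 bn}b0 : 0 < b by rewrite lt0r bn.
set g := Num.sqrt _.
have g20 : 0 < a ^+ 2 + b ^+ 2 by rewrite addr_gt0 // exprn_gt0.
have g0 : 0 < g by rewrite sqrtr_gt0.
have mfab : measurable_fun setT (fun t : measurableTypeR R * measurableTypeR R =>
    f (a * t.1 + b * t.2)).
  apply: (measurableT_comp mf (g := fun t : measurableTypeR R * measurableTypeR R =>
     (a * t.1 + b * t.2)%R)).
  by apply: measurable_funD; apply: measurable_funM.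
rewrite [LHS](fubini_tonelli (m1 := gauss) (m2 := gauss)
  (fun t : measurableTypeR R * measurableTypeR R => f (a * t.1 + b * t.2)%R)
  mfab (fun t => f0 _)) /fubini_G /=.
have mpdf : measurable_fun setT (fun t : measurableTypeR R * measurableTypeR R =>
    (normal_pdf (b * t.2) a t.1)%:E).
  apply/measurable_EFinP; under eq_fun do rewrite normal_pdf_fun //.
  apply: measurable_funM => //; apply: (measurableT_comp (f := expR)) => //.
  apply: measurable_funM => //; apply: measurableT_comp => //.
  by apply: measurable_funX; apply: measurable_funB => //; apply: measurable_funM.
transitivity (\int[gauss]_y \int[leb]_x (f x * (normal_pdf (b * y) a x)%:E))%E.
  apply: eq_integral => y _.
  exact: (etrans (normal_affine (b * y) a0 mf f0) (integral_normal_prob (b * y) a mf f0)).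
pose h (t : measurableTypeR R * measurableTypeR R) :=
  (f t.1 * (normal_pdf (b * t.2) a t.1)%:E)%E.
have mh : measurable_fun setT h.
  by apply: emeasurable_funM => //; exact: (measurableT_comp mf measurable_fst).
have h0 t : (0 <= h t)%E by rewrite mule_ge0 // lee_fin normal_pdf_ge0.
transitivity (\int[leb]_x \int[gauss]_y h (x, y))%E.
  exact: (esym (fubini_tonelli (m1 := leb) (m2 := gauss) h mh h0)).
transitivity (\int[leb]_x (f x * (normal_pdf 0 g x)%:E))%E; last first.
  rewrite -(integral_normal_prob 0 g mf f0) -(normal_affine 0 g0 mf f0).
  by apply: eq_integral => x _; rewrite addr0.
apply: eq_integral => x _.
have mhx : measurable_fun setT (fun y => h (x, y)).
  exact: (measurableT_comp mh (pair1_measurable x)).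
rewrite (integral_normal_prob 0 1 mhx (fun y => h0 _)).
pose k := normal_pdf (b * x / g ^+ 2) (a / g).
transitivity (\int[leb]_y ((f x * (normal_pdf 0 g x)%:E) * (k y)%:E))%E.
  apply: eq_integral => y _; rewrite /h /= -!muleA -!EFinM.
  by rewrite (normal_pdf_conv x y a0 b0).
have mk : measurable_fun setT (fun y => (k y)%:E).
  by apply/measurable_EFinP; exact: measurable_normal_pdf.
have k0 y : setT y -> (0 <= (k y)%:E)%E by rewrite lee_fin normal_pdf_ge0.
have c0 : (0 <= f x * (normal_pdf 0 g x)%:E)%E by rewrite mule_ge0 // lee_fin normal_pdf_ge0.
by rewrite (ge0_integralZl leb measurableT mk k0 c0) integral_normal_pdf mule1.
Qed.

Lemma Rintegrable_normal (f : R -> R) : measurable_fun setT f ->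
  Rintegrable leb (fun x => f x * normal_pdf 0 1 x) -> Rintegrable gauss f.
Proof.
move=> mf /integrableP[_ fi]; apply/integrableP; split; first exact/measurable_EFinP.
have mn : measurable_fun setT (fun x => `|f x|%:E).
  by apply/measurable_EFinP; exact: measurableT_comp.
have n0 x : (0 <= `|f x|%:E)%E by rewrite lee_fin.
have -> : (\int[gauss]_x `|(EFin \o f) x| = \int[gauss]_x `|f x|%:E)%E by [].
rewrite (integral_normal_prob 0 1 mn n0); apply: le_lt_trans fi.
rewrite le_eqVlt; apply/orP; left; apply/eqP; apply: eq_integral => x _ /=.
by rewrite normrM [`|normal_pdf _ _ _|]ger0_norm // normal_pdf_ge0.
Qed.

Lemma Rintegrable_normal_sqr : Rintegrable gauss (fun x : R => x ^+ 2).
Proof.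
apply: Rintegrable_normal => //.
pose c : R := 4 * Num.sqrt 2.
have s2 : 0 < Num.sqrt 2 :> R by rewrite sqrtr_gt0.
have di : Rintegrable leb (fun x => c * normal_pdf 0 (Num.sqrt 2) x).
  by apply: RintegrableZ; exact: integrable_normal_pdf.
apply: Rintegrable_le di.
  by apply: measurable_funM => //; exact: measurable_normal_pdf.
move=> x; rewrite ger0_norm; last by rewrite mulr_ge0 ?sqr_ge0 // normal_pdf_ge0.
rewrite !normal_pdf_fun // (normal_peakE s2) /normal_fun !subr0 sqr_sqrtr // expr1n.
have q0 : 0 < normal_peak (1 : R) by rewrite normal_peak_gt0 // oner_neq0.
pose u := x ^+ 2 / 4.
have u0 : 0 <= u by rewrite divr_ge0 // sqr_ge0.
have xu : x ^+ 2 = 4 * u by rewrite /u; field.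
have e1 : - x ^+ 2 / (1 *+ 2) = - u - u by rewrite -mulr_natr mul1r xu; field.
have e2 : - x ^+ 2 / (2 *+ 2) = - u by rewrite -mulr_natr xu; field.
rewrite e1 e2 xu expRD; set e := expR (- u).
have eu : u * e <= 1.
  rewrite /e expRN ler_pdivrMr ?expR_gt0 // mul1r.
  by apply: le_trans (expR_ge1Dx u); rewrite lerDr.
have -> : c * ((Num.sqrt 2)^-1 * normal_peak 1 * e) = 4 * (normal_peak 1 * e) * 1.
  by rewrite /c; field; rewrite gt_eqF.
have -> : 4 * u * (normal_peak 1 * (e * e)) = 4 * (normal_peak 1 * e) * (u * e) by ring.
by rewrite ler_wpM2l // !mulr_ge0 ?expR_ge0 // ltW.
Qed.

Lemma Rintegrable_normal_id : Rintegrable gauss (fun x : R => x).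
Proof.
have c1 : Rintegrable gauss (fun=> 1 : R) by exact: finite_measure_integrable_cst.
apply: (Rintegrable_le _ _ (RintegrableD c1 Rintegrable_normal_sqr)) => // x.
by rewrite ler_norml; apply/andP; split; nra.
Qed.

Lemma Rintegral_normal_id : \int[gauss]_x x = 0.
Proof.
have refl (f : R -> \bar R) : measurable_fun setT f -> (forall x, 0 <= f x)%E ->
    (\int[gauss]_x f (- x)%R = \int[gauss]_x f x)%E.
  move=> mf f0.
  have mo : measurable_fun setT (fun x : R => - x).
    by under eq_fun do rewrite -mulN1r; exact: measurable_funM.
  have mfN : measurable_fun setT (fun x : R => f (- x)%R).
    exact: (measurableT_comp mf mo).
  rewrite (integral_normal_prob 0 1 mfN (fun x => f0 _)) (integral_normal_prob 0 1 mf f0).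
  pose h x := (f x * (normal_pdf 0 1 x)%:E)%E.
  have mh : measurable_fun setT h.
    apply: emeasurable_funM; first exact: mf.
    by apply/measurable_EFinP; exact: measurable_normal_pdf.
  have h0 x : (0 <= h x)%E by rewrite mule_ge0 // lee_fin normal_pdf_ge0.
  have n1 : -1 != 0 :> R by rewrite oppr_eq0 oner_neq0.
  rewrite -[RHS]/(\int[leb]_x h x)%E (integral_lebesgue_affine 0 n1 mh h0).
  apply: eq_integral => x _; rewrite /h addr0 mulN1r normrN1 mule1.
  by rewrite !normal_pdf_fun // /normal_fun !subr0 sqrrN.
have mE : measurable_fun setT (EFin : R -> \bar R) by exact/measurable_EFinP.
have pos : measurable_fun setT (fun x : R => (Num.max x 0)%:E).
  by apply/measurable_EFinP; exact: measurable_maxr.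
have := refl _ pos (fun x => _); rewrite /Rintegral integralE => E.
rewrite -[RHS](_ : fine 0 = 0) //; congr fine.
rewrite (_ : (\int[gauss]_x (fun x0 : R => x0%:E)^\+ x)%E = \int[gauss]_x (Num.max x 0)%:E)%E; last first.
  by apply: eq_integral => x _; rewrite unlock /= -EFin_max.
rewrite (_ : (\int[gauss]_x (fun x0 : R => x0%:E)^\- x)%E = \int[gauss]_x (Num.max (- x) 0)%:E)%E; last first.
  by apply: eq_integral => x _; rewrite unlock /= -EFin_max.
rewrite E => [|x]; last by rewrite lee_fin le_max lexx orbT.
apply: subee; have := integrable_pos_fin_num measurableT Rintegrable_normal_id.
rewrite (_ : (\int[gauss]_x (EFin \o (fun x0 : R => x0))^\+ x)%E = \int[gauss]_x (Num.max x 0)%:E)%E //.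
by apply: eq_integral => x _; rewrite unlock /= -EFin_max.
Qed.

Lemma Rintegral_normal_sqr_gt0 : 0 < \int[gauss]_x (x ^+ 2).
Proof.
rewrite lt0r Rintegral_ge0 ?andbT => [|x _]; last exact: sqr_ge0.
apply/eqP => s0.
have : (\int[gauss]_x `|(x ^+ 2)%:E| = 0)%E.
  under eq_integral do rewrite gee0_abs ?lee_fin ?sqr_ge0 //.
  by rewrite (RintegralE Rintegrable_normal_sqr) s0.
move/(ae_eq_integral_abs gauss measurableT (measurable_int gauss Rintegrable_normal_sqr)).
move=> [A [mA A0 sA]].
have n0 : gauss [set 0 : R] = 0%E.
  by rewrite /= /normal_prob integral_set1.
have : (gauss setT <= gauss (A `|` [set 0%R : R]))%E.
  apply: le_measure; rewrite ?inE //; first exact: measurableU.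
  move=> x _; have [->|x0] := eqVneq x 0; [by right|left].
  apply: sA => /= /(_ I) [] /eqP; rewrite sqrf_eq0; exact/negP.
have hU := measureU2 gauss mA (measurable_set1 (0 : R)).
have E : (gauss A + gauss [set 0%R : R] = 0)%E.
  exact: etrans (f_equal2 (fun a b => (a + b)%E) A0 n0) (adde0 _).
move=> h; have : (gauss setT <= 0)%E.
  exact: le_trans h (eq_ind _ (fun z => (gauss _ <= z)%E) hU _ E).
by rewrite probability_setT lee_fin ler10.
Qed.


End normal_law.

Section tonelli_curried.
Context {R : realType} {d1 d2 : measure_display} {T1 : measurableType d1}
  {T2 : measurableType d2}.
Variables (m1 : probability T1 R) (m2 : probability T2 R).

Lemma measurable_tonelli dS (S : measurableType dS) (F : S -> T2 -> \bar R) :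
  measurable_fun setT (fun u : S * T2 => F u.1 u.2) -> (forall s t, 0 <= F s t)%E ->
  measurable_fun setT (fun s => \int[m2]_t F s t)%E.
Proof.
move=> mF F0.
exact: (measurable_fun_fubini_tonelli_F (m2 := m2) (fun u : S * T2 => F u.1 u.2)).
Qed.

Lemma tonelli_swap (F : T1 -> T2 -> \bar R) :
  measurable_fun setT (fun u : T1 * T2 => F u.1 u.2) -> (forall s t, 0 <= F s t)%E ->
  (\int[m1]_s \int[m2]_t F s t = \int[m2]_t \int[m1]_s F s t)%E.
Proof.
move=> mF F0.
exact: (fubini_tonelli (m1 := m1) (m2 := m2) (fun u : T1 * T2 => F u.1 u.2)).
Qed.

Lemma tonelli_prod (F : T1 * T2 -> \bar R) :
  measurable_fun setT F -> (forall u, 0 <= F u)%E ->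
  (\int[(m1 \x m2)%E]_u F u = \int[m1]_s \int[m2]_t F (s, t))%E.
Proof. by move=> mF F0; rewrite (fubini_tonelli1 (m1 := m1) (m2 := m2) F). Qed.

End tonelli_curried.

Section gaussian_vector.
Context {R : realType} (d : nat).
Local Notation gauss := (normal_prob (0 : R) 1).

Definition stable_law dT (T : measurableType dT) (Q : probability T R)
    (W : T -> 'cV[R]_d) : Prop :=
  forall (g : 'cV[R]_d -> \bar R) (a b : R), 0 <= a -> 0 <= b ->
    measurable_fun [set: borel R d] g -> (forall x, 0 <= g x)%E ->
    (\int[Q]_s \int[Q]_t g (a *: W s + b *: W t)%R =
     \int[Q]_t g (Num.sqrt (a ^+ 2 + b ^+ 2) *: W t)%R)%E.

Lemma measurable_borel_comp dS (S : measurableType dS) dE (E : measurableType dE)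
    (g : 'cV[R]_d -> E) (phi : S -> 'cV[R]_d) :
  measurable_fun [set: borel R d] (g : borel R d -> E) ->
  (forall i, measurable_fun setT (fun t => phi t i 0)) ->
  measurable_fun setT (fun t => g (phi t)).
Proof.
move=> mg mphi; apply: (measurableT_comp (f := (g : borel R d -> E))
  (g := (phi : S -> borel R d))) => //.
exact: measurable_to_borel.
Qed.

Record gaussian_spec (l : seq 'cV[R]_d) dT (T : measurableType dT)
    (Q : probability T R) (W : T -> 'cV[R]_d) : Prop := {
  gs_meas : forall i, measurable_fun setT (fun t => W t i 0);
  gs_sqr : forall i, Rintegrable Q (fun t => W t i 0 ^+ 2);
  gs_mean : forall i, \int[Q]_t W t i 0 = 0;
  gs_cov : forall i j, \int[Q]_t (W t i 0 * W t j 0) = \sum_(a <- l) a i 0 * a j 0;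
  gs_stable : stable_law Q W }.

Lemma Rintegrable_mul dT (T : measurableType dT) (Q : probability T R) (f g : T -> R) :
  measurable_fun setT f -> measurable_fun setT g ->
  Rintegrable Q (fun t => f t ^+ 2) -> Rintegrable Q (fun t => g t ^+ 2) ->
  Rintegrable Q (fun t => f t * g t).
Proof.
move=> mf mg fi gi; apply: (Rintegrable_le _ _ (RintegrableD fi gi)).
  exact: measurable_funM.
move=> t; rewrite ler_norml; apply/andP.
have := sqr_ge0 (f t + g t); have := sqr_ge0 (f t - g t).
by have := sqr_ge0 (f t); have := sqr_ge0 (g t); split; nra.
Qed.

Lemma Rintegrable_sqrW dT (T : measurableType dT) (Q : probability T R) (f : T -> R) :
  measurable_fun setT f -> Rintegrable Q (fun t => f t ^+ 2) -> Rintegrable Q f.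
Proof.
move=> mf fi; have c1 : Rintegrable Q (fun=> 1 : R) by exact: finite_measure_integrable_cst.
apply: (Rintegrable_le _ _ (RintegrableD c1 fi)) => // t.
by rewrite ler_norml; apply/andP; split; nra.
Qed.

Definition add_direction T (W : T -> 'cV[R]_d) (a : 'cV[R]_d)
  (t : T * measurableTypeR R) : 'cV[R]_d := W t.1 + (t.2 : R) *: a.

Definition normal_variance : R := \int[gauss]_x (x ^+ 2).

Section gaussian_add.
Context {dT : measure_display} {T : measurableType dT} (Q : probability T R).
Variables (W : T -> 'cV[R]_d) (l : seq 'cV[R]_d) (a : 'cV[R]_d).
Hypothesis spec : gaussian_spec l Q W.

Local Notation R' := (measurableTypeR R).
Local Notation W' := (add_direction W a).
Local Notation Q' := (Q \x gauss)%E.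

Let mW i : measurable_fun setT (fun t => W t i 0). Proof. exact: (gs_meas spec). Qed.

Lemma add_meas i : measurable_fun setT (fun t => W' t i 0).
Proof.
have -> : (fun t => W' t i 0) = (fun t : T * R' => W t.1 i 0 + t.2 * a i 0).
  by apply/funext => t; rewrite !mxE.
apply: measurable_funD; first exact: (measurableT_comp (mW i)).
exact: measurable_funM.
Qed.

Let fst_int (f : T -> R) : Rintegrable Q f -> Rintegrable Q' (fun t => f t.1) /\
  \int[Q']_t f t.1 = \int[Q]_t f t.
Proof.
move=> fi; have mf := Rintegrable_meas fi.
have mf1 : measurable_fun setT (fun t : T * R' => f t.1) by exact: measurableT_comp.
have I : Rintegrable Q' (fun t => f t.1).
  apply/integrable12ltyP; first exact/measurable_EFinP.
  have E x : (\int[gauss]_y `|(f x)%:E| = (`|f x|)%:E)%E.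
    rewrite integral_cst //. rewrite [X in (_ * X)%E](probability_setT gauss) mule1. done.
  under eq_integral do rewrite /= E.
  have := integrable_lty measurableT (Rintegrable_norm fi).
  by apply: le_lt_trans; exact: lexx.
split=> //; rewrite Rfubini //; apply: eq_Rintegral => t _.
exact: (Rintegral_cstT gauss (f t)).
Qed.

Let prod_int (f : T -> R) (g : R' -> R) : Rintegrable Q f -> Rintegrable gauss g ->
  Rintegrable Q' (fun t => f t.1 * g t.2) /\
  \int[Q']_t (f t.1 * g t.2) = \int[Q]_t f t * \int[gauss]_x g x.
Proof.
move=> fi gi; have mf := Rintegrable_meas fi; have mg := Rintegrable_meas gi.
have mfg : measurable_fun setT (fun t : T * R' => f t.1 * g t.2).
  by apply: measurable_funM; exact: measurableT_comp.
have I : Rintegrable Q' (fun t => f t.1 * g t.2).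
  apply/integrable12ltyP; first exact/measurable_EFinP.
  have E x : (\int[gauss]_y `|(f x * g y)%:E| = (`|f x| * \int[gauss]_y `|g y|)%:E)%E.
    rewrite -RintegralZ; last exact: Rintegrable_norm.
    rewrite -RintegralE; last by apply: RintegrableZ; exact: Rintegrable_norm.
    by apply: eq_integral => y _ /=; rewrite normrM.
  under eq_integral do rewrite /= E.
  have := RintegrableZ (\int[gauss]_y `|g y|) (Rintegrable_norm fi).
  move=> /(integrable_lty measurableT); apply: le_lt_trans.
  by rewrite le_eqVlt; apply/orP; left; apply/eqP; apply: eq_integral => x _ /=; rewrite mulrC.
split=> //; rewrite Rfubini //.
transitivity (\int[Q]_x (\int[gauss]_y g y * f x)).
  by apply: eq_Rintegral => x _ /=; rewrite RintegralZ // mulrC.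
by rewrite RintegralZ // mulrC.
Qed.

Let c1 : Rintegrable Q (fun=> 1 : R).
Proof. exact: finite_measure_integrable_cst. Qed.

Let snd_int (g : R' -> R) : Rintegrable gauss g -> Rintegrable Q' (fun t => g t.2) /\
  \int[Q']_t g t.2 = \int[gauss]_x g x.
Proof.
move=> gi; have [I E] := prod_int c1 gi; split.
  by apply: eq_Rintegrable I => t; rewrite mul1r.
transitivity (\int[Q']_t (1 * g t.2)); first by apply: eq_Rintegral => t _; rewrite mul1r.
by rewrite E (Rintegral_cstT Q (1 : R)) mul1r.
Qed.

Local Notation s2 := normal_variance.

Lemma add_cov0 i j : Rintegrable Q' (fun t => W' t i 0 * W' t j 0) /\
  \int[Q']_t (W' t i 0 * W' t j 0) = \int[Q]_t (W t i 0 * W t j 0) + s2 * (a i 0 * a j 0).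
Proof.
have Wij := Rintegrable_mul (mW i) (mW j) (gs_sqr spec i) (gs_sqr spec j).
have Wi k := Rintegrable_sqrW (mW k) (gs_sqr spec k).
have [I1 E1] := fst_int Wij.
have [I2 E2] := prod_int (Wi i) (@Rintegrable_normal_id R).
have [I3 E3] := prod_int (Wi j) (@Rintegrable_normal_id R).
have [I4 E4] := snd_int (@Rintegrable_normal_sqr R).
have J2 := RintegrableZ (a j 0) I2; have J3 := RintegrableZ (a i 0) I3.
have J4 := RintegrableZ (a i 0 * a j 0) I4.
have E : (fun t => W' t i 0 * W' t j 0) = (fun t : T * R' => W t.1 i 0 * W t.1 j 0 +
   (a j 0 * (W t.1 i 0 * t.2) + (a i 0 * (W t.1 j 0 * t.2) +
     a i 0 * a j 0 * t.2 ^+ 2))).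
  by apply/funext => t; rewrite !mxE; ring.
have J34 := RintegrableD J3 J4; have J234 := RintegrableD J2 J34.
rewrite E; split; first exact: RintegrableD.
rewrite RintegralD // RintegralD // RintegralD // !RintegralZ // E1 E2 E3 E4.
by rewrite !Rintegral_normal_id !mulr0 !add0r mulrC.
Qed.

Lemma add_sqr i : Rintegrable Q' (fun t => W' t i 0 ^+ 2).
Proof. by have [I _] := add_cov0 i i; apply: eq_Rintegrable I => t; rewrite expr2. Qed.

Lemma add_mean i : \int[Q']_t W' t i 0 = 0.
Proof.
have [I1 E1] := fst_int (Rintegrable_sqrW (mW i) (gs_sqr spec i)).
have [I2 E2] := snd_int (@Rintegrable_normal_id R).
have E : (fun t => W' t i 0) = (fun t : T * R' => W t.1 i 0 + a i 0 * t.2).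
  by apply/funext => t; rewrite !mxE mulrC.
rewrite E RintegralD //; last exact: RintegrableZ.
by rewrite RintegralZ // E1 E2 (gs_mean spec) Rintegral_normal_id mulr0 addr0.
Qed.

Let coordE (al be : R) t x t' x' i :
  (al *: W' (t, x) + be *: W' (t', x')) i 0 =
  al * W t i 0 + be * W t' i 0 + (al * x + be * x') * a i 0.
Proof. by rewrite !mxE /=; ring. Qed.

Lemma add_stable : stable_law Q' W'.
Proof.
move=> g al be al0 be0 mg g0; have mW' := add_meas.
have mgc dS (S : measurableType dS) (phi : S -> 'cV[R]_d) :
    (forall i, measurable_fun setT (fun t => phi t i 0)) ->
    measurable_fun setT (fun t => g (phi t)) by exact: measurable_borel_comp.
pose h (t t' : T) (r : R) := g (al *: W t + be *: W t' + r *: a).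
have hE t x t' x' : g (al *: W' (t, x) + be *: W' (t', x')) =
    h t t' (al * x + be * x').
  by congr g; apply/matrixP => i j; rewrite ord1 coordE !mxE; ring.
pose ga := Num.sqrt (al ^+ 2 + be ^+ 2).
have h0 t t' r : (0 <= h t t' r)%E by exact: g0.
have mh dS (S : measurableType dS) (p p' : S -> T) (r : S -> R) :
    measurable_fun setT p -> measurable_fun setT p' -> measurable_fun setT r ->
    measurable_fun setT (fun s => h (p s) (p' s) (r s)).
  move=> mp mp' mr; apply: mgc => i.
  under eq_fun do rewrite !mxE.
  apply: measurable_funD.
    apply: measurable_funD; apply: measurable_funM => //.
      exact: (measurableT_comp (mW i) mp).
    exact: (measurableT_comp (mW i) mp').
  exact: measurable_funM.
have mW'g c : measurable_fun setT (fun t => g (c *: W' t)).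
  by apply: mgc => i; under eq_fun do rewrite mxE; exact: measurable_funM.
have mW2 s : measurable_fun setT (fun t => g (al *: W' s + be *: W' t)).
  apply: mgc => i; under eq_fun do rewrite mxE [X in _ + X]mxE.
  by apply: measurable_funD => //; exact: measurable_funM.
have mid : measurable_fun setT (fun t : T => t) by exact: measurable_id.
pose H t1 t2 x1 := (\int[gauss]_x2 h t1 t2 (al * x1 + be * x2)%R)%E.
have H0 t1 t2 x1 : (0 <= H t1 t2 x1)%E by exact: integral_ge0.
have mH dS (S : measurableType dS) (p p' : S -> T) (r : S -> R') :
    measurable_fun setT p -> measurable_fun setT p' -> measurable_fun setT r ->
    measurable_fun setT (fun s => H (p s) (p' s) (r s)).
  move=> mp mp' mr; apply: measurable_tonelli => [|*]; last exact: h0.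
  apply: mh; [exact: measurableT_comp|exact: measurableT_comp|].
  apply: measurable_funD; apply: measurable_funM => //.
  exact: (measurableT_comp mr).
have step1 s : (\int[Q']_t g (al *: W' s + be *: W' t)%R = \int[Q]_t2 H s.1 t2 s.2)%E.
  rewrite (tonelli_prod Q gauss (mW2 s) (fun=> g0 _)).
  apply: eq_integral => t' _; apply: eq_integral => x' _.
  by case: s => s1 s2' /=; rewrite hE.
under eq_integral do rewrite step1.
have mH1 : measurable_fun setT (fun s : T * R' => \int[Q]_t2 H s.1 t2 s.2)%E.
  apply: measurable_tonelli => [|*]; last exact: H0.
  apply: mH => //; exact: measurableT_comp.
have H10 (s : T * R') : (0 <= \int[Q]_t2 H s.1 t2 s.2)%E.
  by apply: integral_ge0.
rewrite (tonelli_prod Q gauss mH1 H10).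
have step2 t1 : (\int[gauss]_x1 \int[Q]_t2 H t1 t2 x1 =
    \int[gauss]_x \int[Q]_t2 h t1 t2 (ga * x)%R)%E.
  rewrite tonelli_swap //; last by apply: mH => //; exact: measurable_cst.
  rewrite [RHS](tonelli_swap gauss Q (F := fun x t2 => h t1 t2 (ga * x)%R)); first last.
  - by move=> *; exact: h0.
  - by apply: mh => //; exact: measurable_funM.
  apply: eq_integral => t2 _; rewrite /H.
  by apply: normal_stable => //; apply: mh => //; exact: measurable_cst.
under eq_integral do rewrite step2.
rewrite tonelli_swap; first last.
- by move=> *; exact: integral_ge0.
- apply: measurable_tonelli => //; apply: mh => //; first exact: measurableT_comp.
  by apply: measurable_funM => //; exact: measurableT_comp.
have gE x t : g (ga *: W t + (ga * x) *: a) = g (ga *: W' (t, x)).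
  by congr g; rewrite /add_direction scalerDr scalerA.
rewrite [RHS](tonelli_prod Q gauss (mW'g ga) (fun=> g0 _)).
rewrite [RHS](tonelli_swap Q gauss
  (F := fun t x => g (ga *: W' (t, x)))); first last.
- by move=> *; exact: g0.
- apply: mgc => i; under eq_fun do rewrite mxE.
  exact: measurable_funM.
apply: eq_integral => x _.
under [RHS]eq_integral do rewrite -gE.
apply: (gs_stable spec (g := fun z => g (z + (ga * x) *: a))) => //.
apply: (@mgc _ (borel R d)) => i; under eq_fun do rewrite mxE.
apply: measurable_funD; last exact: measurable_cst.
by apply: continuous_borel_measurable; exact: coord_continuous.
Qed.

Lemma add_cov i j : \int[Q']_t (W' t i 0 * W' t j 0) =
  \int[Q]_t (W t i 0 * W t j 0) + s2 * (a i 0 * a j 0).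
Proof. by have [] := add_cov0 i j. Qed.

End gaussian_add.


Lemma gaussian_spec_cons dT (T : measurableType dT) (Q : probability T R)
    (W : T -> 'cV[R]_d) l a : gaussian_spec l Q W ->
  gaussian_spec (Num.sqrt normal_variance *: a :: l) (Q \x gauss)%E (add_direction W a).
Proof.
move=> spec; split.
- exact: (add_meas a spec).
- exact: (add_sqr a spec).
- exact: (add_mean a spec).
- move=> i j; rewrite (add_cov a spec) big_cons (gs_cov spec) addrC !mxE.
  have -> : Num.sqrt normal_variance * a i 0 * (Num.sqrt normal_variance * a j 0) =
    Num.sqrt normal_variance ^+ 2 * (a i 0 * a j 0) by ring.
  by rewrite sqr_sqrtr // ltW // Rintegral_normal_sqr_gt0.
- exact: (add_stable a spec).
Qed.

Lemma gaussian_spec_nil : gaussian_spec [::] (dirac tt : probability unit R) (fun=> 0).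
Proof.
split.
- by move=> i; exact: measurable_cst.
- by move=> i; apply: (Rintegrable_bounded _ (K := 0)) => [|t];
    rewrite ?mxE ?expr0n ?normr0 //; exact: measurable_cst.
- by move=> i; under eq_Rintegral do rewrite mxE; rewrite Rintegral_cstT.
- move=> i j; rewrite big_nil; under eq_Rintegral do rewrite mxE mul0r.
  by rewrite Rintegral_cstT.
- move=> g a b a0 b0 mg g0.
  by rewrite !scaler0; under eq_integral do under eq_integral do rewrite addr0; rewrite integral_cst // [X in (_ * X)%E]probability_setT mule1.
Qed.

Lemma gaussian_vector_exists (l : seq 'cV[R]_d) :
  exists dT (T : measurableType dT) (Q : probability T R) (W : T -> 'cV[R]_d),
    gaussian_spec l Q W.
Proof.
elim: l => [|a l [dT [T [Q [W spec]]]]].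
  by exists _, unit, (dirac tt : probability unit R), (fun=> 0); exact: gaussian_spec_nil.
have := gaussian_spec_cons ((Num.sqrt normal_variance)^-1 *: a) spec.
rewrite scalerA divff ?scale1r; last first.
  by rewrite gt_eqF // sqrtr_gt0 Rintegral_normal_sqr_gt0.
by move=> H; do 4 eexists; exact: H.
Qed.

End gaussian_vector.

Section psd_decomposition.
Context {R : realType} (d : nat).
Implicit Types (A : 'M[R]_d) (a : 'cV[R]_d).

Lemma bilmx_line A a i (s : R) : A^T = A ->
  bilmx A (a - s *: delta_mx i 0) (a - s *: delta_mx i 0) =
  bilmx A a a - 2 * s * (A *m a) i 0 + s ^+ 2 * A i i.
Proof.
move=> As; have r1 : bilmx A a (delta_mx i 0) = (A *m a) i 0.
  rewrite bilmxE mxE; apply: eq_bigr => k _; rewrite (bigD1 i) //= big1 => [|j /negPf ji].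
    by rewrite mxE !eqxx mulr1 addr0 -[in LHS]As mxE mulrC.
  by rewrite mxE ji /= mulr0 mul0r.
have r2 : bilmx A (delta_mx i 0) a = (A *m a) i 0.
  rewrite bilmxE (bigD1 i) //= [X in _ + X]big1 ?addr0 => [|k /negPf ki].
    by rewrite [RHS]mxE; apply: eq_bigr => j _; rewrite mxE !eqxx mul1r mulrC.
  by rewrite big1 // => j _; rewrite mxE ki /= !mul0r.
rewrite -scaleNr bilmxDD; have bZl (t : R) x y : bilmx A (t *: x) y = t * bilmx A x y.
  by rewrite !bilmxE mulr_sumr; apply: eq_bigr => k _; rewrite mulr_sumr;
    apply: eq_bigr => l _; rewrite mxE; ring.
have bZr (t : R) x y : bilmx A x (t *: y) = t * bilmx A x y.
  by rewrite !bilmxE mulr_sumr; apply: eq_bigr => k _; rewrite mulr_sumr;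
    apply: eq_bigr => l _; rewrite mxE; ring.
by rewrite !(bZl, bZr) r1 r2 bilmx_delta; ring.
Qed.

(* Each deflation step A - (A e_i)(A e_i)^T / A_ii kills row i, keeps the rows
   that already vanish, and keeps A positive semidefinite. *)
Lemma psd_deflation (k : nat) A : A^T = A -> (forall a, 0 <= bilmx A a a) ->
  (forall i j : 'I_d, (k <= i)%N -> A i j = 0) ->
  exists l : seq 'cV[R]_d, forall i j, A i j = \sum_(a <- l) a i 0 * a j 0.
Proof.
elim: k A => [|k IH] A As A0 Ak.
  by exists [::] => i j; rewrite big_nil Ak.
have sym i j : A i j = A j i by rewrite -[in LHS]As mxE.
have [dk|kd] := leqP d k.
  by apply: (IH A) => // i j ki; have := leq_trans dk ki; rewrite leqNgt ltn_ord.
pose i0 := Ordinal kd; have c0 : 0 <= A i0 i0 by rewrite -bilmx_delta.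
have [cz|cn] := eqVneq (A i0 i0) 0.
  apply: (IH A) => // i j; rewrite leq_eqVlt => /orP[/eqP ki|]; last exact: Ak.
  have -> : i = i0 by apply/val_inj.
  pose s := (A j j + 1) / (2 * A i0 j).
  have [//|rn] := eqVneq (A i0 j) 0.
  have := A0 (delta_mx j 0 - s *: delta_mx i0 0).
  rewrite bilmx_line // cz mulr0 addr0 bilmx_delta -colE mxE.
  have -> : 2 * s * A i0 j = A j j + 1.
    by rewrite /s; field.
  by lra.
pose b := Num.sqrt (A i0 i0)^-1 *: col i0 A.
pose A' := A - \matrix_(i, j) (b i 0 * b j 0).
have bE i j : b i 0 * b j 0 = (A i0 i0)^-1 * (A i i0 * A j i0).
  have -> : b i 0 * b j 0 = Num.sqrt (A i0 i0)^-1 ^+ 2 * (A i i0 * A j i0).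
    by rewrite !mxE; ring.
  by rewrite sqr_sqrtr // invr_ge0.
have [||i j|l lE] := IH A'.
- by apply/matrixP => i j; rewrite !mxE (sym j i); ring.
- move=> a; rewrite bilmxB.
  have -> : bilmx (\matrix_(i, j) (b i 0 * b j 0)) a a = (A i0 i0)^-1 * (A *m a) i0 0 ^+ 2.
    rewrite bilmxE mxE expr2 mulr_suml mulr_sumr; apply: eq_bigr => i _.
    rewrite mulr_sumr mulr_sumr; apply: eq_bigr => j _.
    by rewrite [in LHS]mxE bE (sym i) (sym j); ring.
  have := A0 (a - ((A i0 i0)^-1 * (A *m a) i0 0) *: delta_mx i0 0).
  rewrite bilmx_line //; set r := (A *m a) i0 0; set c := A i0 i0 in cn *.
  have -> : bilmx A a a - 2 * (c^-1 * r) * r + (c^-1 * r) ^+ 2 * c =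
     bilmx A a a - c^-1 * r ^+ 2 by field.
  by [].
- have -> : A' i j = A i j - b i 0 * b j 0 by rewrite !mxE.
  rewrite bE leq_eqVlt => /orP[/eqP ki|ki]; last first.
    by rewrite !(Ak i) // mul0r mulr0 subr0.
  have -> : i = i0 by apply/val_inj.
  by rewrite mulKf // sym subrr.
exists (b :: l) => i j; rewrite big_cons -lE !mxE; ring.
Qed.

Lemma psd_decomposition A : A^T = A -> (forall a, 0 <= bilmx A a a) ->
  exists l : seq 'cV[R]_d, forall i j, A i j = \sum_(a <- l) a i 0 * a j 0.
Proof.
move=> As A0; apply: (@psd_deflation d) => // i j.
by rewrite leqNgt ltn_ord.
Qed.

End psd_decomposition.

Section jets.
Context {R : realType} (d : nat).
Local Notation V := 'cV[R]_d.
Implicit Types (h : V -> R) (x u : V).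

Definition linform (G1 : 'I_d -> V -> R) x u : R := \sum_i G1 i x * u i 0.
Definition quadform (G2 : 'I_d -> 'I_d -> V -> R) x u : R :=
  \sum_i \sum_j G2 i j x * (u i 0 * u j 0).
Definition taylor2 h G1 G2 x u : R :=
  h (x + u) - h x - linform G1 x u - 2^-1 * quadform G2 x u.

Record jet h (G1 : 'I_d -> V -> R) (G2 : 'I_d -> 'I_d -> V -> R) (C : R) : Prop := {
  jet_meas0 : measurable_fun [set: borel R d] h;
  jet_meas1 : forall i, measurable_fun [set: borel R d] (G1 i);
  jet_meas2 : forall i j, measurable_fun [set: borel R d] (G2 i j);
  jet_le0 : forall x, `|h x| <= C;
  jet_le1 : forall i x, `|G1 i x| <= C;
  jet_le2 : forall i j x, `|G2 i j x| <= C;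
  jet_taylor : forall x u, `|taylor2 h G1 G2 x u| <= C * `|u| ^+ 3 }.

Lemma linform_le G1 C x u : (forall i x, `|G1 i x| <= C) ->
  `|linform G1 x u| <= d%:R * C * `|u|.
Proof.
move=> G1C; rewrite (le_trans (ler_norm_sum _ _ _)) //.
rewrite (le_trans (y := \sum_(i < d) C * `|u|)) //.
  by apply: ler_sum => i _; rewrite normrM ler_pM // mx_entry_le.
by rewrite sumr_const card_ord -mulrA mulr_natl.
Qed.

Lemma quadform_le G2 C x u : (forall i j x, `|G2 i j x| <= C) ->
  `|quadform G2 x u| <= d%:R ^+ 2 * C * `|u| ^+ 2.
Proof.
move=> G2C; rewrite (le_trans (ler_norm_sum _ _ _)) //.
rewrite (le_trans (y := \sum_(i < d) \sum_(j < d) C * `|u| ^+ 2)) //.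
  apply: ler_sum => i _; rewrite (le_trans (ler_norm_sum _ _ _)) //.
  apply: ler_sum => j _; rewrite normrM ler_pM // normrM expr2.
  by rewrite ler_pM // mx_entry_le.
rewrite sumr_const card_ord sumr_const card_ord.
by rewrite le_eqVlt; apply/orP; left; apply/eqP; rewrite expr2 -!mulrA !mulr_natl.
Qed.

Definition jet_const (C : R) : R := 2 * (1 + d%:R) ^+ 2 * C.

Section jet_bounds.
Variables (h : V -> R) (G1 : 'I_d -> V -> R) (G2 : 'I_d -> 'I_d -> V -> R) (C : R).
Hypothesis J : jet h G1 G2 C.
Local Notation K := (jet_const C).
Local Notation D := (d%:R : R).

Let L x u := linform_le x u (jet_le1 J).
Let Q x u := quadform_le x u (jet_le2 J).
Let D0 : 0 <= D. Proof. by []. Qed.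

Lemma jet_C0 : 0 <= C.
Proof. exact: le_trans (jet_le0 J 0). Qed.

Let small u : `|u| <= 1 -> `|u| ^+ 3 <= `|u| ^+ 2 /\ `|u| ^+ 2 <= `|u|.
Proof. by move=> u1; rewrite !exprSr expr0 mul1r; have := normr_ge0 u; split; nra. Qed.

Let large u : 1 < `|u| -> 1 <= `|u| ^+ 2 /\ `|u| <= `|u| ^+ 2.
Proof. by move=> u1; rewrite !exprSr expr0 mul1r; split; nra. Qed.

Let CD : 0 <= C * D /\ 0 <= C * D ^+ 2.
Proof. by have := jet_C0; split; rewrite mulr_ge0 // exprn_ge0. Qed.

Lemma jet_taylor_sqr x u : `|taylor2 h G1 G2 x u| <= K * `|u| ^+ 2.
Proof.
have := jet_C0; have [cd cdd] := CD; have u0 := normr_ge0 u => C0.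
have [u1|u1] := leP `|u| 1.
  have [a b] := small u1; apply: (le_trans (jet_taylor J x u)).
  rewrite /jet_const ler_pM ?exprn_ge0 //.
  by rewrite -subr_ge0 [leRHS](_ : _ = C + 4 * (C * D) + 2 * (C * D ^+ 2)); [lra|ring].
have [a b] := large u1; rewrite /taylor2.
have hh : `|h (x + u) - h x| <= 2 * C * `|u| ^+ 2.
  rewrite (le_trans (ler_normB _ _)) // (le_trans (lerD (jet_le0 J _) (jet_le0 J _))) //; nra.
have l2 : `|linform G1 x u| <= D * C * `|u| ^+ 2.
  by apply: (le_trans (L _ _)); rewrite ler_wpM2l // mulr_ge0.
have q2 : `|2^-1 * quadform G2 x u| <= D ^+ 2 * C * `|u| ^+ 2.
  rewrite normrM ger0_norm //; have := Q x u.
  by have := normr_ge0 (quadform G2 x u); lra.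
rewrite (le_trans (ler_normB _ _)) // (le_trans (lerD (ler_normB _ _) (lexx _))) //.
apply: (le_trans (lerD (lerD hh l2) q2)); rewrite -!mulrDl /jet_const ler_wpM2r //.
by rewrite -subr_ge0 [leRHS](_ : _ = 3 * (C * D) + C * D ^+ 2); [lra|ring].
Qed.

Lemma jet_taylor1 x u : `|h (x + u) - h x - linform G1 x u| <= 2 * K * `|u| ^+ 2.
Proof.
have -> : h (x + u) - h x - linform G1 x u =
    taylor2 h G1 G2 x u + 2^-1 * quadform G2 x u by rewrite /taylor2; ring.
rewrite (le_trans (ler_normD _ _)) // [2 * K]mulrDl mul1r mulrDl.
apply: lerD; first exact: jet_taylor_sqr.
rewrite normrM ger0_norm //; have := Q x u; have [cd cdd] := CD => q.
have : D ^+ 2 * C * `|u| ^+ 2 <= K * `|u| ^+ 2.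
  rewrite ler_wpM2r ?exprn_ge0 // /jet_const; have c0 := jet_C0.
  by rewrite -subr_ge0 [leRHS](_ : _ = 2 * C + 4 * (C * D) + C * D ^+ 2); [lra|ring].
by have := normr_ge0 (quadform G2 x u); lra.
Qed.

Lemma jet_lipschitz x u : `|h (x + u) - h x| <= 3 * K * `|u|.
Proof.
have := jet_C0; have [cd cdd] := CD; have u0 := normr_ge0 u => C0.
have K0 : 2 * C <= K /\ D * C <= K.
  by split; rewrite -subr_ge0 /jet_const;
  [rewrite [leRHS](_ : _ = 4 * (C * D) + 2 * (C * D ^+ 2))
  |rewrite [leRHS](_ : _ = 2 * C + 3 * (C * D) + 2 * (C * D ^+ 2))]; try ring; lra.
have [K2 KD] := K0.
have [u1|u1] := leP `|u| 1; last first.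
  have Ku : K <= K * `|u| by rewrite ler_peMr ?(ltW u1) //; lra.
  rewrite (le_trans (ler_normB _ _)) // (le_trans (lerD (jet_le0 J _) (jet_le0 J _))) //.
  by rewrite -mulrA; lra.
have [a b] := small u1.
have -> : h (x + u) - h x = (h (x + u) - h x - linform G1 x u) + linform G1 x u by ring.
rewrite (le_trans (ler_normD _ _)) // (le_trans (lerD (jet_taylor1 _ _) (L _ _))) //.
rewrite (_ : 3 * K * `|u| = 2 * K * `|u| + K * `|u|); last by ring.
apply: lerD; last by rewrite ler_wpM2r.
by rewrite ler_wpM2l //; lra.
Qed.

End jet_bounds.

Definition smooth h := exists G1 G2 C, jet h G1 G2 C.

Lemma smooth_cst c : smooth (fun=> c).
Proof.
exists (fun _ _ => 0), (fun _ _ _ => 0), `|c|; split=> [|i|i j|x|i x|i j x|x u]; rewrite ?normr0 //;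
  try exact: measurable_cst.
rewrite /taylor2 /linform /quadform big1 => [|i _]; last by rewrite mul0r.
rewrite big1 => [|i _]; last by rewrite big1 // => j _; rewrite mul0r.
by rewrite mulr0 !subr0 subrr normr0 mulr_ge0 // exprn_ge0.
Qed.

Lemma linformD G1 G1' x u :
  linform (fun i x => G1 i x + G1' i x) x u = linform G1 x u + linform G1' x u.
Proof. by rewrite /linform -big_split; apply: eq_bigr => i _; rewrite mulrDl. Qed.

Lemma linformZ (p : V -> R) G1 x u :
  linform (fun i x => p x * G1 i x) x u = p x * linform G1 x u.
Proof. by rewrite /linform mulr_sumr; apply: eq_bigr => i _; rewrite mulrA. Qed.

Lemma quadformD G2 G2' x u :
  quadform (fun i j x => G2 i j x + G2' i j x) x u = quadform G2 x u + quadform G2' x u.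
Proof.
rewrite /quadform -big_split; apply: eq_bigr => i _; rewrite -big_split.
by apply: eq_bigr => j _; rewrite mulrDl.
Qed.

Lemma quadformZ (p : V -> R) G2 x u :
  quadform (fun i j x => p x * G2 i j x) x u = p x * quadform G2 x u.
Proof.
rewrite /quadform mulr_sumr; apply: eq_bigr => i _; rewrite mulr_sumr.
by apply: eq_bigr => j _; rewrite -mulrA.
Qed.

Lemma quadform_linform G1 G1' x u :
  quadform (fun i j x => G1 i x * G1' j x) x u = linform G1 x u * linform G1' x u.
Proof.
rewrite /quadform /linform mulr_suml; apply: eq_bigr => i _; rewrite mulr_sumr.
by apply: eq_bigr => j _; ring.
Qed.

Lemma smoothD h k : smooth h -> smooth k -> smooth (fun x => h x + k x).
Proof.
move=> [G1 [G2 [C J]]] [H1 [H2 [D K]]].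
exists (fun i x => G1 i x + H1 i x), (fun i j x => G2 i j x + H2 i j x), (C + D).
split=> [|i|i j|x|i x|i j x|x u].
- by apply: measurable_funD; [exact: jet_meas0 J|exact: jet_meas0 K].
- by apply: measurable_funD; [exact: jet_meas1 J _|exact: jet_meas1 K _].
- by apply: measurable_funD; [exact: jet_meas2 J _ _|exact: jet_meas2 K _ _].
- by rewrite (le_trans (ler_normD _ _)) // lerD // ?(jet_le0 J) ?(jet_le0 K).
- by rewrite (le_trans (ler_normD _ _)) // lerD // ?(jet_le1 J) ?(jet_le1 K).
- by rewrite (le_trans (ler_normD _ _)) // lerD // ?(jet_le2 J) ?(jet_le2 K).
have -> : taylor2 (fun x => h x + k x) (fun i x => G1 i x + H1 i x)
    (fun i j x => G2 i j x + H2 i j x) x u = taylor2 h G1 G2 x u + taylor2 k H1 H2 x u.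
  by rewrite /taylor2 linformD quadformD; ring.
rewrite mulrDl (le_trans (ler_normD _ _)) // lerD //; first exact: jet_taylor J _ _.
exact: jet_taylor K _ _.
Qed.

Lemma smoothM h k : smooth h -> smooth k -> smooth (fun x => h x * k x).
Proof.
move=> [G1 [G2 [C J]]] [H1 [H2 [D K]]].
pose E1 i x := h x * H1 i x + k x * G1 i x.
pose E2 i j x := (h x * H2 i j x + k x * G2 i j x) + 2 * (G1 i x * H1 j x).
have C0 := jet_C0 J; have D0 := jet_C0 K.
have K0 (B : R) : 0 <= B -> 0 <= jet_const B by move=> B0; rewrite !mulr_ge0 // exprn_ge0.
have d0 : 0 <= d%:R :> R by [].
pose A := 4 * C * D + 2 * C * D + (C * D + D * C) +
  (2 * jet_const C * (d%:R * D) + 3 * jet_const C * (d%:R ^+ 2 * D)).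
have CD0 := mulr_ge0 C0 D0.
have A1 : 0 <= 2 * jet_const C * (d%:R * D).
  by apply: mulr_ge0; apply: mulr_ge0 => //; exact: K0.
have A2 : 0 <= 3 * jet_const C * (d%:R ^+ 2 * D).
  by apply: mulr_ge0; apply: mulr_ge0 => //; exact: K0.
have bd (p q p' q' : R) : `|p| <= p' -> `|q| <= q' -> `|p * q| <= p' * q'.
  by move=> pp qq; rewrite normrM ler_pM.
exists E1, E2, A; split=> [|i|i j|x|i x|i j x|x u].
- by apply: measurable_funM; [exact: jet_meas0 J|exact: jet_meas0 K].
- apply: measurable_funD.
    by apply: measurable_funM; [exact: jet_meas0 J|exact: jet_meas1 K _].
  by apply: measurable_funM; [exact: jet_meas0 K|exact: jet_meas1 J _].
- apply: measurable_funD.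
    apply: measurable_funD.
      by apply: measurable_funM; [exact: jet_meas0 J|exact: jet_meas2 K _ _].
    by apply: measurable_funM; [exact: jet_meas0 K|exact: jet_meas2 J _ _].
  apply: measurable_funM => //.
  by apply: measurable_funM; [exact: jet_meas1 J _|exact: jet_meas1 K _].
- apply: (le_trans (bd _ _ _ _ (jet_le0 J x) (jet_le0 K x))); rewrite /A; lra.
- rewrite (le_trans (ler_normD _ _)) //.
  have := bd _ _ _ _ (jet_le0 J x) (jet_le1 K i x).
  have := bd _ _ _ _ (jet_le0 K x) (jet_le1 J i x).
  by rewrite /A; lra.
- rewrite (le_trans (ler_normD _ _)) // (le_trans (lerD (ler_normD _ _) (lexx _))) //.
  have := bd _ _ _ _ (jet_le0 J x) (jet_le2 K i j x).
  have := bd _ _ _ _ (jet_le0 K x) (jet_le2 J i j x).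
  have := bd _ _ _ _ (jet_le1 J i x) (jet_le1 K j x).
  by rewrite [X in _ + X <= _]normrM ger0_norm // /A; lra.
pose r := taylor2 h G1 G2 x u; pose s := taylor2 k H1 H2 x u.
pose L1 := linform H1 x u; pose Q1 := quadform H2 x u.
have -> : taylor2 (fun x => h x * k x) E1 E2 x u =
    h (x + u) * s + k x * r + ((h (x + u) - h x - linform G1 x u) * L1 +
    2^-1 * ((h (x + u) - h x) * Q1)).
  rewrite /s /r /L1 /Q1 /taylor2 /E1 /E2 linformD !linformZ !quadformD !quadformZ.
  by rewrite quadform_linform; field.
have b1 := bd _ _ _ _ (jet_le0 J (x + u)) (jet_taylor K x u).
have b2 := bd _ _ _ _ (jet_le0 K x) (jet_taylor J x u).
have b3 := bd _ _ _ _ (jet_taylor1 J x u) (linform_le x u (jet_le1 K)).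
have b4 := bd _ _ _ _ (jet_lipschitz J x u) (quadform_le x u (jet_le2 K)).
have u0 := normr_ge0 u; have u3 : 0 <= `|u| ^+ 3 by exact: exprn_ge0.
rewrite (le_trans (ler_normD _ _)) // (le_trans (lerD (ler_normD _ _) (ler_normD _ _))) //.
rewrite [X in _ + (_ + X) <= _]normrM [`|2^-1|]ger0_norm //.
have -> : A * `|u| ^+ 3 = 4 * (C * D * `|u| ^+ 3) + 2 * (C * D * `|u| ^+ 3) +
    (C * (D * `|u| ^+ 3) + D * (C * `|u| ^+ 3)) +
    (2 * jet_const C * `|u| ^+ 2 * (d%:R * D * `|u|) +
     3 * jet_const C * `|u| * (d%:R ^+ 2 * D * `|u| ^+ 2)).
  by rewrite /A; ring.
have e3 := mulr_ge0 CD0 u3.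
have := normr_ge0 ((h (x + u) - h x) * Q1).
by rewrite -/s -/r -/L1 -/Q1 in b1 b2 b3 b4 *; lra.
Qed.

Lemma smooth_sum (I : Type) (r : seq I) (F : I -> V -> R) :
  (forall i, smooth (F i)) -> smooth (fun x => \sum_(i <- r) F i x).
Proof.
move=> sF; elim: r => [|i r IH].
  by under eq_fun do rewrite big_nil; exact: smooth_cst.
by under eq_fun do rewrite big_cons; exact: smoothD.
Qed.

Lemma smooth_prod (I : Type) (r : seq I) (F : I -> V -> R) :
  (forall i, smooth (F i)) -> smooth (fun x => \prod_(i <- r) F i x).
Proof.
move=> sF; elim: r => [|i r IH].
  by under eq_fun do rewrite big_nil; exact: smooth_cst.
by under eq_fun do rewrite big_cons; exact: smoothM.
Qed.

Lemma smooth_coord (p p1 p2 : R -> R) (C : R) (k : 'I_d) :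
  measurable_fun setT p -> measurable_fun setT p1 -> measurable_fun setT p2 ->
  (forall t, `|p t| <= C) -> (forall t, `|p1 t| <= C) -> (forall t, `|p2 t| <= C) ->
  (forall t s, `|p (t + s) - p t - p1 t * s - 2^-1 * (p2 t * s ^+ 2)| <= C * `|s| ^+ 3) ->
  smooth (fun x => p (x k 0)).
Proof.
move=> mp mp1 mp2 pC p1C p2C T.
have C0 : 0 <= C by exact: le_trans (pC 0).
have mc : measurable_fun [set: borel R d] (fun x : V => x k 0).
  by apply: continuous_borel_measurable; exact: coord_continuous.
exists (fun i x => (i == k)%:R * p1 (x k 0)),
  (fun i j x => (i == k)%:R * (j == k)%:R * p2 (x k 0)), C.
split=> [|i|i j|x|i x|i j x|x u] //.
- exact: (measurableT_comp mp mc).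
- apply: measurable_funM; first exact: measurable_cst.
  exact: (measurableT_comp mp1 mc).
- apply: measurable_funM; first exact: measurable_cst.
  exact: (measurableT_comp mp2 mc).
- by case: (i == k); rewrite ?mul1r // mul0r normr0.
- by case: (i == k); case: (j == k); rewrite ?mulr1 ?mul1r ?mulr0 ?mul0r ?normr0.
have -> : taylor2 (fun x => p (x k 0)) (fun i x => (i == k)%:R * p1 (x k 0))
    (fun i j x => (i == k)%:R * (j == k)%:R * p2 (x k 0)) x u =
    p (x k 0 + u k 0) - p (x k 0) - p1 (x k 0) * u k 0 -
    2^-1 * (p2 (x k 0) * u k 0 ^+ 2).
  rewrite /taylor2 /linform /quadform mxE; congr (_ - _ - _ * _).
    by rewrite (bigD1 k) //= big1 ?eqxx ?mul1r ?addr0 // => i /negPf ->; rewrite !mul0r.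
  rewrite (bigD1 k) //= [X in _ + X]big1 ?addr0 => [|i /negPf ->]; last first.
    by rewrite big1 // => j _; rewrite !mul0r.
  rewrite (bigD1 k) //= [X in _ + X]big1 ?addr0 => [|i /negPf ->]; last first.
    by rewrite mulr0 !mul0r.
  by rewrite eqxx !mul1r expr2.
apply: (le_trans (T _ _)); rewrite ler_wpM2l // lerXn2r ?nnegrE //.
exact: mx_entry_le.
Qed.

End jets.

Section spline.
Context {R : realType}.
Implicit Types t s : R.

Definition pospart t : R := Num.max t 0.

(* cubic B-spline smooth step from 0 (at t <= 0) to 1 (at t >= 3), and its first two derivatives *)
Definition step t : R := 6^-1 * (pospart t ^+ 3 - 3 * pospart (t - 1) ^+ 3 +
  3 * pospart (t - 2) ^+ 3 - pospart (t - 3) ^+ 3).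
Definition step1 t : R := 2^-1 * (pospart t ^+ 2 - 3 * pospart (t - 1) ^+ 2 +
  3 * pospart (t - 2) ^+ 2 - pospart (t - 3) ^+ 2).
Definition step2 t : R := pospart t - 3 * pospart (t - 1) +
  3 * pospart (t - 2) - pospart (t - 3).
Definition bump t : R := step t - step (t - 1).

Lemma step_le0 t : t <= 0 -> step t = 0.
Proof.
by move=> t0; rewrite /step /pospart !max_r; try lra; ring.
Qed.

Lemma step_ge3 t : 3 <= t -> step t = 1.
Proof.
by move=> t0; rewrite /step /pospart !max_l; try lra; field.
Qed.

Lemma step1_itv t : `|step1 t| <= 2.
Proof.
rewrite ler_norml /step1 /pospart; apply/andP.
by case: (leP t 0) => ?; case: (leP (t - 1) 0) => ?; case: (leP (t - 2) 0) => ?;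
  case: (leP (t - 3) 0) => ?; try lra; split; rewrite ?expr0n /=; nra.
Qed.

Lemma step2_itv t : `|step2 t| <= 2.
Proof.
rewrite ler_norml /step2 /pospart; apply/andP.
by case: (leP t 0) => ?; case: (leP (t - 1) 0) => ?; case: (leP (t - 2) 0) => ?;
  case: (leP (t - 3) 0) => ?; try lra; split; lra.
Qed.

Lemma bump_ge0 t : 0 <= bump t.
Proof.
have cube (r : R) : 0 <= r -> 0 <= r ^+ 3 by exact: exprn_ge0.
have [t0|t0] := leP t 0; first by rewrite /bump !step_le0 ?subrr //; lra.
have [t4|t4] := leP 4 t; first by rewrite /bump !step_ge3 ?subrr //; lra.
have e1 : t - 1 - 1 = t - 2 by ring.
have e2 : t - 1 - 2 = t - 3 by ring.
have e3 : t - 1 - 3 = t - 4 by ring.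
rewrite /bump /step e1 e2 e3.
have P0 r : r <= 0 -> pospart r = 0 by move=> r0; rewrite /pospart max_r.
have P1 r : 0 <= r -> pospart r = r by move=> r0; rewrite /pospart max_l.
rewrite (P1 t (ltW t0)) (P0 (t - 4)); last by lra.
have [t1|t1] := leP t 1.
  have := cube t (ltW t0); rewrite (P0 (t - 1)); last by lra.
  rewrite (P0 (t - 2)); last by lra.
  rewrite (P0 (t - 3)); last by lra.
  by rewrite !expr0n /=; lra.
have [t2|t2] := leP t 2.
  rewrite (P1 (t - 1)); last by lra.
  rewrite (P0 (t - 2)); last by lra.
  rewrite (P0 (t - 3)) ?expr0n /=; last by lra.
  rewrite [leRHS](_ : _ = 6^-1 * (1 + 3 * (t - 1) + 3 * (t - 1) ^+ 2 * (2 - t))); last by ring.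
  have h : 0 <= 3 * (t - 1) ^+ 2 * (2 - t) by rewrite !mulr_ge0 ?sqr_ge0 //; lra.
  by lra.
have [t3|t3] := leP t 3.
  rewrite (P1 (t - 1)); last by lra.
  rewrite (P1 (t - 2)); last by lra.
  rewrite (P0 (t - 3)) ?expr0n /=; last by lra.
  rewrite [leRHS](_ : _ = 6^-1 * (1 + 3 * (3 - t) + 3 * (3 - t) ^+ 2 * (t - 2))); last by ring.
  have h : 0 <= 3 * (3 - t) ^+ 2 * (t - 2) by rewrite !mulr_ge0 ?sqr_ge0 //; lra.
  by lra.
rewrite (P1 (t - 1)); last by lra.
rewrite (P1 (t - 2)); last by lra.
rewrite (P1 (t - 3)) ?expr0n /=; last by lra.
rewrite [leRHS](_ : _ = 6^-1 * (4 - t) ^+ 3); last by ring.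
by rewrite mulr_ge0 // cube //; lra.
Qed.

Lemma bump_support t : bump t != 0 -> 0 < t < 4.
Proof.
move=> bt; apply/andP; split; rewrite ltNge; apply/negP => h; move: bt; rewrite /bump.
  by rewrite !step_le0 ?subrr ?eqxx //; lra.
by rewrite !step_ge3 ?subrr ?eqxx //; lra.
Qed.

Lemma sum_bump t m : \sum_(j < m) bump (t - j%:R) = step t - step (t - m%:R).
Proof.
elim: m => [|m IH]; first by rewrite big_ord0 subr0 subrr.
rewrite big_ord_recr /= IH /bump (_ : t - m.+1%:R = t - m%:R - 1); first by ring.
by rewrite -(natr1 m); ring.
Qed.

Lemma step_itv t : 0 <= step t <= 1.
Proof.
have sb t' m : 0 <= \sum_(j < m) bump (t' - j%:R) by apply: sumr_ge0 => j _; exact: bump_ge0.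
pose m := (Num.truncn (`|t| + 3)).+1.
have mt : `|t| + 3 < m%:R.
  by rewrite /m -natr1; have /andP[_] := truncn_itv (addr_ge0 (normr_ge0 t) (ler0n R 3)); rewrite natr1.
move: mt; have := ler_norm t; have := ler_norm (- t); rewrite normrN => tn tp mt.
have := sb t m; have := sb (t + m%:R) m.
rewrite !sum_bump addrK (step_le0 (t := t - m%:R)) ?(step_ge3 (t := t + m%:R)); lra.
Qed.

Lemma pospart_taylor t s :
  `|pospart (t + s) ^+ 3 - pospart t ^+ 3 - 3 * pospart t ^+ 2 * s -
     3 * pospart t * s ^+ 2| <= `|s| ^+ 3.
Proof.
rewrite /pospart; have [t0|t0] := leP t 0; have [ts|ts] := leP (t + s) 0.
- by rewrite !expr0n /= !mulr0 !mul0r !subr0 normr0 exprn_ge0.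
- have s0 : 0 < s by lra.
  rewrite !expr0n /= !mulr0 !mul0r !subr0 normrX lerXn2r ?nnegrE //.
  by rewrite !gtr0_norm //; lra.
- have s0 : s < 0 by lra.
  have -> : 0 ^+ 3 - t ^+ 3 - 3 * t ^+ 2 * s - 3 * t * s ^+ 2 = s ^+ 3 - (t + s) ^+ 3 by ring.
  have e (r : R) : - (- r) ^+ 3 = r ^+ 3 by ring.
  have a0 : 0 <= (- (t + s)) ^+ 3 by rewrite exprn_ge0 //; lra.
  have a1 : (- (t + s)) ^+ 3 <= (- s) ^+ 3 by rewrite lerXn2r ?nnegrE; lra.
  by rewrite (ltr0_norm s0) ler_norml -(e s) -(e (t + s)); lra.
have -> : (t + s) ^+ 3 - t ^+ 3 - 3 * t ^+ 2 * s - 3 * t * s ^+ 2 = s ^+ 3 by ring.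
by rewrite normrX.
Qed.

Lemma step_taylor t s :
  `|step (t + s) - step t - step1 t * s - 2^-1 * (step2 t * s ^+ 2)| <= 2 * `|s| ^+ 3.
Proof.
pose F t := pospart (t + s) ^+ 3 - pospart t ^+ 3 - 3 * pospart t ^+ 2 * s -
     3 * pospart t * s ^+ 2.
have -> : step (t + s) - step t - step1 t * s - 2^-1 * (step2 t * s ^+ 2) =
    6^-1 * (F t - 3 * F (t - 1) + 3 * F (t - 2) - F (t - 3)).
  rewrite /step /step1 /step2 /F [t + s - 1]addrAC [t + s - 2]addrAC [t + s - 3]addrAC.
  by field.
have := pospart_taylor t s; have := pospart_taylor (t - 1) s.
have := pospart_taylor (t - 2) s; have := pospart_taylor (t - 3) s.
rewrite -!/(F _) !ler_norml => /andP[? ?] /andP[? ?] /andP[? ?] /andP[? ?].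
by have := exprn_ge0 3 (normr_ge0 s); move=> ?; apply/andP; split; lra.
Qed.

End spline.

Section smooth_approximation.
Context {R : realType} (d : nat).
Local Notation V := 'cV[R]_d.

Lemma measurable_step : [/\ measurable_fun setT (@step R),
  measurable_fun setT (@step1 R) & measurable_fun setT (@step2 R)].
Proof.
have mp0 : measurable_fun setT (@pospart R) by apply: measurable_maxr.
have mp c : measurable_fun setT (fun t : R => pospart (t - c)).
  by apply: (measurableT_comp mp0); apply: measurable_funB.
have mX k : measurable_fun setT (fun t : R => pospart t ^+ k) by exact: measurable_funX.
have mcX c k : measurable_fun setT (fun t : R => pospart (t - c) ^+ k).
  exact: measurable_funX.
split.
- apply: measurable_funM => //; apply: measurable_funB => //.
  by apply: measurable_funD; [apply: measurable_funB|]=> //; apply: measurable_funM.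
- apply: measurable_funM => //; apply: measurable_funB => //.
  by apply: measurable_funD; [apply: measurable_funB|]=> //; apply: measurable_funM.
- apply: measurable_funB => //.
  by apply: measurable_funD; [apply: measurable_funB|]=> //; apply: measurable_funM.
Qed.

Lemma smooth_step (a c : R) (k : 'I_d) : smooth (fun x : V => step (a * x k 0 + c)).
Proof.
have [c0 c1 c2] := measurable_step.
have m (p : R -> R) : measurable_fun setT p -> measurable_fun setT (fun t => p (a * t + c)).
  by move=> mp; apply: (measurableT_comp mp); exact: measurable_affine.
have a3 : 1 <= (1 + `|a|) ^+ 3 by rewrite exprn_ege1 // lerDl.
have a1 : `|a| <= (1 + `|a|) ^+ 3.
  by apply: (le_trans (y := 1 + `|a|)); [lra|rewrite ler_eXnr // lerDl].
have a2 : `|a| ^+ 2 <= (1 + `|a|) ^+ 3.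
  apply: (le_trans (y := (1 + `|a|) ^+ 2)).
    by rewrite lerXn2r ?nnegrE ?addr_ge0 // lerDr.
  by rewrite ler_weXn2l // lerDl.
have a3' : `|a| ^+ 3 <= (1 + `|a|) ^+ 3.
  by rewrite lerXn2r ?nnegrE ?addr_ge0 // lerDr.
apply: (@smooth_coord R d (fun t => step (a * t + c)) (fun t => a * step1 (a * t + c))
  (fun t => a ^+ 2 * step2 (a * t + c)) (2 * (1 + `|a|) ^+ 3)).
- exact: m.
- by apply: measurable_funM => //; exact: m.
- by apply: measurable_funM => //; exact: m.
- by move=> t; have /andP[s0 s1] := step_itv (a * t + c); rewrite ger0_norm //; lra.
- by move=> t; rewrite normrM mulrC ler_pM // step1_itv.
- by move=> t; rewrite normrM normrX mulrC ler_pM // ?step2_itv // exprn_ge0.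
move=> t s; have := step_taylor (a * t + c) (a * s).
rewrite [a * t + c + a * s](_ : _ = a * (t + s) + c); last by ring.
rewrite [X in `|_ - X - _|](_ : _ = a * step1 (a * t + c) * s); last by ring.
rewrite [X in `|_ - X|](_ : _ = 2^-1 * (a ^+ 2 * step2 (a * t + c) * s ^+ 2)); last by ring.
move=> h; apply: (le_trans h); rewrite normrM exprMn mulrA ler_wpM2r ?exprn_ge0 //.
by rewrite ler_wpM2l.
Qed.

Lemma smooth_bump (a c : R) (k : 'I_d) : smooth (fun x : V => bump (a * x k 0 + c)).
Proof.
have E : (fun x : V => bump (a * x k 0 + c)) =
    (fun x => step (a * x k 0 + c) + (-1) * step (a * x k 0 + (c - 1))).
  by apply/funext => x; rewrite /bump addrA mulN1r.
rewrite E; apply: smoothD; first exact: smooth_step.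
by apply: smoothM; [exact: smooth_cst|exact: smooth_step].
Qed.

Lemma compact_norm_le (r : R) : compact [set x : V | `|x| <= r].
Proof.
have -> : [set x : V | `|x| <= r] = trmx @` [set v : 'rV[R]_d | `|v| <= r].
  have tn m n (A : 'M[R]_(m, n)) : `|A^T| <= `|A|.
    by apply: mx_norm_le => // i j; rewrite mxE mx_entry_le.
  apply/seteqP; split=> [x xr|_ [v vr <-]]; last exact: le_trans (tn _ _ _) _.
  by exists x^T; [exact: le_trans (tn _ _ _) _|rewrite trmxK].
apply: continuous_compact.
  apply: continuous_subspaceT => v B /= /(nbhs_ballP (v^T)) [e e0 eB].
  apply/nbhs_ballP; exists e => //= w [_ vw]; apply: eB; split=> // i j.
  by rewrite !mxE; exact: vw.
apply: bounded_closed_compact.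
  by exists r; split; [exact: num_real|move=> M rM v vr; exact: le_trans vr (ltW rM)].
rewrite [X in closed X](_ : _ = (fun v : 'rV[R]_d => `|v|) @^-1` [set t | t <= r]) //.
apply: closed_comp; last exact: closed_le.
by move=> v _; exact: norm_continuous.
Qed.

Lemma uniform_continuity_near (g : V -> R) (r e : R) : continuous g -> 0 < e ->
  exists2 del, 0 < del &
    forall y x, `|y| <= r -> `|x - y| <= del -> `|g x - g y| <= e.
Proof.
move=> cg e0.
have /compact_near_coveringP := @compact_norm_le r.
move/(_ R (0^'+)%R (fun del y => forall x, `|x - y| <= del -> `|g x - g y| <= e)).
case=> [y yr|del /= del0 H].
  have := cg y; move/cvgrPdist_le => /(_ (e / 2)); rewrite divr_gt0 // => /(_ isT).
  move=> /nbhs_ballP[s /= s0 sg].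
  exists (ball y (s / 2), [set t | t < s / 2]).
    split; first by apply: nbhsx_ballx; rewrite divr_gt0.
    by apply: nbhs_right_lt; rewrite divr_gt0.
  move=> [z t] [/= yz ts] x xz.
  have b1 : `|g y - g x| <= e / 2.
    apply: sg; rewrite -ball_normE /=; move: yz; rewrite -ball_normE /= => yz.
    rewrite -(subrK z y) -addrA (le_lt_trans (ler_normD _ _)) //.
    by move: xz; rewrite distrC => xz; lra.
  have b2 : `|g y - g z| <= e / 2.
    apply: sg; rewrite -ball_normE /=; move: yz; rewrite -ball_normE /= => yz; lra.
  rewrite -(subrK (g y) (g x)) -addrA (le_trans (ler_normD _ _)) // distrC; lra.
exists (del / 2); first by rewrite divr_gt0.
move=> y x yr xy; apply: (H (del / 2)) => //=; last by rewrite divr_gt0.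
by rewrite sub0r normrN gtr0_norm ?divr_gt0 //; lra.
Qed.

Lemma smooth_approx (g : V -> R) (K eta L : R) : continuous g ->
  (forall x, `|g x| <= K) -> 0 < eta -> 0 <= L ->
  exists h chi, [/\ smooth h, smooth chi, (forall x, 0 <= chi x <= 1),
    (forall x, `|x| <= L -> chi x = 1) &
    (forall x, `|g x - h x| <= eta + K * (1 - chi x))].
Proof.
move=> cg gK eta0 L0.
have [del del0 gdel] := uniform_continuity_near (L + 3) cg eta0.
pose eps := Num.min 1 (del / 4).
have e0 : 0 < eps by rewrite lt_min ltr01 divr_gt0.
have e1 : eps <= 1 by rewrite ge_min lexx.
have e4 : 4 * eps <= del by rewrite mulrC -ler_pdivlMr // ge_min lexx orbT.
pose A := L + 3 * eps.
have LA0 : 0 <= (L + A) / eps by rewrite divr_ge0 ?(ltW e0) // /A; lra.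
pose m := (Num.truncn ((L + A) / eps)).+1.
have /andP[m1 m2] := truncn_itv LA0.
pose F (x : V) (k : 'I_d) (j : 'I_m) : R :=
  bump (eps^-1 * x k 0 + (eps^-1 * A - j%:R)).
pose pt (j : {ffun 'I_d -> 'I_m}) : V := \col_k (eps * (j k)%:R - A).
pose Bj (j : {ffun 'I_d -> 'I_m}) x := \prod_k F x k (j k).
have ptL j : `|pt j| <= L + 3.
  apply: mx_norm_le => [|k i]; first by lra.
  rewrite mxE; have jk : (j k)%:R <= (L + A) / eps.
    by apply: le_trans m1; rewrite ler_nat -ltnS.
  rewrite ler_pdivlMr // in jk.
  have j0 : 0 <= eps * (j k)%:R by rewrite mulr_ge0 // ltW.
  by rewrite ler_norml; apply/andP; rewrite /A in jk *; split; lra.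
have chiE x : \sum_j Bj j x = \prod_k (step (eps^-1 * (x k 0 + A)) -
    step (eps^-1 * (x k 0 + A) - m%:R)).
  rewrite /Bj -bigA_distr_bigA; apply: eq_bigr => k _.
  by rewrite -sum_bump; apply: eq_bigr => j _; rewrite /F addrA -mulrDr.
have F0 x k j : 0 <= F x k j by exact: bump_ge0.
have Bj0 j x : 0 <= Bj j x by apply: prodr_ge0.
have chi01 x : 0 <= \sum_j Bj j x <= 1.
  apply/andP; split; first by apply: sumr_ge0.
  rewrite chiE; apply: prodr_ile1 => k _.
  rewrite -sum_bump sumr_ge0 => [|j _]; last exact: bump_ge0.
  rewrite sum_bump; have /andP[_ a] := step_itv (eps^-1 * (x k 0 + A)).
  by have /andP[b _] := step_itv (eps^-1 * (x k 0 + A) - m%:R); lra.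
exists (fun x => \sum_j g (pt j) * Bj j x), (fun x => \sum_j Bj j x).
have sB j : smooth (Bj j).
  by apply: smooth_prod => k; exact: smooth_bump.
split=> [|||x xL|x] //.
- by apply: smooth_sum => j; apply: smoothM => //; exact: smooth_cst.
- exact: smooth_sum.
- rewrite chiE big1 // => k _.
  have := le_trans (mx_entry_le x k 0) xL; rewrite ler_norml => /andP[xl xr].
  rewrite step_ge3 ?step_le0 ?subr0 //.
    rewrite subr_le0 (le_trans _ (ltW m2)) // mulrC ler_wpM2r ?invr_ge0 ?(ltW e0) //.
    by rewrite lerD2r.
  by rewrite mulrC ler_pdivlMr // /A; lra.
have -> : g x - \sum_j g (pt j) * Bj j x =
    \sum_j (g x - g (pt j)) * Bj j x + g x * (1 - \sum_j Bj j x).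
  under [in RHS]eq_bigr do rewrite mulrBl.
  by rewrite sumrB -mulr_sumr; ring.
have /andP[c0 c1] := chi01 x.
rewrite (le_trans (ler_normD _ _)) // lerD //; last first.
  by rewrite normrM [`|1 - _|]ger0_norm ?ler_wpM2r //; lra.
rewrite (le_trans (ler_norm_sum _ _ _)) // (le_trans (y := \sum_j eta * Bj j x)) //.
  apply: ler_sum => j _; rewrite normrM [`|Bj j x|]ger0_norm //.
  have [->|Bn] := eqVneq (Bj j x) 0; first by rewrite !mulr0.
  rewrite ler_wpM2r // gdel //; apply: mx_norm_le => [|k i]; first exact: ltW.
  have : F x k (j k) != 0 by move/prodf_neq0: Bn => /(_ k isT).
  move=> /bump_support /andP[]; rewrite addrA -mulrDr ord1 !mxE.
  rewrite subr_gt0 ltrBlDr mulrC ltr_pdivlMr // ltr_pdivrMr // => f1 f2.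
  by rewrite ler_norml; apply/andP; split; lra.
by rewrite -mulr_sumr; rewrite ler_piMr // ltW.
Qed.

End smooth_approximation.

Section gaussian_smoothing.
Context {R : realType} (d : nat) {dT : measure_display} {T : measurableType dT}.
Variables (Q : probability T R) (W : T -> 'cV[R]_d) (l : seq 'cV[R]_d).
Hypothesis spec : gaussian_spec l Q W.
Local Notation V := 'cV[R]_d.
Local Notation S i j := (\sum_(a <- l) a i 0 * a j 0).

Definition smoothing (c : R) (h : V -> R) (x : V) : R := \int[Q]_t h (x + c *: W t).

Lemma measurable_smoothing_arg (c : R) (h : V -> R) : measurable_fun [set: borel R d] h ->
  measurable_fun setT (fun z : borel R d * T => h ((z.1 : V) + c *: W z.2)).
Proof.
move=> mh; apply: measurable_borel_comp => // i.
under eq_fun do rewrite !mxE.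
apply: measurable_funD.
  apply: (measurableT_comp (f := fun x : borel R d => (x : V) i 0) (g := fst)) => //.
  by apply: continuous_borel_measurable; exact: coord_continuous.
by apply: measurable_funM => //; apply: (measurableT_comp (gs_meas spec i)).
Qed.

Lemma measurable_smoothing_slice (c : R) (h : V -> R) x : measurable_fun [set: borel R d] h ->
  measurable_fun setT (fun t => h (x + c *: W t)).
Proof.
move=> mh; apply: (measurableT_comp (measurable_smoothing_arg c mh)
  (g := fun t => (x : borel R d, t))).
exact: pair1_measurable.
Qed.

Lemma Rintegrable_smoothing (c : R) (h : V -> R) K x : measurable_fun [set: borel R d] h ->
  (forall x, `|h x| <= K) -> Rintegrable Q (fun t => h (x + c *: W t)).
Proof. by move=> mh hK; apply: Rintegrable_bounded => //; exact: measurable_smoothing_slice. Qed.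

Lemma measurable_smoothing (c : R) (h : V -> R) : measurable_fun [set: borel R d] h ->
  measurable_fun [set: borel R d] (smoothing c h).
Proof.
move=> mh; exact: (measurable_Rintegral Q (measurable_smoothing_arg c mh)).
Qed.

Lemma smoothing_le (c : R) (h : V -> R) K x : measurable_fun [set: borel R d] h ->
  (forall x, `|h x| <= K) -> `|smoothing c h x| <= K.
Proof. by move=> mh hK; apply: Rintegral_norm_bounded => //; exact: measurable_smoothing_slice. Qed.

Lemma smoothing0 (h : V -> R) x : smoothing 0 h x = h x.
Proof.
rewrite /smoothing; under eq_Rintegral do rewrite scale0r addr0.
exact: Rintegral_cstT.
Qed.

Section jet_smoothing.
Variables (h : V -> R) (G1 : 'I_d -> V -> R) (G2 : 'I_d -> 'I_d -> V -> R) (C : R).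
Hypothesis J : jet h G1 G2 C.

Lemma taylor2_smoothing c x u :
  taylor2 (smoothing c h) (fun i => smoothing c (G1 i)) (fun i j => smoothing c (G2 i j)) x u
  = \int[Q]_t taylor2 h G1 G2 (x + c *: W t) u.
Proof.
have Ih y : Rintegrable Q (fun t => h (y + c *: W t)).
  exact: Rintegrable_smoothing (jet_meas0 J) (jet_le0 J).
have I1 i : Rintegrable Q (fun t => G1 i (x + c *: W t)).
  exact: Rintegrable_smoothing (jet_meas1 J i) (jet_le1 J i).
have I2 i j : Rintegrable Q (fun t => G2 i j (x + c *: W t)).
  exact: Rintegrable_smoothing (jet_meas2 J i j) (jet_le2 J i j).
have Zr (F : T -> R) k : Rintegrable Q F -> Rintegrable Q (fun t => F t * k).
  by move=> FI; apply: (eq_Rintegrable _ (RintegrableZ k FI)) => t; rewrite mulrC.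
have Zi (F : T -> R) k : Rintegrable Q F -> \int[Q]_t (F t * k) = \int[Q]_t F t * k.
  by move=> FI; under eq_Rintegral do rewrite mulrC; rewrite RintegralZ // mulrC.
have L1 : Rintegrable Q (fun t => linform G1 (x + c *: W t) u).
  by apply: Rintegrable_sum => i _; exact: Zr.
have L2i i : Rintegrable Q (fun t => \sum_j G2 i j (x + c *: W t) * (u i 0 * u j 0)).
  by apply: Rintegrable_sum => j _; exact: Zr.
have L2 : Rintegrable Q (fun t => quadform G2 (x + c *: W t) u).
  by apply: Rintegrable_sum => i _.
have hu : (fun t => h (x + c *: W t + u)) = (fun t => h (x + u + c *: W t)).
  by apply/funext => t; rewrite addrAC.
have Ihu : Rintegrable Q (fun t => h (x + c *: W t + u)) by rewrite hu.
have Ia := RintegrableB Ihu (Ih x); have Ib := RintegrableB Ia L1.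
rewrite /taylor2 RintegralB //; last exact: RintegrableZ.
rewrite RintegralB // RintegralB //; last exact: Ih.
have E1 : \int[Q]_t linform G1 (x + c *: W t) u =
    linform (fun i => smoothing c (G1 i)) x u.
  rewrite Rintegral_sum => [|i _]; last exact: Zr.
  by apply: eq_bigr => i _; rewrite Zi.
have E2 : \int[Q]_t quadform G2 (x + c *: W t) u =
    quadform (fun i j => smoothing c (G2 i j)) x u.
  rewrite Rintegral_sum //; apply: eq_bigr => i _.
  rewrite Rintegral_sum => [|j _]; last exact: Zr.
  by apply: eq_bigr => j _; rewrite Zi.
have E3 := RintegralZ 2^-1 L2.
by rewrite -E1 -E2 -E3 hu.
Qed.

Lemma measurable_taylor2 dS (E : measurableType dS) (y u : E -> V) :
  (forall i, measurable_fun setT (fun t => y t i 0)) ->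
  (forall i, measurable_fun setT (fun t => u t i 0)) ->
  measurable_fun setT (fun t => taylor2 h G1 G2 (y t) (u t)).
Proof.
move=> my mu; apply: measurable_funB.
  apply: measurable_funB.
    apply: measurable_funB.
      apply: measurable_borel_comp; first exact: jet_meas0 J.
      by move=> i; under eq_fun do rewrite mxE; exact: measurable_funD.
    by apply: measurable_borel_comp => //; exact: jet_meas0 J.
  apply: measurable_sum => i; apply: measurable_funM => //.
  by apply: measurable_borel_comp => //; exact: jet_meas1 J _.
apply: measurable_funM => //; apply: measurable_sum => i; apply: measurable_sum => j.
apply: measurable_funM; last exact: measurable_funM.
by apply: measurable_borel_comp => //; exact: jet_meas2 J _ _.
Qed.

Lemma jet_smoothing c :
  jet (smoothing c h) (fun i => smoothing c (G1 i)) (fun i j => smoothing c (G2 i j)) C.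
Proof.
split=> [|i|i j|x|i x|i j x|x u].
- exact: measurable_smoothing (jet_meas0 J).
- exact: measurable_smoothing (jet_meas1 J i).
- exact: measurable_smoothing (jet_meas2 J i j).
- exact: smoothing_le (jet_meas0 J) (jet_le0 J).
- exact: smoothing_le (jet_meas1 J i) (jet_le1 J i).
- exact: smoothing_le (jet_meas2 J i j) (jet_le2 J i j).
rewrite taylor2_smoothing; apply: Rintegral_norm_bounded => [|t]; last exact: jet_taylor J _ _.
apply: measurable_taylor2 => i; last exact: measurable_cst.
under eq_fun do rewrite !mxE; apply: measurable_funD => //.
by apply: measurable_funM => //; exact: gs_meas spec i.
Qed.

Lemma smoothing_comp a b x : 0 <= a -> 0 <= b ->
  smoothing a (smoothing b h) x = smoothing (Num.sqrt (a ^+ 2 + b ^+ 2)) h x.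
Proof.
move=> a0 b0.
have mh := jet_meas0 J; have hC := jet_le0 J.
pose g (y : V) : \bar R := (h (x + y) + C)%:E.
have g0 y : (0 <= g y)%E.
  by rewrite lee_fin; have := hC (x + y); rewrite ler_norml => /andP[]; lra.
have mg : measurable_fun [set: borel R d] g.
  apply/measurable_EFinP; apply: measurable_funD => //.
  apply: (@measurable_borel_comp _ _ _ (borel R d)) => // i; under eq_fun do rewrite mxE.
  apply: measurable_funD => //.
  by apply: continuous_borel_measurable; exact: coord_continuous.
have IC y c : Rintegrable Q (fun t => h (y + c *: W t)) by exact: Rintegrable_smoothing mh hC.
have cI (k : R) : Rintegrable Q (fun=> k) by exact: finite_measure_integrable_cst.
have intE y c : (\int[Q]_t (h (y + c *: W t) + C)%:E = (smoothing c h y + C)%:E)%E.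
  rewrite (RintegralE (RintegrableD (IC _ _) (cI C))) RintegralD //;
    [|exact: IC|exact: cI].
  by rewrite (Rintegral_cstT Q C).
have l1 s : (\int[Q]_t g (a *: W s + b *: W t)%R = (smoothing b h (x + a *: W s) + C)%:E)%E.
  by rewrite -intE; apply: eq_integral => t _; rewrite /g addrA.
have := gs_stable spec a0 b0 mg g0.
under eq_integral do rewrite l1.
have -> := intE x (Num.sqrt (a ^+ 2 + b ^+ 2)).
have Jb := jet_smoothing b.
have Ib : Rintegrable Q (fun s => smoothing b h (x + a *: W s)).
  exact: Rintegrable_smoothing (jet_meas0 Jb) (jet_le0 Jb).
rewrite (RintegralE (RintegrableD Ib (cI C))) RintegralD //; last exact: cI.
rewrite (Rintegral_cstT Q C).
by move=> [] /addIr.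
Qed.

Definition gauss_rest (C K c : R) : R := \int[Q]_t Num.min (C * c * `|W t| ^+ 3) (K * `|W t| ^+ 2).

Lemma measurable_normW : measurable_fun setT (fun t => `|W t|).
Proof.
apply: (measurable_borel_comp (g := fun x : V => `|x|)); last exact: gs_meas spec.
by apply: continuous_borel_measurable; exact: norm_continuous.
Qed.

Lemma sqr_norm_le (x : V) : `|x| ^+ 2 <= \sum_i x i 0 ^+ 2.
Proof.
by rewrite -sqr_frob lerXn2r ?nnegrE ?frob_ge0 // norm_le_frob.
Qed.

Lemma Rintegrable_sqr_normW : Rintegrable Q (fun t => `|W t| ^+ 2).
Proof.
apply: (Rintegrable_le (g := fun t => \sum_i W t i 0 ^+ 2)).
- by apply: measurable_funX; exact: measurable_normW.
- by move=> t; rewrite ger0_norm ?sqr_ge0 // sqr_norm_le.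
by apply: Rintegrable_sum => i _; exact: gs_sqr spec i.
Qed.

Lemma Rintegrable_gauss_rest B K c : 0 <= B -> 0 <= K -> 0 <= c ->
  Rintegrable Q (fun t => Num.min (B * c * `|W t| ^+ 3) (K * `|W t| ^+ 2)).
Proof.
move=> B0 K0 c0; apply: (Rintegrable_le _ _ (RintegrableZ K Rintegrable_sqr_normW)).
  apply: measurable_minr; apply: measurable_funM => //; apply: measurable_funX;
  exact: measurable_normW.
move=> t; rewrite ger0_norm; first by rewrite ge_min lexx orbT.
by rewrite le_min !mulr_ge0 // exprn_ge0.
Qed.

Lemma smoothing_taylor c x : 0 <= c ->
  `|smoothing c h x - h x - 2^-1 * (c ^+ 2 * \sum_i \sum_j G2 i j x * S i j)| <=
  c ^+ 2 * gauss_rest C (jet_const d C) c.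
Proof.
move=> c0; have C0 := jet_C0 J.
have K0 : 0 <= jet_const d C by rewrite !mulr_ge0 // exprn_ge0 // addr_ge0.
have Ih : Rintegrable Q (fun t => h (x + c *: W t)).
  exact: Rintegrable_smoothing (jet_meas0 J) (jet_le0 J).
have IW i : Rintegrable Q (fun t => W t i 0).
  exact: Rintegrable_sqrW (gs_meas spec i) (gs_sqr spec i).
have IWW i j : Rintegrable Q (fun t => W t i 0 * W t j 0).
  exact: Rintegrable_mul (gs_meas spec i) (gs_meas spec j) (gs_sqr spec i) (gs_sqr spec j).
have cI (k : R) : Rintegrable Q (fun=> k) by exact: finite_measure_integrable_cst.
have linE t : linform G1 x (c *: W t) = \sum_i G1 i x * c * W t i 0.
  by apply: eq_bigr => i _; rewrite mxE mulrA.
have quadE t : quadform G2 x (c *: W t) =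
    \sum_i \sum_j G2 i j x * c ^+ 2 * (W t i 0 * W t j 0).
  by apply: eq_bigr => i _; apply: eq_bigr => j _; rewrite !mxE; ring.
have I1 : Rintegrable Q (fun t => linform G1 x (c *: W t)).
  apply: (eq_Rintegrable (fun t => esym (linE t))).
  by apply: Rintegrable_sum => i _; exact: RintegrableZ.
have I2i i : Rintegrable Q (fun t => \sum_j G2 i j x * c ^+ 2 * (W t i 0 * W t j 0)).
  by apply: Rintegrable_sum => j _; exact: RintegrableZ.
have I2 : Rintegrable Q (fun t => quadform G2 x (c *: W t)).
  apply: (eq_Rintegrable (fun t => esym (quadE t))).
  by apply: Rintegrable_sum => i _.
have E1 : \int[Q]_t linform G1 x (c *: W t) = 0.
  under eq_Rintegral do rewrite linE.
  rewrite Rintegral_sum => [|i _]; last exact: RintegrableZ.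
  by rewrite big1 // => i _; rewrite RintegralZ // (gs_mean spec) mulr0.
have E2 : \int[Q]_t quadform G2 x (c *: W t) = c ^+ 2 * \sum_i \sum_j G2 i j x * S i j.
  under eq_Rintegral do rewrite quadE.
  rewrite Rintegral_sum // mulr_sumr; apply: eq_bigr => i _.
  rewrite Rintegral_sum => [|j _]; last exact: RintegrableZ.
  rewrite mulr_sumr; apply: eq_bigr => j _.
  by rewrite RintegralZ // (gs_cov spec); ring.
have mt : measurable_fun setT (fun t => taylor2 h G1 G2 x (c *: W t)).
  apply: measurable_taylor2 => i; first exact: measurable_cst.
  by under eq_fun do rewrite mxE; apply: measurable_funM => //; exact: gs_meas spec i.
have -> : smoothing c h x - h x - 2^-1 * (c ^+ 2 * \sum_i \sum_j G2 i j x * S i j) =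
    \int[Q]_t taylor2 h G1 G2 x (c *: W t).
  have Ia := RintegrableB Ih (cI (h x)); have Ib := RintegrableB Ia I1.
  rewrite /taylor2 RintegralB //; last exact: RintegrableZ.
  have E3 := RintegralZ 2^-1 I2.
  rewrite RintegralB // RintegralB //; last exact: cI.
  by rewrite -E2 -E3 [X in _ = _ - X - _]E1 [X in _ = _ - X - _ - _](Rintegral_cstT Q (h x)) subr0.
have Ir := Rintegrable_gauss_rest C0 K0 c0.
have Er := RintegralZ (c ^+ 2) Ir.
rewrite /gauss_rest -Er.
have tle t : `|taylor2 h G1 G2 x (c *: W t)| <=
    c ^+ 2 * Num.min (C * c * `|W t| ^+ 3) (jet_const d C * `|W t| ^+ 2).
  rewrite minr_pMr ?sqr_ge0 // le_min; apply/andP; split.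
    apply: (le_trans (jet_taylor J _ _)); rewrite normrZ ger0_norm // le_eqVlt.
    by apply/orP; left; apply/eqP; ring.
  apply: (le_trans (jet_taylor_sqr J _ _)); rewrite normrZ ger0_norm // le_eqVlt.
  by apply/orP; left; apply/eqP; ring.
have It : Rintegrable Q (fun t => taylor2 h G1 G2 x (c *: W t)).
  exact: (Rintegrable_le mt tle (RintegrableZ (c ^+ 2) Ir)).
rewrite (le_trans (le_normr_Rintegral _ _)) //.
apply: Rintegral_mono => //; [exact: Rintegrable_norm|exact: RintegrableZ].
Qed.

End jet_smoothing.
End gaussian_smoothing.

Lemma Rintegral_add {R : realType} {d} {T : measurableType d} (m : probability T R)
    (f g : T -> R) : Rintegrable m f -> Rintegrable m g ->
  \int[m]_x (f x + g x) = \int[m]_x f x + \int[m]_x g x.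
Proof. by move=> fi gi; rewrite RintegralD. Qed.

Section truncated_square.
Context {R : realType}.

Definition tail_sqr (e r : R) : R := if e < r then r ^+ 2 else 0.

Lemma tail_sqr_ge0 e r : 0 <= tail_sqr e r.
Proof. by rewrite /tail_sqr; case: ifP => // _; exact: sqr_ge0. Qed.

Lemma tail_sqr_le e r : tail_sqr e r <= r ^+ 2.
Proof. by rewrite /tail_sqr; case: ifP => // _; exact: sqr_ge0. Qed.

Lemma measurable_tail_sqr e : measurable_fun setT (tail_sqr e).
Proof.
have -> : tail_sqr e = (fun r => \1_(`]e, +oo[%classic) r * r ^+ 2).
  apply/funext => r; rewrite /tail_sqr indicE mem_setE in_itv /= andbT.
  by case: ifP; rewrite ?mul1r ?mul0r.
by apply: measurable_funM => //; apply: measurable_indic.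
Qed.

End truncated_square.

Section one_step.
Context {R : realType} (d : nat) {dZ : measure_display} {Z : measurableType dZ}.
Variables (nu : probability Z R) (p : Z -> R) (u : Z -> 'cV[R]_d) (S : 'M[R]_d)
  (c eta eps : R).
Local Notation V := 'cV[R]_d.
Hypotheses (mp : measurable_fun setT p) (p01 : forall t, 0 <= p t <= 1)
  (mu_ : forall i, measurable_fun setT (fun t => u t i 0))
  (c0 : 0 <= c) (eta0 : 0 <= eta) (eps0 : 0 <= eps).
Hypotheses (Iu : forall i, Rintegrable nu (fun t => p t * u t i 0))
  (u0 : forall i, \int[nu]_t (p t * u t i 0) = 0)
  (Iuu : forall i j, Rintegrable nu (fun t => p t * (u t i 0 * u t j 0)))
  (uuS : forall i j, `|\int[nu]_t (p t * (u t i 0 * u t j 0)) - c * S i j| <= c * eta)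
  (utail : \int[nu]_t (p t * tail_sqr eps `|u t|) <= c * eta).
Variables (h : V -> R) (G1 : 'I_d -> V -> R) (G2 : 'I_d -> 'I_d -> V -> R) (C : R).
Hypothesis J : jet h G1 G2 C.
Local Notation K := (jet_const d C).

Definition step_error : R :=
  2^-1 * (d%:R ^+ 2 * (C * eta)) + (C * eps * \sum_i (S i i + eta) + K * eta).

Lemma one_step_taylor x :
  `|\int[nu]_t (p t * h (x + u t) + (1 - p t) * h x) - h x -
     2^-1 * (c * \sum_i \sum_j G2 i j x * S i j)| <= c * step_error.
Proof.
have C0 := jet_C0 J.
have K0 : 0 <= K by rewrite !mulr_ge0 // exprn_ge0 // addr_ge0.
have mnu : measurable_fun setT (fun t => `|u t|).
  apply: (measurable_borel_comp (g := fun x : V => `|x|)) => //.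
  by apply: continuous_borel_measurable; exact: norm_continuous.
have mt : measurable_fun setT (fun t => taylor2 h G1 G2 x (u t)).
  by apply: (measurable_taylor2 J) => // i; exact: measurable_cst.
have p0 t : 0 <= p t by have /andP[] := p01 t.
have Ii i : Rintegrable nu (fun t => G1 i x * (p t * u t i 0)) by exact: RintegrableZ.
have Iij i j : Rintegrable nu (fun t => G2 i j x * (p t * (u t i 0 * u t j 0))).
  exact: RintegrableZ.
have IL : Rintegrable nu (fun t => \sum_i G1 i x * (p t * u t i 0)).
  by apply: Rintegrable_sum => i _.
have IQi i : Rintegrable nu (fun t => \sum_j G2 i j x * (p t * (u t i 0 * u t j 0))).
  by apply: Rintegrable_sum => j _.
have IQ : Rintegrable nu (fun t => \sum_i \sum_j G2 i j x * (p t * (u t i 0 * u t j 0))).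
  by apply: Rintegrable_sum => i _.
have Isq : Rintegrable nu (fun t => \sum_i p t * (u t i 0 * u t i 0)).
  by apply: Rintegrable_sum => i _.
have sqE t : p t * `|u t| ^+ 2 <= \sum_i p t * (u t i 0 * u t i 0).
  rewrite -mulr_sumr ler_wpM2l //; apply: (le_trans (sqr_norm_le _)).
  by apply: ler_sum => i _; rewrite expr2.
have mtl : measurable_fun setT (fun t => p t * tail_sqr eps `|u t|).
  apply: measurable_funM => //; exact: (measurableT_comp (measurable_tail_sqr eps) mnu).
have Itl : Rintegrable nu (fun t => p t * tail_sqr eps `|u t|).
  apply: (Rintegrable_le mtl _ Isq) => t.
  rewrite ger0_norm ?mulr_ge0 ?tail_sqr_ge0 // (le_trans _ (sqE t)) //.
  by rewrite ler_wpM2l // tail_sqr_le.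
have tle t : `|p t * taylor2 h G1 G2 x (u t)| <=
    C * eps * (\sum_i p t * (u t i 0 * u t i 0)) + K * (p t * tail_sqr eps `|u t|).
  rewrite normrM ger0_norm //.
  rewrite (le_trans (y := C * eps * (p t * `|u t| ^+ 2) + K * (p t * tail_sqr eps `|u t|))) //;
    last by rewrite lerD2r ler_wpM2l // mulr_ge0.
  have u2 : 0 <= `|u t| ^+ 2 by exact: sqr_ge0.
  rewrite /tail_sqr; case: ltP => [eu|ue].
    apply: (le_trans (ler_wpM2l (p0 t) (jet_taylor_sqr J x (u t)))).
    rewrite mulrCA lerDr; apply: mulr_ge0; first exact: mulr_ge0.
    exact: mulr_ge0.
  rewrite !mulr0 addr0 mulrCA ler_wpM2l // (le_trans (jet_taylor J x (u t))) //.
  rewrite exprS -!mulrA ler_wpM2l // ler_wpM2r //.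
have Idom : Rintegrable nu (fun t => C * eps * (\sum_i p t * (u t i 0 * u t i 0)) +
    K * (p t * tail_sqr eps `|u t|)).
  by apply: RintegrableD; exact: RintegrableZ.
have It : Rintegrable nu (fun t => p t * taylor2 h G1 G2 x (u t)).
  by apply: (Rintegrable_le _ tle Idom); exact: measurable_funM.
have cI (k : R) : Rintegrable nu (fun=> k) by exact: finite_measure_integrable_cst.
have IQh := RintegrableZ 2^-1 IQ.
have E t : p t * h (x + u t) + (1 - p t) * h x =
    h x + ((\sum_i G1 i x * (p t * u t i 0)) +
      (2^-1 * (\sum_i \sum_j G2 i j x * (p t * (u t i 0 * u t j 0))) +
       p t * taylor2 h G1 G2 x (u t))).
  have -> : \sum_i G1 i x * (p t * u t i 0) = p t * linform G1 x (u t).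
    by rewrite mulr_sumr; apply: eq_bigr => i _; ring.
  have -> : \sum_i \sum_j G2 i j x * (p t * (u t i 0 * u t j 0)) =
      p t * quadform G2 x (u t).
    rewrite mulr_sumr; apply: eq_bigr => i _; rewrite mulr_sumr.
    by apply: eq_bigr => j _; ring.
  by rewrite /taylor2; ring.
pose m i j := \int[nu]_t (p t * (u t i 0 * u t j 0)).
have IE : \int[nu]_t (p t * h (x + u t) + (1 - p t) * h x) =
    h x + 2^-1 * (\sum_i \sum_j G2 i j x * m i j) +
    \int[nu]_t (p t * taylor2 h G1 G2 x (u t)).
  under eq_Rintegral do rewrite E.
  have I2 := RintegrableD IQh It; have I3 := RintegrableD IL I2.
  have -> := Rintegral_add (cI (h x)) I3; have -> := Rintegral_add IL I2.
  have -> := Rintegral_add IQh It.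
  rewrite [X in X + _ = _](Rintegral_cstT nu (h x)) -addrA; congr (_ + _).
  rewrite [X in X + _ = _](_ : _ = 0); last first.
    rewrite Rintegral_sum // big1 // => i _.
    have -> := RintegralZ (G1 i x) (Iu i).
    by rewrite u0 mulr0.
  rewrite add0r; congr (_ + _).
  have -> := RintegralZ 2^-1 IQ; congr (_ * _).
  rewrite Rintegral_sum //; apply: eq_bigr => i _.
  rewrite Rintegral_sum //; apply: eq_bigr => j _.
  exact: (RintegralZ (G2 i j x) (Iuu i j)).
have mS i j : `|m i j - c * S i j| <= c * eta by exact: uuS.
have q : `|\sum_i \sum_j G2 i j x * (m i j - c * S i j)| <= d%:R ^+ 2 * (C * (c * eta)).
  rewrite (le_trans (ler_norm_sum _ _ _)) //.
  rewrite (le_trans (y := \sum_(i < d) \sum_(j < d) C * (c * eta))) //.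
    apply: ler_sum => i _; rewrite (le_trans (ler_norm_sum _ _ _)) //.
    by apply: ler_sum => j _; rewrite normrM ler_pM // (jet_le2 J).
  rewrite sumr_const card_ord sumr_const card_ord.
  by rewrite le_eqVlt; apply/orP; left; apply/eqP; rewrite expr2 -!mulrA !mulr_natl.
have rest : `|\int[nu]_t (p t * taylor2 h G1 G2 x (u t))| <=
    c * (C * eps * \sum_i (S i i + eta) + K * eta).
  rewrite (le_trans (le_normr_Rintegral _ It)) //.
  rewrite (le_trans (Rintegral_mono (Rintegrable_norm It) Idom tle)) //.
  have -> := Rintegral_add (RintegrableZ (C * eps) Isq) (RintegrableZ K Itl).
  have -> := RintegralZ (C * eps) Isq; have -> := RintegralZ K Itl.
  rewrite mulrDr lerD //; last by rewrite mulrCA ler_wpM2l.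
  rewrite mulrCA ler_wpM2l ?mulr_ge0 // Rintegral_sum // mulr_sumr.
  apply: ler_sum => i _; have := mS i i; rewrite ler_norml => /andP[_].
  by rewrite /m; lra.
rewrite IE /step_error.
have -> : h x + 2^-1 * (\sum_i \sum_j G2 i j x * m i j) +
    \int[nu]_t (p t * taylor2 h G1 G2 x (u t)) - h x -
    2^-1 * (c * \sum_i \sum_j G2 i j x * S i j) =
    2^-1 * (\sum_i \sum_j G2 i j x * (m i j - c * S i j)) +
    \int[nu]_t (p t * taylor2 h G1 G2 x (u t)).
  have -> : \sum_i \sum_j G2 i j x * (m i j - c * S i j) =
    \sum_i \sum_j G2 i j x * m i j - c * \sum_i \sum_j G2 i j x * S i j.
    rewrite mulr_sumr -sumrB; apply: eq_bigr => i _.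
    by rewrite mulr_sumr -sumrB; apply: eq_bigr => j _; ring.
  ring.
rewrite (le_trans (ler_normD _ _)) // mulrDr lerD // normrM ger0_norm //.
rewrite mulrCA ler_wpM2l // (le_trans q) // le_eqVlt.
by apply/orP; left; apply/eqP; ring.
Qed.

End one_step.

Section lindeberg.
Context {R : realType} (d : nat) {dO dE dZ dT : measure_display}
  {Om : measurableType dO} {E : measurableType dE} {Z : measurableType dZ}
  {T : measurableType dT}.
Local Notation V := 'cV[R]_d.
Variables (P : probability Om R) (nu : probability Z R) (Q : probability T R)
  (W : T -> V) (l : seq V) (S : 'M[R]_d).
Hypotheses (spec : gaussian_spec l Q W)
  (SE : forall i j, S i j = \sum_(a <- l) a i 0 * a j 0).
Variables (pil : Om -> E) (s : nat -> Om -> V) (p : E * Z -> R) (u : E * Z -> V)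
  (N : nat) (A : set E) (eta eps : R).
Hypotheses (N0 : (0 < N)%N) (mpil : measurable_fun setT pil)
  (ms : forall k i, measurable_fun setT (fun w => s k w i 0)) (s0 : forall w, s 0 w = 0)
  (mp : measurable_fun setT p) (p01 : forall t, 0 <= p t <= 1)
  (mu_ : forall i, measurable_fun setT (fun t => u t i 0))
  (mA : measurable A) (eta0 : 0 <= eta) (eps0 : 0 <= eps).
Hypothesis s_step : forall k (h : V -> R) K, (k < N)%N ->
  measurable_fun [set: borel R d] h -> (forall x, `|h x| <= K) ->
  \int[P]_w (\1_A (pil w) * h (s k.+1 w)) =
  \int[P]_w (\1_A (pil w) * \int[nu]_t (p (pil w, t) * h (s k w + u (pil w, t)) +
     (1 - p (pil w, t)) * h (s k w))).
Local Notation c := (N%:R^-1 : R).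
Hypotheses
  (Iu : forall v i, A v -> Rintegrable nu (fun t => p (v, t) * u (v, t) i 0))
  (u0 : forall v i, A v -> \int[nu]_t (p (v, t) * u (v, t) i 0) = 0)
  (Iuu : forall v i j, A v ->
     Rintegrable nu (fun t => p (v, t) * (u (v, t) i 0 * u (v, t) j 0)))
  (uuS : forall v i j, A v ->
     `|\int[nu]_t (p (v, t) * (u (v, t) i 0 * u (v, t) j 0)) - c * S i j| <= c * eta)
  (utail : forall v, A v -> \int[nu]_t (p (v, t) * tail_sqr eps `|u (v, t)|) <= c * eta).
Variables (h : V -> R) (G1 : 'I_d -> V -> R) (G2 : 'I_d -> 'I_d -> V -> R) (C : R).
Hypothesis J : jet h G1 G2 C.
Local Notation K := (jet_const d C).
Local Notation bound := (step_error S eta eps C + gauss_rest Q W C K (Num.sqrt c)).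

Let c0 : 0 <= c. Proof. by rewrite invr_ge0. Qed.
Let lev k : R := Num.sqrt ((N - k)%:R * c).
Let hk k := smoothing Q W (lev k) h.
Let Jk k := jet_smoothing spec J (lev k).

Let hkS k x : (k < N)%N -> hk k x = smoothing Q W (Num.sqrt c) (hk k.+1) x.
Proof.
move=> kN; have levE : lev k = Num.sqrt (Num.sqrt c ^+ 2 + lev k.+1 ^+ 2).
  rewrite /lev [X in X + _]sqr_sqrtr // sqr_sqrtr; last exact: mulr_ge0.
  rewrite -[X in X + _]mul1r -mulrDl (_ : (N - k)%:R = 1 + (N - k.+1)%:R :> R) //.
  by rewrite -(natrD R 1 (N - k.+1)); congr (_%:R); lia.
rewrite /hk levE; symmetry.
exact: (smoothing_comp spec J x (sqrtr_ge0 c) (sqrtr_ge0 _)).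
Qed.

Let m1A : measurable_fun setT (fun w => \1_A (pil w) : R).
Proof. by apply: (measurableT_comp (f := (\1_A : E -> R))). Qed.

Let le1A (a : R) w K' : `|a| <= K' -> `|\1_A (pil w) * a| <= K'.
Proof.
move=> aK; rewrite normrM indicE; case: (_ \in _); rewrite ?normr1 ?mul1r //.
by rewrite normr0 mul0r (le_trans _ aK).
Qed.

Let bound0 : 0 <= bound.
Proof.
have C0 := jet_C0 J.
have K0 : 0 <= K by rewrite !mulr_ge0 // exprn_ge0 // addr_ge0.
have S0 : 0 <= \sum_i (S i i + eta).
  apply: sumr_ge0 => i _; rewrite addr_ge0 // SE; apply: sumr_ge0 => a _.
  by rewrite -expr2 sqr_ge0.
apply: addr_ge0; last first.
  by apply: Rintegral_ge0 => t _; rewrite le_min !mulr_ge0 ?sqrtr_ge0 ?exprn_ge0.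
by rewrite /step_error !addr_ge0 // !mulr_ge0 // exprn_ge0.
Qed.

Let step_diff k : (k < N)%N ->
  `|\int[P]_w (\1_A (pil w) * hk k.+1 (s k.+1 w)) - \int[P]_w (\1_A (pil w) * hk k (s k w))|
  <= c * bound.
Proof.
move=> kN; have J1 := Jk k.+1.
have mh := jet_meas0 J1; have hC := jet_le0 J1.
rewrite (s_step kN mh hC).
pose F w := \int[nu]_t (p (pil w, t) * hk k.+1 (s k w + u (pil w, t)) +
     (1 - p (pil w, t)) * hk k.+1 (s k w)).
have mpair : measurable_fun setT (fun t : Om * Z => (pil t.1, t.2)).
  by apply: measurable_fun_pair => //; exact: measurableT_comp.
have mpt : measurable_fun setT (fun t : Om * Z => p (pil t.1, t.2)).
  exact: (measurableT_comp mp mpair).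
have ms1 i : measurable_fun setT (fun t : Om * Z => s k t.1 i 0).
  exact: (measurableT_comp (ms k i)).
have mF : measurable_fun setT F.
  apply: (measurable_Rintegral nu (f := fun t : Om * Z =>
    p (pil t.1, t.2) * hk k.+1 (s k t.1 + u (pil t.1, t.2)) +
     (1 - p (pil t.1, t.2)) * hk k.+1 (s k t.1))).
  apply: measurable_funD; apply: measurable_funM => //.
  - apply: measurable_borel_comp => // i; under eq_fun do rewrite mxE.
    by apply: measurable_funD => //; exact: (measurableT_comp (mu_ i) mpair).
  - exact: measurable_funB.
  - exact: measurable_borel_comp.
have intb w t : `|p (pil w, t) * hk k.+1 (s k w + u (pil w, t)) +
     (1 - p (pil w, t)) * hk k.+1 (s k w)| <= C.
  have /andP[p0 p1] := p01 (pil w, t).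
  rewrite (le_trans (ler_normD _ _)) // !normrM (ger0_norm p0) (@ger0_norm _ (1 - _)) ?subr_ge0 //.
  have -> : C = p (pil w, t) * C + (1 - p (pil w, t)) * C by ring.
  by apply: lerD; apply: ler_wpM2l; rewrite ?subr_ge0 //; exact: hC.
have mFs w : measurable_fun setT (fun t => p (pil w, t) * hk k.+1 (s k w + u (pil w, t)) +
     (1 - p (pil w, t)) * hk k.+1 (s k w)).
  have mps : measurable_fun setT (fun t => p (pil w, t)).
    exact: (measurableT_comp mp (pair1_measurable _)).
  apply: measurable_funD; apply: measurable_funM => //; last exact: measurable_funB.
  apply: measurable_borel_comp => // i; under eq_fun do rewrite mxE.
  apply: measurable_funD => //.
  exact: (measurableT_comp (mu_ i) (pair1_measurable _)).
have FC w : `|F w| <= C by exact: Rintegral_norm_bounded.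
have mG : measurable_fun setT (fun w => hk k (s k w)).
  exact: (measurable_borel_comp (jet_meas0 (Jk k)) (ms k)).
have mF1 : measurable_fun setT (fun w => \1_A (pil w) * F w) by exact: measurable_funM.
have mG1 : measurable_fun setT (fun w => \1_A (pil w) * hk k (s k w)) by exact: measurable_funM.
have IF : Rintegrable P (fun w => \1_A (pil w) * F w).
  by apply: (Rintegrable_bounded _ (K := C)) => // w; exact: le1A.
have IG : Rintegrable P (fun w => \1_A (pil w) * hk k (s k w)).
  apply: (Rintegrable_bounded _ (K := C)) => // w; apply: le1A.
  exact: jet_le0 (Jk k) _.
have <- : \int[P]_w (\1_A (pil w) * F w - \1_A (pil w) * hk k (s k w)) =
   \int[P]_w (\1_A (pil w) * F w) - \int[P]_w (\1_A (pil w) * hk k (s k w)).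
  by rewrite RintegralB.
apply: Rintegral_norm_bounded; first exact: measurable_funB.
move=> w; rewrite -mulrBr indicE; case: (boolP (_ \in _)) => [|_]; last first.
  by rewrite mul0r normr0 mulr_ge0.
rewrite inE => Aw; rewrite mul1r (hkS _ kN).
have h1 := one_step_taylor (measurableT_comp mp (pair1_measurable (pil w)))
  (fun t => p01 _) (fun i => measurableT_comp (mu_ i) (pair1_measurable (pil w)))
  eps0 (fun i => Iu i Aw) (fun i => u0 i Aw) (fun i j => Iuu i j Aw)
  (fun i j => uuS i j Aw) (utail Aw) J1 (s k w).
have := smoothing_taylor spec J1 (s k w) (sqrtr_ge0 c).
rewrite sqr_sqrtr // => h2.
set g := hk k.+1 in h1 h2 *; set x := s k w in h1 h2 *.
have SEE : \sum_i \sum_j smoothing Q W (lev k.+1) (G2 i j) x * S i j =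
  \sum_i \sum_j smoothing Q W (lev k.+1) (G2 i j) x * \sum_(a <- l) a i 0 * a j 0.
  by apply: eq_bigr => i _; apply: eq_bigr => j _; rewrite SE.
rewrite SEE in h1.
have -> : F w - smoothing Q W (Num.sqrt c) g x =
   (F w - g x - 2^-1 * (c * \sum_i \sum_j smoothing Q W (lev k.+1) (G2 i j) x *
       \sum_(a <- l) a i 0 * a j 0)) -
   (smoothing Q W (Num.sqrt c) g x - g x -
     2^-1 * (c * \sum_i \sum_j smoothing Q W (lev k.+1) (G2 i j) x *
       \sum_(a <- l) a i 0 * a j 0)) by ring.
rewrite (le_trans (ler_normB _ _)) // mulrDr; exact: lerD h1 h2.
Qed.

Lemma lindeberg_bound :
  `|\int[P]_w (\1_A (pil w) * h (s N w)) -
    \int[P]_w (\1_A (pil w) * \int[Q]_t h (W t))| <= bound.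
Proof.
pose a k := \int[P]_w (\1_A (pil w) * hk k (s k w)).
have aN : a N = \int[P]_w (\1_A (pil w) * h (s N w)).
  by apply: eq_Rintegral => w _; rewrite /hk /lev subnn mul0r sqrtr0 smoothing0.
have a0 : a 0%N = \int[P]_w (\1_A (pil w) * \int[Q]_t h (W t)).
  apply: eq_Rintegral => w _; rewrite /hk /lev subn0 mulfV ?sqrtr1; last first.
    by rewrite pnatr_eq0 -lt0n.
  by rewrite s0 /smoothing; congr (_ * _); apply: eq_Rintegral => t _; rewrite add0r scale1r.
have ad k : (k < N)%N -> `|a k.+1 - a k| <= c * bound by exact: step_diff.
rewrite -aN -a0; clearbody a; move: ad; set b := c * bound => ad.
have -> : bound = N%:R * b.
  by rewrite /b mulrA mulfV ?mul1r // pnatr_eq0 -lt0n.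
clearbody b.
have aS k : (k <= N)%N -> `|a k - a 0%N| <= k%:R * b.
  elim: k => [|k IH] kN; first by rewrite subrr normr0 mul0r.
  have -> : a k.+1 - a 0%N = (a k.+1 - a k) + (a k - a 0%N) by rewrite addrA subrK.
  apply: (le_trans (ler_normD _ _)); rewrite -natr1 mulrDl mul1r addrC.
  by apply: lerD; [apply: IH; exact: ltnW|exact: ad].
exact: aS.
Qed.

End lindeberg.

Lemma Rintegral_exceptional {R : realType} {dT : measure_display} {T : measurableType dT}
    (P : probability T R) (F : T -> R) (D : set T) (e K : R) :
  measurable_fun setT F -> measurable D -> 0 <= e -> (forall w, `|F w| <= K) ->
  (forall w, ~ D w -> `|F w| <= e) ->
  `|\int[P]_w F w| <= e + K * fine (P D).
Proof.
move=> mF mD e0 FK Fe.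
have IF : Rintegrable P F by exact: Rintegrable_bounded FK.
have cI (k : R) : Rintegrable P (fun=> k) by exact: finite_measure_integrable_cst.
have ID : Rintegrable P (\1_D : T -> R).
  apply: (Rintegrable_bounded _ (K := 1)); first exact: measurable_indic.
  by move=> w; rewrite indicE; case: (_ \in _); rewrite ?normr1 ?normr0.
have KD := RintegrableZ K ID; have eD := RintegrableD (cI e) KD.
rewrite (le_trans (le_normr_Rintegral measurableT IF)) //.
apply: (le_trans (Rintegral_mono (Rintegrable_norm IF) eD _)) => [w|].
  rewrite indicE; case: (boolP (w \in D)) => [_|/negP].
    by rewrite mulr1 (le_trans (FK w)) // lerDr.
  by rewrite inE mulr0 addr0; exact: Fe.
rewrite (Rintegral_add (cI e) KD) (Rintegral_cstT P e) lerD2l.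
have -> := RintegralZ K ID.
by rewrite /Rintegral integral_indic // setIT.
Qed.

Lemma oP1_fine {R : realType} {dO : measure_display} {Om : measurableType dO}
    (P : probability Om R) (Z : nat -> Om -> R) (e r : R) :
  (forall N, measurable_fun setT (Z N)) -> oP1 P Z -> 0 < e -> 0 < r ->
  \forall N \near \oo, fine (P [set w | e < `|Z N w|]) <= r.
Proof.
move=> mZ oZ e0 r0.
have : \forall N \near \oo, (P [set w | (e < `|Z N w|)%R] < r%:E)%E.
  apply: (oZ _ e0 [set x | (x < r%:E)%E]).
  apply: open_nbhs_nbhs; split; first exact: open_ereal_lt_ereal.
  by rewrite /= lte_fin.
apply: filterS => N h.
rewrite -lee_fin fineK ?ltW //.
by apply: fin_num_measure; exact: measurable_gt_norm.
Qed.

Lemma cvg_gauss_rest {R : realType} d dT (T : measurableType dT) (Q : probability T R)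
    (W : T -> 'cV[R]_d) l (C K : R) : gaussian_spec l Q W -> 0 <= C -> 0 <= K ->
  gauss_rest Q W C K (Num.sqrt (N%:R^-1)) @[N --> \oo] --> (0 : R).
Proof.
move=> spec C0 K0.
pose F (N : nat) t := (Num.min (C * Num.sqrt (N%:R^-1) * `|W t| ^+ 3) (K * `|W t| ^+ 2))%:E.
have IF N : Rintegrable Q (fun t => Num.min (C * Num.sqrt (N%:R^-1) * `|W t| ^+ 3)
    (K * `|W t| ^+ 2)).
  by apply: (Rintegrable_gauss_rest spec) => //; exact: sqrtr_ge0.
have F0 N t : 0 <= Num.min (C * Num.sqrt (N%:R^-1) * `|W t| ^+ 3) (K * `|W t| ^+ 2).
  by rewrite le_min !mulr_ge0 ?sqrtr_ge0 // exprn_ge0.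
have cF t : F ^~ t @ \oo --> (0 : \bar R)%E.
  apply/cvg_EFin; first by near=> N.
  have s0 : C * `|W t| ^+ 3 * Num.sqrt (N%:R^-1) @[N --> \oo] --> (0 : R).
    rewrite -(mulr0 (C * `|W t| ^+ 3)); apply: cvgMr.
    rewrite -(sqrtr0 R); apply: (continuous_cvg _ (@sqrt_continuous R 0)).
    by rewrite -cvg_shiftS; exact: cvg_harmonic.
  apply: (squeeze_cvgr _ (cvg_cst 0) s0); near=> N.
  by rewrite /= F0 /= ge_min; apply/orP; left; rewrite mulrAC.
have mF N : measurable_fun setT (F N) by apply/measurable_EFinP; exact: Rintegrable_meas (IF N).
have Ig : Q.-integrable setT (fun t => (K * `|W t| ^+ 2)%:E).
  exact: (RintegrableZ K (Rintegrable_sqr_normW spec)).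
have dom N t : (`|F N t| <= (K * `|W t| ^+ 2)%:E)%E.
  by rewrite /F abse_EFin lee_fin ger0_norm // ge_min lexx orbT.
have [_ _] := dominated_convergence measurableT mF (measurable_cst (0 : \bar R))
  (aeW _ (fun t _ => cF t)) Ig (aeW _ (fun t N _ => dom N t)).
rewrite integral0 => /fine_cvg /=.
by [].
Unshelve. all: by end_near. Qed.

Section weak_convergence.
Context {R : realType} (d : nat) {dO dT : measure_display} {Om : measurableType dO}
  {T : measurableType dT}.
Local Notation V := 'cV[R]_d.
Variables (P : probability Om R) (Q : probability T R) (W : T -> V).
Hypotheses (mW : forall i, measurable_fun setT (fun t => W t i 0))
  (IW : Rintegrable Q (fun t => `|W t| ^+ 2)).

Definition weak_cvg (Z : nat -> Om -> V) (C : (V -> R) -> Prop) : Prop :=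
  forall g, C g -> \int[P]_w g (Z N w) @[N --> \oo] --> \int[Q]_t g (W t).

Definition bounded_continuous (g : V -> R) : Prop :=
  continuous g /\ exists K, forall x, `|g x| <= K.

Lemma measurable_continuous_comp dS (E : measurableType dS) (g : V -> R) (Z : E -> V) :
  continuous g -> (forall i, measurable_fun setT (fun t => Z t i 0)) ->
  measurable_fun setT (fun t => g (Z t)).
Proof. by move=> cg; apply: measurable_borel_comp; exact: continuous_borel_measurable. Qed.

Lemma smooth_bounded (h : V -> R) : smooth h ->
  measurable_fun [set: borel R d] h /\ exists K, forall x, `|h x| <= K.
Proof.
by move=> [G1 [G2 [C J]]]; split; [exact: jet_meas0 J|exists C; exact: jet_le0 J].
Qed.

Lemma weak_cvg_smooth (Z : nat -> Om -> V) :
  (forall N i, measurable_fun setT (fun w => Z N w i 0)) ->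
  weak_cvg Z (@smooth R d) -> weak_cvg Z bounded_continuous.
Proof.
move=> mZ Zs g [cg [K0 gK0]]; apply/cvgrPdist_le => e e0.
pose K := `|K0| + 1; have K1 : 0 < K by rewrite ltr_wpDl.
have gK x : `|g x| <= K by rewrite (le_trans (gK0 x)) // (le_trans (ler_norm _)) // lerDl.
pose m2 := \int[Q]_t (`|W t| ^+ 2).
have m20 : 0 <= m2 by apply: Rintegral_ge0 => t _; exact: sqr_ge0.
pose q := K * m2 / (e / 8) + 1.
have q1 : 1 <= q by rewrite lerDr divr_ge0 // ?mulr_ge0 // ltW // ?divr_gt0.
have q0 : 0 < q by exact: lt_le_trans q1.
have e8 : 0 < e / 8 by rewrite divr_gt0.
have Kq : K * (m2 / q) <= e / 8.
  rewrite mulrA ler_pdivrMr // /q mulrDr mulr1 mulrCA divff ?gt_eqF // mulr1.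
  by rewrite lerDl ltW.
have [h [chi [sh sc chi01 chi1 gh]]] := smooth_approx cg gK e8 (ltW q0).
have [mh [Kh hK]] := smooth_bounded sh; have [mc _] := smooth_bounded sc.
have mg : measurable_fun [set: borel R d] g by exact: continuous_borel_measurable.
have chiK x : `|chi x| <= 1 by have /andP[c0 c1] := chi01 x; rewrite ger0_norm.
have bI dS (E : measurableType dS) (m : probability E R) (Y : E -> V) (k : V -> R) B :
    (forall i, measurable_fun setT (fun t => Y t i 0)) ->
    measurable_fun [set: borel R d] k -> (forall x, `|k x| <= B) ->
    Rintegrable m (fun t => k (Y t)).
  by move=> mY mk kB; apply: Rintegrable_bounded => //; exact: measurable_borel_comp.
have approx dS (E : measurableType dS) (m : probability E R) (Y : E -> V) :
    (forall i, measurable_fun setT (fun t => Y t i 0)) ->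
    `|\int[m]_t g (Y t) - \int[m]_t h (Y t)| <= e / 8 + K * (1 - \int[m]_t chi (Y t)).
  move=> mY.
  have Ig := bI _ _ m _ _ _ mY mg gK; have Ih := bI _ _ m _ _ _ mY mh hK.
  have Ic := bI _ _ m _ _ _ mY mc chiK.
  have cI (k : R) : Rintegrable m (fun=> k) by exact: finite_measure_integrable_cst.
  have I1 := RintegrableB (cI 1) Ic; have I2 := RintegrableD (cI (e / 8)) (RintegrableZ K I1).
  have <- : \int[m]_t (g (Y t) - h (Y t)) = \int[m]_t g (Y t) - \int[m]_t h (Y t).
    by rewrite RintegralB.
  have Igh := RintegrableB Ig Ih.
  rewrite (le_trans (le_normr_Rintegral measurableT Igh)) //.
  apply: (le_trans (Rintegral_mono (Rintegrable_norm Igh) I2 _)) => [t|]; first exact: gh.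
  rewrite (Rintegral_add (cI (e / 8)) (RintegrableZ K I1)) (Rintegral_cstT m (e / 8)) lerD2l.
  have -> := RintegralZ K I1; rewrite ler_wpM2l ?(ltW K1) //.
  have -> : \int[m]_t (1 - chi (Y t)) = \int[m]_t 1 - \int[m]_t chi (Y t).
    by rewrite RintegralB //; exact: cI.
  by rewrite (Rintegral_cstT m (1 : R)).
have chiW : K * (1 - \int[Q]_t chi (W t)) <= e / 8.
  apply: le_trans Kq; rewrite ler_wpM2l ?(ltW K1) //.
  have Ic := bI _ _ Q _ _ _ mW mc chiK.
  have cI (k : R) : Rintegrable Q (fun=> k) by exact: finite_measure_integrable_cst.
  have -> : 1 - \int[Q]_t chi (W t) = \int[Q]_t (1 - chi (W t)).
    by rewrite RintegralB // ?(Rintegral_cstT Q (1 : R)) //; exact: cI.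
  rewrite mulrC; have <- := RintegralZ q^-1 IW.
  apply: Rintegral_mono => [||t]; [exact: RintegrableB (cI 1) Ic|exact: RintegrableZ|].
  have /andP[c0 c1] := chi01 (W t).
  have [Wq|qW] := leP `|W t| q.
    by rewrite chi1 // subrr mulr_ge0 ?invr_ge0 ?(ltW q0) ?sqr_ge0.
  rewrite (le_trans (y := 1)) //; first by lra.
  rewrite mulrC ler_pdivlMr // mul1r expr2 (le_trans (ltW qW)) // ler_peMl //.
  exact: le_trans q1 (ltW qW).
have e8' := ltW e8.
have ch : \forall N \near \oo, `|\int[Q]_t h (W t) - \int[P]_w h (Z N w)| <= e / 8.
  by have := Zs _ sh => /cvgrPdist_le; apply.
have ek : 0 < e / 8 / K by rewrite divr_gt0.
have cc : \forall N \near \oo, `|\int[Q]_t chi (W t) - \int[P]_w chi (Z N w)| <= e / 8 / K.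
  by have := Zs _ sc => /cvgrPdist_le; apply.
apply: filterS2 ch cc => N h1 h2.
have a1 := approx _ _ P (Z N) (mZ N); have a2 := approx _ _ Q W mW.
have h3 : K * (\int[Q]_t chi (W t) - \int[P]_w chi (Z N w)) <= e / 8.
  have := le_trans (ler_norm _) h2; rewrite ler_pdivlMr // => hc.
  by rewrite mulrC.
move: a1 a2 h1 h3 chiW.
move: (\int[Q]_t chi (W t)) (\int[P]_w chi (Z N w)) (\int[Q]_t h (W t)) (\int[P]_w h (Z N w))
  (\int[Q]_t g (W t)) (\int[P]_w g (Z N w)) => c1 c2 h1 h2' g1 g2.
rewrite !mulrBr !mulr1 !ler_norml => /andP[? ?] /andP[? ?] /andP[? ?] ? ?.
by apply/andP; split; lra.
Qed.

Lemma weak_cvg_slutsky (Z Z' : nat -> Om -> V) :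
  (forall N i, measurable_fun setT (fun w => Z N w i 0)) ->
  (forall N i, measurable_fun setT (fun w => Z' N w i 0)) ->
  oP1 P (fun N w => frob (Z' N w - Z N w)) ->
  weak_cvg Z (@smooth R d) -> weak_cvg Z' (@smooth R d).
Proof.
move=> mZ mZ' o Zs h sh; apply/cvgrPdist_le => e e0.
have [G1 [G2 [C J]]] := sh; have C0 := jet_C0 J.
have mh := jet_meas0 J; have hC := jet_le0 J.
have K0 : 0 <= 3 * jet_const d C by rewrite !mulr_ge0 // exprn_ge0 // addr_ge0.
set K := 3 * jet_const d C in K0.
have K1 : 0 < K + 1 by rewrite ltr_wpDl.
have C1 : 0 < 2 * C + 1 by rewrite ltr_wpDl // mulr_ge0.
have mD N : measurable_fun setT (fun w => frob (Z' N w - Z N w)).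
  apply: (measurable_continuous_comp (Z := fun w => Z' N w - Z N w)).
    exact: continuous_frob.
  by move=> i; under eq_fun do rewrite !mxE; exact: measurable_funB.
have ed : 0 < e / 4 / (K + 1) by rewrite !divr_gt0.
have er : 0 < e / 4 / (2 * C + 1) by rewrite !divr_gt0.
have n1 := oP1_fine mD o ed er.
have e4 : 0 < e / 4 by rewrite divr_gt0.
have n2 : \forall N \near \oo, `|\int[Q]_t h (W t) - \int[P]_w h (Z N w)| <= e / 4.
  by have := Zs _ sh => /cvgrPdist_le; apply.
apply: filterS2 n1 n2 => N h1 h2.
have mhZ : measurable_fun setT (fun w => h (Z N w)) by exact: (measurable_borel_comp mh (mZ N)).
have mhZ' : measurable_fun setT (fun w => h (Z' N w)).
  exact: (measurable_borel_comp mh (mZ' N)).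
have IZ : Rintegrable P (fun w => h (Z N w)) by exact: (Rintegrable_bounded P mhZ (fun w => hC _)).
have IZ' : Rintegrable P (fun w => h (Z' N w)).
  exact: (Rintegrable_bounded P mhZ' (fun w => hC _)).
have := @Rintegral_exceptional _ _ _ P (fun w => h (Z' N w) - h (Z N w))
  [set w | e / 4 / (K + 1) < `|frob (Z' N w - Z N w)|] (e / 4) (2 * C)
  (measurable_funB mhZ' mhZ) (measurable_gt_norm _ (mD N)) (ltW e4).
have -> : \int[P]_w (h (Z' N w) - h (Z N w)) = \int[P]_w h (Z' N w) - \int[P]_w h (Z N w).
  by rewrite RintegralB.
have b1 w : `|h (Z' N w) - h (Z N w)| <= 2 * C.
  rewrite (le_trans (ler_normB _ _)) // mulrDl mul1r lerD //.
have b2 w : ~ [set w | e / 4 / (K + 1) < `|frob (Z' N w - Z N w)|] w ->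
    `|h (Z' N w) - h (Z N w)| <= e / 4.
  move=> /= /negP; rewrite -leNgt ger0_norm ?frob_ge0 // => fw.
  have := jet_lipschitz J (Z N w) (Z' N w - Z N w); rewrite addrCA subrr addr0 => l.
  apply: (le_trans l); rewrite -/K.
  have fn := le_trans (norm_le_frob _) fw; rewrite ler_pdivlMr // in fn.
  have := normr_ge0 (Z' N w - Z N w); lra.
move=> /(_ b1 b2) h3.
have h4 : 2 * C * fine (P [set w | e / 4 / (K + 1) < `|frob (Z' N w - Z N w)|]) <= e / 4.
  rewrite ler_pdivlMr // in h1; set f := fine _ in h1 *.
  have : 0 <= f by exact: fine_ge0.
  by lra.
move: h2 h3; rewrite !ler_norml => /andP[? ?] /andP[? ?].
by apply/andP; split; lra.
Qed.

End weak_convergence.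

Lemma law_exists {R : realType} {dO dS : measure_display} {Om : measurableType dO}
    {S : measurableType dS} (P : probability Om R) (phi : Om -> S) :
  measurable_fun setT phi ->
  exists nu : probability S R, forall A, nu A = P (phi @^-1` A).
Proof.
move=> mphi; have fP : phi \in mfun by rewrite inE.
by exists (distribution P (mfun_Sub fP)).
Qed.

Lemma step_error_small {R : realType} d (S : 'M[R]_d) (C e : R) : 0 <= C -> 0 < e ->
  (forall i, 0 <= S i i) ->
  exists eta eps, [/\ 0 < eta, 0 < eps & step_error S eta eps C <= e].
Proof.
move=> C0 e0 S0.
have K0 : 0 <= jet_const d C by rewrite !mulr_ge0 // exprn_ge0 // addr_ge0.
pose T0 := \sum_i (S i i + 1).
have T00 : 0 <= T0 by apply: sumr_ge0 => i _; rewrite addr_ge0.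
pose D := d%:R ^+ 2 * C + jet_const d C + 1.
have DC0 : 0 <= d%:R ^+ 2 * C by rewrite mulr_ge0 // exprn_ge0.
have D0 : 0 < D by rewrite ltr_wpDl // addr_ge0.
have CT : 0 <= C * T0 by exact: mulr_ge0.
have CT0 : 0 < C * T0 + 1 by rewrite ltr_wpDl.
have e3 : 0 < e / 3 by rewrite divr_gt0.
pose eta := Num.min 1 (e / 3 / D); pose eps := e / 3 / (C * T0 + 1).
have eta0 : 0 < eta by rewrite lt_min ltr01 divr_gt0.
have eps0 : 0 < eps by rewrite divr_gt0.
exists eta, eps; split=> //.
have h1 : D * eta <= e / 3.
  by rewrite mulrC -ler_pdivlMr // ge_min lexx orbT.
have h2 : (C * T0 + 1) * eps <= e / 3 by rewrite mulrC /eps divfK // gt_eqF.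
have h3 : C * eps * \sum_i (S i i + eta) <= C * eps * T0.
  apply: ler_wpM2l; first by rewrite mulr_ge0 // ltW.
  by apply: ler_sum => i _; rewrite lerD2l ge_min lexx.
rewrite /step_error; have h4 := mulr_ge0 DC0 (ltW eta0); have h5 := mulr_ge0 K0 (ltW eta0).
by rewrite /D in h1; lra.
Qed.

Section sampled_clt.
Context {R : realType} {dX dY dO : measure_display}
  {X : measurableType dX} {Y : measurableType dY} {Om : measurableType dO}
  {d q : nat}.
Variables (PX : probability X R) (mu : {sigma_finite_measure set Y -> \bar R})
  (Theta : set 'cV[R]_d) (theta : 'cV[R]_d)
  (f : 'cV[R]_d -> X -> Y -> R).
Hypotheses (hTheta : Theta° theta)
  (hf : is_conditional_density mu f Theta).
Variables (pi : nat -> 'cV[R]_q -> X -> Y -> R) (n : nat -> R).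
Hypotheses (hpi_meas : forall N, measurable_fun setT
     (fun z : X * Y * borel R q => pi N z.2 z.1.1 z.1.2))
  (hpi : forall N vt x y, 0 < pi N vt x y <= 1)
  (hn : forall N vt, (0 < N)%N ->
     Exp PX mu f pi N theta vt (fun x y _ => pi N vt x y) = n N / N%:R).
Variable (P : probability Om R)
  (xs : nat -> Om -> X) (ys : nat -> Om -> Y)
  (pilot : nat -> Om -> borel R q) (vtp : 'cV[R]_q)
  (delta : nat -> nat -> Om -> bool).
Hypotheses (hxs : forall i, measurable_fun setT (xs i))
  (hys : forall i, measurable_fun setT (ys i))
  (hpilot_meas : forall N, measurable_fun setT (pilot N))
  (hdelta_meas : forall N i, measurable_fun setT (delta N i))
  (hdata : iid_sample PX mu f P xs ys theta)
  (hpilot_indep : pilot_independent P xs ys pilot)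
  (hpilot_cvg : oP1 P (fun N w => frob ((pilot N w : 'cV[R]_q) - vtp)))
  (hdelta : bernoulli_subsampling pi P xs ys delta pilot).
Variable U : nat -> 'cV[R]_q -> 'cV[R]_d -> X -> Y -> 'cV[R]_d.
Hypotheses (hU_meas : forall N t j, Theta t -> measurable_fun setT
     (fun z : X * Y * borel R q => U N z.2 t z.1.1 z.1.2 j 0))
  (hU_unbiased : conditionally_unbiased PX mu f pi U Theta).
Variables (B : set 'cV[R]_q) (V : 'cV[R]_q -> 'M[R]_d).
Hypotheses (hB : open_nbhs vtp B)
  (hV_fin : forall N vt, B vt -> finite_Emx PX mu f pi N theta vt
     (fun x y b => b%:R *: outer (U N vt theta x y)))
  (hV_cont : forall N, {for vtp, continuous (fun v => VN PX mu f pi n U N theta v)})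
  (hV_unif : {uniform B, (fun N => VN PX mu f pi n U N theta) @ \oo --> V})
  (hlind : forall eps, 0 < eps ->
         oP1 P (fun N w =>
           lindeberg_tail PX mu f pi n U eps N theta (pilot N w))).

Local Notation w N v := (sampled_density theta f pi N v).
Local Notation u N v := (U_c theta N v U).
Local Notation m := (PX \x mu)%E.

Let z i om := (xs i om, ys i om).
Let mz i : measurable_fun setT (z i).
Proof. exact: measurable_fun_pair. Qed.
Let T0 : Theta theta := Theta_theta hTheta.
Let mf : measurable_fun setT (fun t : X * Y => f theta t.1 t.2) := measurable_density hTheta hf.
Let f0 (t : X * Y) : 0 <= f theta t.1 t.2. Proof. exact: density_ge0 hTheta hf _ _. Qed.

Variable nu : probability (X * Y)%type R.
Hypothesis nuE : forall C, measurable C ->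
  nu C = (\int[m]_(t in C) (f theta t.1 t.2)%:E)%E.

Let nu_sub C : measurable C ->
  (\int[m]_(t in idfun @^-1` C) (f theta t.1 t.2)%:E =
   \int[nu]_(t in idfun @^-1` C) (1 : R)%:E)%E.
Proof. by move=> mC; rewrite -nuE // integral_cst // mul1e. Qed.

Let fin_f : (\int[m]_t (f theta t.1 t.2)%:E < +oo)%E.
Proof. by rewrite -nuE // probability_setT ltry. Qed.

Let measE : @measurable _ (X * Y)%type = <<s @measurable _ (X * Y)%type >>.
Proof. by rewrite sigma_algebra_id //; exact: sigma_algebra_measurable. Qed.

Lemma nu_integral (F : X * Y -> R) : measurable_fun setT F ->
  \int[nu]_t F t = \int[m]_t (F t * f theta t.1 t.2).
Proof.
move=> mF; have := pi_system_Rintegral_eq mf (measurable_cst (1 : R)) f0 (fun=> ler01)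
  (@measurable_id _ _ setT) (@measurable_id _ _ setT) measE (@measurableI _ _)
  measurableT fin_f nu_sub mF => /= ->.
by apply: eq_Rintegral => t _; rewrite mulr1.
Qed.

Lemma nu_integrable (F : X * Y -> R) : measurable_fun setT F ->
  Rintegrable m (fun t => F t * f theta t.1 t.2) -> Rintegrable nu F.
Proof.
move=> mF IF; have := pi_system_Rintegrable mf (measurable_cst (1 : R)) f0 (fun=> ler01)
  (@measurable_id _ _ setT) (@measurable_id _ _ setT) measE (@measurableI _ _)
  measurableT fin_f nu_sub mF IF.
by apply: eq_Rintegrable => t /=; rewrite mulr1.
Qed.

Lemma data_law N (A : set (borel R q)) (C : nat -> set (X * Y)) : measurable A ->
  (forall i, measurable (C i)) ->
  P (pilot N @^-1` A `&` [set om | forall i, (i < N)%N -> C i (z i om)]) =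
  (P (pilot N @^-1` A) * \prod_(i < N) nu (C i))%E.
Proof.
move=> mA mC.
have -> : [set om | forall i, (i < N)%N -> C i (z i om)] =
    data_event xs ys (fun i : 'I_N => C i).
  apply/seteqP; split=> om /= H => [i|i iN]; first exact: H.
  exact: (H (Ordinal iN)).
rewrite hpilot_indep // hdata //; congr (_ * _)%E.
by apply: eq_bigr => i _; rewrite nuE.
Qed.

Lemma indicator_law N (A : set (borel R q)) (C : nat -> set (X * Y)) (b : nat -> bool) :
  measurable A -> (forall i, measurable (C i)) ->
  P (pilot N @^-1` A `&` [set om | forall i, (i < N)%N -> C i (z i om)]
     `&` [set om | forall i, (i < N)%N -> delta N i om = b i]) =
  (\int[P]_(om in pilot N @^-1` A `&` [set om | forall i, (i < N)%N -> C i (z i om)])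
     (\prod_(i < N) bern_wt (b i)
        ((fun t : borel R q * (X * Y) => pi N t.1 t.2.1 t.2.2) (pilot N om, z i om)))%:E)%E.
Proof.
move=> mA mC.
have -> : [set om | forall i, (i < N)%N -> C i (z i om)] =
    data_event xs ys (fun i : 'I_N => C i).
  apply/seteqP; split=> om /= H => [i|i iN]; first exact: H.
  exact: (H (Ordinal iN)).
have -> : [set om | forall i, (i < N)%N -> delta N i om = b i] =
    [set om | forall i : 'I_N, delta N i om = b i].
  apply/seteqP; split=> om /= H => [i|i iN]; first exact: H.
  exact: (H (Ordinal iN)).
by rewrite (hdelta (fun i : 'I_N => b i) mA (fun i : 'I_N => mC i)).
Qed.

Lemma measurable_lindeberg_tail eps N : measurable_fun [set: borel R q]
  (fun v : borel R q => lindeberg_tail PX mu f pi n U eps N theta v).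
Proof.
have E v : lindeberg_tail PX mu f pi n U eps N theta v = N%:R / n N * \int[m]_t (w N v t *
    tail_sqr (eps * Num.sqrt (n N)) (frob (U N v theta t.1 t.2))).
  by rewrite /lindeberg_tail Exp_delta.
under eq_fun do rewrite E.
apply: measurable_funM => //.
apply: (measurable_Rintegral_prod PX mu (f := fun t : borel R q * (X * Y) =>
  w N t.1 t.2 * tail_sqr (eps * Num.sqrt (n N)) (frob (U N t.1 theta t.2.1 t.2.2)))).
apply: measurable_funM; first exact: (measurable_w_joint hTheta hf hpi_meas).
apply: (measurableT_comp (measurable_tail_sqr _)
  (g := fun t : borel R q * (X * Y) => frob (U N t.1 theta t.2.1 t.2.2))).
apply: measurable_continuous_comp; first exact: continuous_frob.
by move=> i; exact: (measurable_U_joint hTheta hU_meas).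
Qed.

Section fixed_size.
Variables (N : nat) (N0 : (0 < N)%N) (A : set (borel R q)) (eta eps : R).
Let nN : 0 < n N := n_gt0 hTheta hf hpi_meas hpi hn vtp N0.
Let r := (Num.sqrt (n N))^-1.
Let r0 : 0 < r. Proof. by rewrite invr_gt0 sqrtr_gt0. Qed.
Let r2 : r ^+ 2 = (n N)^-1. Proof. by rewrite exprVn sqr_sqrtr // ltW. Qed.

Definition pi_at (t : borel R q * (X * Y)) : R := pi N t.1 t.2.1 t.2.2.
Definition U_at (t : borel R q * (X * Y)) : 'cV[R]_d :=
  (Num.sqrt (n N))^-1 *: U N t.1 theta t.2.1 t.2.2.
Definition scaled_sum (k : nat) (om : Om) : 'cV[R]_d :=
  partial_sum (pilot N) z (delta N) U_at k om.

Hypotheses (mA : measurable A) (eta0 : 0 <= eta) (eps0 : 0 < eps).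
Hypothesis hA : forall v, A v -> [/\ B v,
  `|VN PX mu f pi n U N theta v - V vtp| <= eta &
  lindeberg_tail PX mu f pi n U eps N theta v <= eta].

Lemma measurable_pi_at : measurable_fun setT pi_at.
Proof.
apply: (measurableT_comp (hpi_meas N) (g := fun t : borel R q * (X * Y) => (t.2, t.1))).
exact: measurable_fun_pair.
Qed.

Lemma measurable_U_at i : measurable_fun setT (fun t => U_at t i 0).
Proof.
under eq_fun do rewrite mxE; apply: measurable_funM => //.
exact: (measurable_U_joint hTheta hU_meas).
Qed.

Let muv v i : measurable_fun setT (fun t => U_at (v, t) i 0).
Proof. exact: (measurableT_comp (measurable_U_at i) (pair1_measurable v)). Qed.
Let mpv v : measurable_fun setT (fun t => pi_at (v, t)).
Proof. exact: (measurableT_comp measurable_pi_at (pair1_measurable v)). Qed.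

Let Lu v i : B v -> wL2 PX mu (w N v) (u N v i).
Proof. by move=> Bv; apply: wL2_U => [j|]; [exact: hU_meas|exact: hV_fin]. Qed.

Let mw v : measurable_fun setT (w N v) := measurable_w hTheta hf v (hpi_meas N).
Let w0 v t : 0 <= w N v t := w_ge0 hTheta hf N v hpi t.
Let Iw v : Rintegrable m (w N v) := Rintegrable_w PX hTheta hf v (hpi_meas N) hpi.

Lemma step_first v i : A v -> Rintegrable nu (fun t => pi_at (v, t) * U_at (v, t) i 0) /\
  \int[nu]_t (pi_at (v, t) * U_at (v, t) i 0) = 0.
Proof.
move=> /hA[Bv _ _].
have E t : pi_at (v, t) * U_at (v, t) i 0 * f theta t.1 t.2 = r * (w N v t * u N v i t).
  by rewrite mxE /pi_at /sampled_density /U_c /r /=; ring.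
have mF : measurable_fun setT (fun t => pi_at (v, t) * U_at (v, t) i 0).
  exact: measurable_funM.
have I := wL2_int (mw v) (w0 v) (Iw v) (Lu i Bv); split.
  apply: nu_integrable => //; apply: (eq_Rintegrable (fun t => esym (E t))).
  exact: RintegrableZ.
rewrite nu_integral //; under eq_Rintegral do rewrite E.
have -> := RintegralZ r I.
by rewrite (U_centered hTheta hf (hpi_meas N) hpi) ?mulr0 // => [j|]; [exact: hU_meas|exact: hV_fin].
Qed.

Lemma step_second v i j : A v ->
  Rintegrable nu (fun t => pi_at (v, t) * (U_at (v, t) i 0 * U_at (v, t) j 0)) /\
  `|\int[nu]_t (pi_at (v, t) * (U_at (v, t) i 0 * U_at (v, t) j 0)) - N%:R^-1 * V vtp i j|
    <= N%:R^-1 * eta.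
Proof.
move=> /hA[Bv VV _].
have E t : pi_at (v, t) * (U_at (v, t) i 0 * U_at (v, t) j 0) * f theta t.1 t.2 =
    r ^+ 2 * (w N v t * (u N v i t * u N v j t)).
  by rewrite !mxE /pi_at /sampled_density /U_c /r /=; ring.
have mF : measurable_fun setT (fun t => pi_at (v, t) * (U_at (v, t) i 0 * U_at (v, t) j 0)).
  by apply: measurable_funM => //; exact: measurable_funM.
have I := wL2M (mw v) (w0 v) (Lu i Bv) (Lu j Bv); split.
  apply: nu_integrable => //; apply: (eq_Rintegrable (fun t => esym (E t))).
  exact: RintegrableZ.
rewrite nu_integral //; under eq_Rintegral do rewrite E.
have -> := RintegralZ (r ^+ 2) I.
have := VN_wip PX mu theta f pi n N v U i j; rewrite /wip.
set I2 := \int[_]_ _ _ => VE.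
have -> : r ^+ 2 * I2 = N%:R^-1 * VN PX mu f pi n U N theta v i j.
  rewrite VE r2 mulrA [N%:R^-1 * _]mulrA mulVf ?mul1r //.
  by rewrite pnatr_eq0 -lt0n.
rewrite -mulrBr normrM ger0_norm ?invr_ge0 // ler_wpM2l ?invr_ge0 //.
apply: le_trans VV; have := mx_entry_le (VN PX mu f pi n U N theta v - V vtp) i j.
by rewrite !mxE.
Qed.

Lemma step_tail v : A v ->
  \int[nu]_t (pi_at (v, t) * tail_sqr eps `|U_at (v, t)|) <= N%:R^-1 * eta.
Proof.
move=> /hA[Bv _ tl].
pose F t := w N v t * tail_sqr (eps * Num.sqrt (n N)) (frob (U N v theta t.1 t.2)).
have tlE : N%:R / n N * \int[m]_t F t <= eta.
  by move: tl; rewrite /lindeberg_tail Exp_delta.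
have mfr : measurable_fun setT (fun t : X * Y => frob (U N v theta t.1 t.2)).
  apply: measurable_continuous_comp; first exact: continuous_frob.
  by move=> i; exact: (wL2_meas (Lu i Bv)).
have mF : measurable_fun setT F.
  by apply: measurable_funM => //; exact: (measurableT_comp (measurable_tail_sqr _) mfr).
have IF : Rintegrable m F.
  have I : Rintegrable m (fun t => \sum_i w N v t * u N v i t ^+ 2).
    by apply: Rintegrable_sum => i _; exact: (Lu i Bv).2.
  apply: (Rintegrable_le mF _ I) => t.
  have F0 : 0 <= F t by rewrite mulr_ge0 ?tail_sqr_ge0.
  rewrite ger0_norm // -mulr_sumr; apply: ler_wpM2l; first exact: w0.
  by apply: (le_trans (tail_sqr_le _ _)); rewrite sqr_frob.
have mU : measurable_fun setT (fun t => `|U_at (v, t)|).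
  apply: (measurable_continuous_comp (g := fun x : 'cV[R]_d => `|x|)) => //.
  exact: norm_continuous.
have mG : measurable_fun setT (fun t => pi_at (v, t) * tail_sqr eps `|U_at (v, t)|).
  by apply: measurable_funM => //; exact: (measurableT_comp (measurable_tail_sqr _) mU).
have GF t : pi_at (v, t) * tail_sqr eps `|U_at (v, t)| * f theta t.1 t.2 <= (n N)^-1 * F t.
  have -> : (n N)^-1 * F t = pi_at (v, t) * ((n N)^-1 *
      tail_sqr (eps * Num.sqrt (n N)) (frob (U N v theta t.1 t.2))) * f theta t.1 t.2.
    by rewrite /F /sampled_density /pi_at /=; ring.
  apply: ler_wpM2r => //; apply: ler_wpM2l.
    by have /andP[/ltW] := hpi N v t.1 t.2.
  have Ule : `|U_at (v, t)| <= r * frob (U N v theta t.1 t.2).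
    by rewrite normrZ gtr0_norm // ler_wpM2l ?(ltW r0) // norm_le_frob.
  rewrite {1}/tail_sqr; case: ifP => eU; last by rewrite mulr_ge0 ?tail_sqr_ge0 // invr_ge0 ltW.
  have := lt_le_trans eU Ule; rewrite mulrC ltr_pdivlMr ?sqrtr_gt0 // => eF.
  rewrite /tail_sqr eF -r2 -exprMn lerXn2r ?nnegrE ?mulr_ge0 ?frob_ge0 // ltW //.
rewrite nu_integral //.
have IF' := RintegrableZ (n N)^-1 IF.
have IG : Rintegrable m (fun t => pi_at (v, t) * tail_sqr eps `|U_at (v, t)| * f theta t.1 t.2).
  apply: (Rintegrable_le _ _ IF') => [|t]; first exact: measurable_funM.
  rewrite ger0_norm // mulr_ge0 // mulr_ge0 ?tail_sqr_ge0 //.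
  by have /andP[/ltW] := hpi N v t.1 t.2.
apply: (le_trans (Rintegral_mono IG IF' GF)).
have -> := RintegralZ (n N)^-1 IF.
have -> : (n N)^-1 * \int[m]_t F t = N%:R^-1 * (N%:R / n N * \int[m]_t F t).
  by rewrite !mulrA mulVf ?mul1r // pnatr_eq0 -lt0n.
by rewrite ler_wpM2l ?invr_ge0.
Qed.

End fixed_size.

Lemma sampled_sum_scaled N om : scaled_sum N N om =
  (Num.sqrt (n N))^-1 *: sampled_sum U xs ys delta pilot N theta om.
Proof.
rewrite /sampled_sum scaler_sumr; apply: eq_bigr => i _.
by rewrite /U_at /= scalerA mulrC -scalerA.
Qed.

Lemma sampled_sum_clt dT (T : measurableType dT) (Q : probability T R) (W : T -> 'cV[R]_d) l :
  gaussian_spec l Q W -> (forall i j, V vtp i j = \sum_(a <- l) a i 0 * a j 0) ->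
  weak_cvg P Q W (fun N om => scaled_sum N N om) (@smooth R d).
Proof.
move=> spec SE h sh; apply/cvgrPdist_le => e e0.
have [G1 [G2 [C J]]] := sh; have C0 := jet_C0 J.
have mh := jet_meas0 J; have hC := jet_le0 J.
have S0 i : 0 <= V vtp i i by rewrite SE; apply: sumr_ge0 => a _; rewrite -expr2 sqr_ge0.
have e4 : 0 < e / 4 by rewrite divr_gt0.
have C1 : 0 < 2 * C + 1 by rewrite ltr_wpDl // mulr_ge0.
have K0 : 0 <= jet_const d C by rewrite !mulr_ge0 // exprn_ge0 // addr_ge0.
have [eta [eps [eta0 eps0 serr]]] := step_error_small C0 e4 S0.
have [r r0 nr'] := uniform_near_le hB hV_cont hV_unif eta0.
have mfrob N : measurable_fun setT (fun om => frob ((pilot N om : 'cV[R]_q) - vtp)).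
  exact: (measurableT_comp (measurable_frob_sub vtp) (hpilot_meas N)).
have mlind N : measurable_fun setT (fun om =>
    lindeberg_tail PX mu f pi n U eps N theta (pilot N om)).
  exact: (measurableT_comp (measurable_lindeberg_tail eps N) (hpilot_meas N)).
have ec : 0 < e / 4 / (2 * C + 1) by rewrite divr_gt0.
have n1' := oP1_fine mfrob hpilot_cvg r0 ec.
have n2' := oP1_fine mlind (hlind eps0) eta0 ec.
have n3' : \forall N \near \oo, gauss_rest Q W C (jet_const d C) (Num.sqrt N%:R^-1) <= e / 4.
  have := cvg_gauss_rest spec C0 K0 => /cvgrPdist_le /(_ _ e4); apply: filterS => N.
  by rewrite sub0r normrN; apply: le_trans; exact: ler_norm.
have n4 : \forall N \near \oo, (0 < N)%N by exact: nbhs_infty_gt.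
near=> N; have N0 : (0 < N)%N by near: N.
have n1 : fine (P [set om | r < `|frob ((pilot N om : 'cV[R]_q) - vtp)|])
  <= e / 4 / (2 * C + 1) by near: N.
have n2 : fine (P [set om | eta < `|lindeberg_tail PX mu f pi n U eps N theta (pilot N om)|])
  <= e / 4 / (2 * C + 1) by near: N.
have n3 : gauss_rest Q W C (jet_const d C) (Num.sqrt N%:R^-1) <= e / 4 by near: N.
have nr : forall v, `|v - vtp| <= r -> B v /\
  `|VN PX mu f pi n U N theta v - V vtp| <= eta by near: N.
pose A := ~` [set v : borel R q | r < `|frob ((v : 'cV[R]_q) - vtp)|] `&`
  ~` [set v : borel R q | eta < `|lindeberg_tail PX mu f pi n U eps N theta v|].
have mA : measurable A.
  apply: measurableI; apply: measurableC; apply: measurable_gt_norm.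
    exact: measurable_frob_sub.
  exact: measurable_lindeberg_tail.
have hA v : A v -> [/\ B v, `|VN PX mu f pi n U N theta v - V vtp| <= eta &
    lindeberg_tail PX mu f pi n U eps N theta v <= eta].
  move=> [/= /negP + /negP]; rewrite -!leNgt => a1 a2.
  have [|Bv Vv] := nr v; last by split=> //; exact: le_trans (ler_norm _) a2.
  by apply: le_trans (norm_le_frob _) _; apply: le_trans (ler_norm _) a1.
have p01 t : 0 <= pi_at N t <= 1.
  by have /andP[/ltW a b] := hpi N t.1 t.2.1 t.2.2; apply/andP.
have mpi := measurable_pi_at N; have mUa := measurable_U_at N.
have sstep k (g : 'cV[R]_d -> R) K : (k < N)%N -> measurable_fun [set: borel R d] g ->
  (forall x, `|g x| <= K) ->
  \int[P]_om (\1_A (pilot N om) * g (scaled_sum N k.+1 om)) =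
  \int[P]_om (\1_A (pilot N om) * \int[nu]_t (pi_at N (pilot N om, t) *
      g (scaled_sum N k om + U_at N (pilot N om, t)) +
     (1 - pi_at N (pilot N om, t)) * g (scaled_sum N k om))).
  move=> kN mg gK.
  exact: (partial_sum_step (hpilot_meas N) mz (hdelta_meas N) mpi p01
    (@data_law N) (@indicator_law N) mUa kN mg gK mA).
have ms k i : measurable_fun setT (fun om => scaled_sum N k om i 0).
  rewrite /scaled_sum /partial_sum; under eq_fun do rewrite summxE.
  apply: measurable_sum => j; under eq_fun do rewrite mxE.
  apply: measurable_funM.
    by apply: (measurableT_comp (f := fun b : bool => b%:R : R)).
  apply: (measurableT_comp (mUa i) (g := fun om => (pilot N om, z j om))).
  exact: measurable_fun_pair.
have s0 om : scaled_sum N 0 om = 0 by rewrite /scaled_sum /partial_sum big_ord0.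
have LB := lindeberg_bound spec SE N0 (hpilot_meas N) ms s0 mpi p01 mUa mA (ltW eta0)
  (ltW eps0) sstep (fun v i Av => (step_first hA i Av).1)
  (fun v i Av => (step_first hA i Av).2) (fun v i j Av => (step_second N0 hA i j Av).1)
  (fun v i j Av => (step_second N0 hA i j Av).2) (fun v Av => step_tail N0 hA Av) J.
set mW := \int[Q]_t h (W t) in LB *.
have mWC : `|mW| <= C.
  apply: Rintegral_norm_bounded => //; exact: (measurable_borel_comp mh (gs_meas spec)).
have mhs : measurable_fun setT (fun om => h (scaled_sum N N om)).
  exact: (measurable_borel_comp mh (ms N)).
have m1 : measurable_fun setT (fun om => \1_A (pilot N om) : R).
  by apply: (measurableT_comp (f := (\1_A : borel R q -> R))).
have i01 om : (0 : R) <= \1_A (pilot N om) <= (1 : R).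
  by rewrite indicE; case: (_ \in _); rewrite ?ler01 ?lexx.
pose F om := (1 - \1_A (pilot N om)) * (h (scaled_sum N N om) - mW).
have mF : measurable_fun setT F.
  by apply: measurable_funM; apply: measurable_funB.
have FC om : `|F om| <= 2 * C.
  have /andP[a b] := i01 om; rewrite normrM ger0_norm ?subr_ge0 //.
  rewrite (le_trans (ler_wpM2l _ (ler_normB _ _))) ?subr_ge0 //.
  have := hC (scaled_sum N N om); have := normr_ge0 (h (scaled_sum N N om)).
  by have := normr_ge0 mW; nra.
pose D := [set om | r < `|frob ((pilot N om : 'cV[R]_q) - vtp)|] `|`
  [set om | eta < `|lindeberg_tail PX mu f pi n U eps N theta (pilot N om)|].
have mD1 := measurable_gt_norm r (mfrob N); have mD2 := measurable_gt_norm eta (mlind N).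
have mD : measurable D by exact: measurableU.
have FD om : ~ D om -> `|F om| <= 0.
  move=> nD; rewrite /F indicE mem_set ?subrr ?mul0r ?normr0 //.
  by split=> H; apply: nD; [left|right].
have := Rintegral_exceptional P mF mD (lexx 0) FC FD; rewrite add0r => FB.
have PD : fine (P D) <= 2 * (e / 4 / (2 * C + 1)).
  have : (P D <= P [set om | (r < `|frob ((pilot N om : 'cV[R]_q) - vtp)|)%R] +
     P [set om | (eta < `|lindeberg_tail PX mu f pi n U eps N theta (pilot N om)|)%R])%E.
    exact: measureU2.
  have f1 := fin_num_measure P _ mD1; have f2 := fin_num_measure P _ mD2.
  have f3 := fin_num_measure P _ mD.
  by rewrite -(fineK f1) -(fineK f2) -(fineK f3) -EFinD lee_fin; lra.
have PD0 : 0 <= fine (P D) by exact: fine_ge0.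
have PDe : 2 * C * fine (P D) <= 2 * (e / 4).
  have h1 : (2 * C + 1) * fine (P D) <= 2 * (e / 4).
    by rewrite mulrC -ler_pdivlMr // -mulrA.
  by lra.
have bI (g : Om -> R) K : measurable_fun setT g -> (forall x, `|g x| <= K) ->
    Rintegrable P g by move=> mg gK; exact: (Rintegrable_bounded P mg gK).
have Ih : Rintegrable P (fun om => h (scaled_sum N N om)) by exact: (bI _ C).
have I1 : Rintegrable P (fun om => \1_A (pilot N om) * h (scaled_sum N N om)).
  apply: (bI _ C) => [|x]; first exact: measurable_funM.
  have /andP[a b] := i01 x; rewrite normrM ger0_norm //.
  by have := hC (scaled_sum N N x); have := normr_ge0 (h (scaled_sum N N x)); nra.
have I2 : Rintegrable P (fun om => \1_A (pilot N om) * mW).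
  apply: (bI _ C) => [|x]; first exact: measurable_funM.
  have /andP[a b] := i01 x; rewrite normrM ger0_norm //.
  by have := normr_ge0 mW; nra.
have IF : Rintegrable P F by exact: (bI _ (2 * C)).
have cI (k : R) : Rintegrable P (fun=> k) by exact: finite_measure_integrable_cst.
have I12 := RintegrableB I1 I2.
have E : \int[P]_om h (scaled_sum N N om) - mW =
    (\int[P]_om (\1_A (pilot N om) * h (scaled_sum N N om)) -
     \int[P]_om (\1_A (pilot N om) * mW)) + \int[P]_om F om.
  transitivity (\int[P]_om (h (scaled_sum N N om) - mW)).
    by rewrite RintegralB // ?(Rintegral_cstT P mW) //; exact: cI.
  transitivity (\int[P]_om ((\1_A (pilot N om) * h (scaled_sum N N om) -
     \1_A (pilot N om) * mW) + F om)).
    by apply: eq_Rintegral => om _; rewrite /F; ring.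
  by rewrite (Rintegral_add I12 IF); congr (_ + _); rewrite RintegralB.
rewrite distrC E (le_trans (ler_normD _ _)) //.
by apply: (le_trans (lerD LB FB)); lra.
Unshelve. all: by end_near. Qed.

End sampled_clt.

Lemma Lfun2_of_sqr {R : realType} {dT : measure_display} {T : measurableType dT}
    (Q : probability T R) (f : T -> R) : measurable_fun setT f ->
  Rintegrable Q (fun t => f t ^+ 2) -> f \in Lfun Q 2%:E.
Proof.
move=> mf f2; rewrite inE; apply/andP; split; first by rewrite inE.
rewrite inE /= /finite_norm unlock /=; apply: poweR_lty.
rewrite (eq_integral (fun t => (f t ^+ 2)%:E)); last first.
  by move=> t _ /=; rewrite powR_mulrn // real_normK ?num_real.
exact: integrable_lty f2.
Qed.

Lemma covariance_centered {R : realType} {dT : measure_display} {T : measurableType dT}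
    (Q : probability T R) (f g : T -> R) :
  Rintegrable Q f -> Rintegrable Q g -> Rintegrable Q (fun t => f t * g t) ->
  \int[Q]_t f t = 0 -> \int[Q]_t g t = 0 ->
  covariance Q f g = (\int[Q]_t (f t * g t))%:E.
Proof.
move=> fi gi fgi f0 g0; rewrite -RintegralE //.
have Ef : ('E_Q[f] = 0)%E by rewrite unlock RintegralE // f0.
have Eg : ('E_Q[g] = 0)%E by rewrite unlock RintegralE // g0.
rewrite unlock Ef Eg unlock; apply: eq_integral => t _ /=.
by transitivity (((f t - 0) * (g t - 0))%:E) => //; rewrite !subr0.
Qed.

Section linear_image.
Context {R : realType} (d : nat) {dT : measure_display} {T : measurableType dT}.
Variables (Q : probability T R) (W : T -> 'cV[R]_d) (l : seq 'cV[R]_d) (L S : 'M[R]_d).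
Hypotheses (spec : gaussian_spec l Q W)
  (SE : forall i j, S i j = \sum_(a <- l) a i 0 * a j 0).

Let IW i : Rintegrable Q (fun t => W t i 0).
Proof. exact: Rintegrable_sqrW (gs_meas spec i) (gs_sqr spec i). Qed.

Let IWW i j : Rintegrable Q (fun t => W t i 0 * W t j 0).
Proof.
exact: Rintegrable_mul (gs_meas spec i) (gs_meas spec j) (gs_sqr spec i) (gs_sqr spec j).
Qed.

Lemma measurable_linear_image i : measurable_fun setT (fun t => (L *m W t) i 0).
Proof.
under eq_fun do rewrite mxE; apply: measurable_sum => j.
by apply: measurable_funM => //; exact: gs_meas spec j.
Qed.

Lemma linear_image_mean i : Rintegrable Q (fun t => (L *m W t) i 0) /\
  \int[Q]_t (L *m W t) i 0 = 0.
Proof.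
have E t : (L *m W t) i 0 = \sum_k L i k * W t k 0 by rewrite mxE.
have I k : Rintegrable Q (fun t => L i k * W t k 0) by exact: RintegrableZ.
split; first by apply: (eq_Rintegrable (fun t => esym (E t))); exact: Rintegrable_sum.
under eq_Rintegral do rewrite E.
rewrite Rintegral_sum // big1 // => k _.
by have -> := RintegralZ (L i k) (IW k); rewrite (gs_mean spec) mulr0.
Qed.

Lemma linear_image_cov i j : Rintegrable Q (fun t => (L *m W t) i 0 * (L *m W t) j 0) /\
  \int[Q]_t ((L *m W t) i 0 * (L *m W t) j 0) = (L *m S *m L^T) i j.
Proof.
have E t : (L *m W t) i 0 * (L *m W t) j 0 =
    \sum_k \sum_m (L i m * L j k) * (W t m 0 * W t k 0).
  rewrite !mxE mulr_sumr; apply: eq_bigr => k _; rewrite mulr_suml.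
  by apply: eq_bigr => m _; ring.
have I k m : Rintegrable Q (fun t => (L i m * L j k) * (W t m 0 * W t k 0)).
  exact: RintegrableZ.
have Ik k : Rintegrable Q (fun t => \sum_m (L i m * L j k) * (W t m 0 * W t k 0)).
  exact: Rintegrable_sum.
split; first by apply: (eq_Rintegrable (fun t => esym (E t))); exact: Rintegrable_sum.
under eq_Rintegral do rewrite E.
rewrite Rintegral_sum // mxE; apply: eq_bigr => k _.
rewrite Rintegral_sum // !mxE mulr_suml; apply: eq_bigr => m _.
have -> := RintegralZ (L i m * L j k) (IWW m k).
by rewrite (gs_cov spec) -SE; ring.
Qed.

Lemma linear_image_sqr_norm : Rintegrable Q (fun t => `|L *m W t| ^+ 2).
Proof.
apply: (Rintegrable_le (g := fun t => \sum_i (L *m W t) i 0 * (L *m W t) i 0)).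
- apply: measurable_funX; apply: (measurable_continuous_comp (g := fun x : 'cV[R]_d => `|x|)).
    exact: norm_continuous.
  exact: measurable_linear_image.
- move=> t; rewrite ger0_norm ?sqr_ge0 //; apply: (le_trans (sqr_norm_le _)).
  by apply: ler_sum => i _; rewrite expr2.
by apply: Rintegrable_sum => i _; exact: (linear_image_cov i i).1.
Qed.

Lemma weak_cvg_linear {dO : measure_display} {Om : measurableType dO}
    (P : probability Om R) (Z : nat -> Om -> 'cV[R]_d) :
  weak_cvg P Q W Z (@bounded_continuous R d) ->
  weak_cvg P Q (fun t => L *m W t) (fun N w => L *m Z N w) (@smooth R d).
Proof.
move=> ZW h [G1 [G2 [C J]]]; apply: (ZW (fun x => h (L *m x))); split; last first.
  by exists C => x; exact: jet_le0 J _.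
move=> x A /= /nbhs_ballP[e /= e0 eA].
have C0 := jet_C0 J.
pose K := 3 * jet_const d C * (d%:R * `|L|).
have K0 : 0 <= K by rewrite !mulr_ge0 // exprn_ge0 // addr_ge0.
have K1 : 0 < K + 1 by rewrite ltr_wpDl.
apply/(nbhs_ballP x); exists (e / (K + 1)) => /= [|y]; first by rewrite divr_gt0.
rewrite -ball_normE /= => yx; apply: eA; rewrite -ball_normE /=.
have := jet_lipschitz J (L *m y) (L *m (x - y)).
rewrite -mulmxDr addrCA subrr addr0 => h1; apply: (le_lt_trans h1).
have h2 : `|L *m (x - y)| <= d%:R * `|L| * `|x - y| by exact: mulmx_norm_le.
have jc : 0 <= 3 * jet_const d C by rewrite !mulr_ge0 // exprn_ge0 // addr_ge0.
apply: (le_lt_trans (ler_wpM2l jc h2)); rewrite mulrA -/K.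
rewrite ltr_pdivlMr // in yx; have := normr_ge0 (x - y); nra.
Qed.

End linear_image.

Lemma sqrtr_divr {R : realType} (x : R) : Num.sqrt x * x^-1 = (Num.sqrt x)^-1.
Proof.
have [x0|x0] := leP x 0; first by rewrite ler0_sqrtr // mul0r invr0.
rewrite -{2}(sqr_sqrtr (ltW x0)) expr2 invfM mulrA divff ?mul1r //.
by rewrite gt_eqF // sqrtr_gt0.
Qed.

Lemma weak_cvg_dist {R : realType} d {dO dT : measure_display} {Om : measurableType dO}
    {T : measurableType dT} (P : probability Om R) (Q : probability T R)
    (W : T -> 'cV[R]_d) (Z : nat -> Om -> 'cV[R]_d) :
  (forall i, measurable_fun setT (fun t => W t i 0)) ->
  (forall N i, measurable_fun setT (fun w => Z N w i 0)) ->
  weak_cvg P Q W Z (@bounded_continuous R d) -> cvg_dist P Z Q W.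
Proof.
move=> mW mZ ZW g cg [K gK].
have E dS (S : measurableType dS) (m : probability S R) (Y : S -> 'cV[R]_d) :
    (forall i, measurable_fun setT (fun t => Y t i 0)) ->
    'E_m[g \o Y]%E = (\int[m]_t g (Y t))%:E.
  move=> mY; rewrite unlock RintegralE //.
  exact: (Rintegrable_bounded m (measurable_continuous_comp cg mY) (fun t => gK _)).
rewrite E //; under eq_fun do rewrite E //.
apply: cvg_EFin; first by near=> N.
by apply: ZW; split=> //; exists K.
Unshelve. all: by end_near. Qed.

Theorem theorem6
  (R : realType) (dX dY dO : measure_display)
  (X : measurableType dX) (Y : measurableType dY) (Om : measurableType dO)
  (d q : nat)
  (* model *)
  (PX : probability X R) (mu : {sigma_finite_measure set Y -> \bar R})
  (Theta : set 'cV[R]_d) (theta : 'cV[R]_d)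
  (f : 'cV[R]_d -> X -> Y -> R)
  (hTheta : Theta° theta)
  (hf : is_conditional_density mu f Theta)
  (hf_diff : \forall x \ae PX, \forall y \ae mu,
     differentiable (fun t => f t x y) theta)
  (hscore : forall k, measurable_fun setT
     (fun z : X * Y => score f theta z.1 z.2 k 0))
  (* subsampling probabilities and average subsample size *)
  (pi : nat -> 'cV[R]_q -> X -> Y -> R) (n : nat -> R)
  (hpi_meas : forall N, measurable_fun setT
     (fun z : X * Y * borel R q => pi N z.2 z.1.1 z.1.2))
  (hpi : forall N vt x y, 0 < pi N vt x y <= 1)
  (hn : forall N vt, (0 < N)%N ->
     Exp PX mu f pi N theta vt (fun x y _ => pi N vt x y) = n N / N%:R)
  (hn_infty : n N @[N --> \oo] --> +oo)
  (* data, pilot estimator, sampling indicators *)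
  (P : probability Om R)
  (xs : nat -> Om -> X) (ys : nat -> Om -> Y)
  (pilot : nat -> Om -> borel R q) (vtp : 'cV[R]_q)
  (delta : nat -> nat -> Om -> bool)
  (hxs : forall i, measurable_fun setT (xs i))
  (hys : forall i, measurable_fun setT (ys i))
  (hpilot_meas : forall N, measurable_fun setT (pilot N))
  (hdelta_meas : forall N i, measurable_fun setT (delta N i))
  (hdata : iid_sample PX mu f P xs ys theta)
  (hpilot_indep : pilot_independent P xs ys pilot)
  (hpilot_cvg : oP1 P (fun N w => frob ((pilot N w : 'cV[R]_q) - vtp)))
  (hdelta : bernoulli_subsampling pi P xs ys delta pilot)
  (* estimating function *)
  (U : nat -> 'cV[R]_q -> 'cV[R]_d -> X -> Y -> 'cV[R]_d)
  (hU_meas : forall N t j, Theta t -> measurable_fun setT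
     (fun z : X * Y * borel R q => U N z.2 t z.1.1 z.1.2 j 0))
  (hU_diff : forall N vt, \forall x \ae PX, \forall y \ae mu,
     differentiable (fun t => U N vt t x y) theta)
  (hU_unbiased : conditionally_unbiased PX mu f pi U Theta)
  (hU_swap : forall N vt, diff_under_integral PX mu f pi U N theta vt)
  (* estimator *)
  (thetahat : nat -> Om -> borel R d)
  (hthetahat_meas : forall N, measurable_fun setT (thetahat N))
  (hthetahat : P [set w | Theta (thetahat N w) /\
     sampled_sum U xs ys delta pilot N (thetahat N w) w = 0]
     @[N --> \oo] --> 1%E)
  (* limits in a neighborhood B of vtp *)
  (B : set 'cV[R]_q) (M V Sigma : 'cV[R]_q -> 'M[R]_d)
  (hB : open_nbhs vtp B)
  (hM_fin : forall N vt, B vt -> finite_Emx PX mu f pi N theta vt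
     (fun x y b => b%:R *: jac (fun t => U N vt t x y) theta))
  (hM_cont : forall N vt, B vt ->
     {for vt, continuous (fun v => MN PX mu f pi n U N theta v)})
  (hM_cvg : forall vt, B vt ->
     MN PX mu f pi n U N theta vt @[N --> \oo] --> M vt)
  (hM_rank : forall vt, B vt -> \rank (M vt) = d)
  (hV_fin : forall N vt, B vt -> finite_Emx PX mu f pi N theta vt
     (fun x y b => b%:R *: outer (U N vt theta x y)))
  (hV_cont : forall N vt, B vt ->
     {for vt, continuous (fun v => VN PX mu f pi n U N theta v)})
  (hV_cvg : forall vt, B vt ->
     VN PX mu f pi n U N theta vt @[N --> \oo] --> V vt)
  (hV_rank : forall vt, B vt -> \rank (V vt) = d)
  (hSigma_fin : forall N vt, B vt -> finite_Emx PX mu f pi N theta vt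
     (fun x y _ => pi N vt x y *: outer (score f theta x y)))
  (hSigmaN_pd : forall N vt, (0 < N)%N -> B vt ->
     posdef (SigmaN PX mu f pi n N theta vt))
  (hSigmaN_cont : forall N vt, B vt ->
     {for vt, continuous (fun v => SigmaN PX mu f pi n N theta v)})
  (hSigma_cvg : forall vt, B vt ->
     SigmaN PX mu f pi n N theta vt @[N --> \oo] --> Sigma vt)
  (hSigma_pd : forall vt, B vt -> posdef (Sigma vt))
  (hSigma_cont : forall vt, B vt -> {for vt, continuous Sigma})
  (* asymptotic expansion of the estimator *)
  (hexpansion : oP1 P (fun N w => frob (Num.sqrt (n N) *:
     ((thetahat N w : 'cV[R]_d) - (theta - (n N)^-1 *: (invmx (M vtp) *m
        sampled_sum U xs ys delta pilot N theta w)))))) :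
  [/\ (* asymptotic variance *)
      {uniform B, (fun N => VN PX mu f pi n U N theta) @ \oo --> V} ->
      (forall eps, 0 < eps ->
         oP1 P (fun N w =>
           lindeberg_tail PX mu f pi n U eps N theta (pilot N w))) ->
      asymptotic_covariance P
        (fun N w => Num.sqrt (n N) *: ((thetahat N w : 'cV[R]_d) - theta))
        (invmx (M vtp) *m V vtp *m (invmx (M vtp))^T),
      (* information bound *)
      loewner_ge (invmx (M vtp) *m V vtp *m (invmx (M vtp))^T)
        (invmx (Sigma vtp)) &
      (* equality case *)
      {uniform B, (fun N => VN PX mu f pi n U N theta) @ \oo --> V} ->
      {uniform B, (fun N => SigmaN PX mu f pi n N theta) @ \oo --> Sigma} ->
      oP1 P (fun N w =>
        mean_sq_TN PX mu f pi n U (M vtp) (Sigma vtp) N theta (pilot N w)) ->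
      invmx (M vtp) *m V vtp *m (invmx (M vtp))^T = invmx (Sigma vtp)].
Proof.
have [oB Bv] := hB.
have VM := V_sym (hV_cvg vtp Bv).
have Vc N := hV_cont N vtp Bv.
set Minv := invmx (M vtp).
split.
- move=> uV hl.
  have V0 a : 0 <= bilmx (V vtp) a a.
    have := limit_info hTheta hf hf_diff hscore hpi_meas hpi hn hU_meas hU_diff hU_unbiased
      hU_swap hB hM_fin (hM_cvg vtp Bv) hV_fin (hV_cvg vtp Bv) hSigma_fin (hSigma_cvg vtp Bv) a 0.
    by rewrite /bilmx !mulmx0 !mxE mulr0 subr0 addr0.
  have [l SE] := psd_decomposition VM V0.
  have [dT [T [Q [W spec]]]] := gaussian_vector_exists l.
  have mz : measurable_fun setT (fun om => (xs 0%N om, ys 0%N om)).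
    exact: measurable_fun_pair.
  have [nu nuP] := law_exists P mz.
  have nuE C : measurable C ->
      nu C = (\int[(PX \x mu)%E]_(t in C) (f theta t.1 t.2)%:E)%E.
    move=> mC; rewrite nuP.
    have := @hdata 1%N (fun=> C) (fun=> mC); rewrite big_ord1 => <-.
    congr (P _); apply/seteqP; split=> om /= H; last exact: (H ord0).
    by move=> i; rewrite ord1.
  have clt := sampled_sum_clt hTheta hf hpi_meas hpi hn hxs hys hpilot_meas hdelta_meas
    hdata hpilot_indep hpilot_cvg hdelta hU_meas hU_unbiased hB hV_fin Vc uV hl nuE spec SE.
  pose s N om := scaled_sum theta n xs ys pilot delta U N N om.
  have ms N i : measurable_fun setT (fun om => s N om i 0).
    rewrite /s /scaled_sum /partial_sum; under eq_fun do rewrite summxE.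
    apply: measurable_sum => j; under eq_fun do rewrite mxE.
    apply: measurable_funM.
      by apply: (measurableT_comp (f := fun b : bool => b%:R : R)).
    apply: (measurableT_comp (measurable_U_at hTheta n hU_meas N i)
      (g := fun om => (pilot N om, (xs j om, ys j om)))).
    by apply: measurable_fun_pair => //; exact: measurable_fun_pair.
  have mW := gs_meas spec.
  have clt' := weak_cvg_smooth mW (Rintegrable_sqr_normW spec) ms clt.
  have cltL := weak_cvg_linear (L := - Minv) clt'.
  pose Z N om := Num.sqrt (n N) *: ((thetahat N om : 'cV[R]_d) - theta).
  have mZ N i : measurable_fun setT (fun om => Z N om i 0).
    under eq_fun do rewrite !mxE.
    apply: measurable_funM => //; apply: measurable_funB => //.
    apply: (measurableT_comp (f := fun x : borel R d => (x : 'cV[R]_d) i 0)) => //.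
    by apply: continuous_borel_measurable; exact: coord_continuous.
  have mLs N i : measurable_fun setT (fun om => (- Minv *m s N om) i 0).
    under eq_fun do rewrite mxE; apply: measurable_sum => j.
    by apply: measurable_funM.
  have remE : (fun N om => frob (Z N om - - Minv *m s N om)) =
      (fun N om => frob (Num.sqrt (n N) *:
       ((thetahat N om : 'cV[R]_d) - (theta - (n N)^-1 *: (invmx (M vtp) *m
          sampled_sum U xs ys delta pilot N theta om))))).
    apply/funext => N; apply/funext => om; congr (frob _).
    rewrite /Z /s sampled_sum_scaled -sqrtr_divr mulNmx opprK -scalemxAr -scalerA.
    by rewrite -scalerDr opprB addrA addrAC.
  have rem : oP1 P (fun N om => frob (Z N om - - Minv *m s N om)) by rewrite remE.
  have cltZ := weak_cvg_slutsky mLs mZ rem cltL.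
  have mLW := measurable_linear_image (- Minv) spec.
  have cltZ' := weak_cvg_smooth mLW (linear_image_sqr_norm (- Minv) spec SE) mZ cltZ.
  exists dT, T, Q, (fun t => - Minv *m W t); split=> [i||i j].
  + apply: Lfun2_of_sqr; first exact: mLW.
    have [I _] := linear_image_cov (- Minv) spec SE i i.
    by apply: eq_Rintegrable I => t; rewrite expr2.
  + exact: weak_cvg_dist mLW mZ cltZ'.
  + have [Ii Ei] := linear_image_mean (- Minv) spec i.
    have [Ij Ej] := linear_image_mean (- Minv) spec j.
    have [Iij Eij] := linear_image_cov (- Minv) spec SE i j.
    rewrite covariance_centered // Eij.
    by rewrite mulNmx linearN /= mulmxN mulNmx opprK.
- exact: (information_bound hTheta hf hf_diff hscore hpi_meas hpi hn hU_meas hU_diff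
    hU_unbiased hU_swap hB hM_fin (hM_cvg vtp Bv) (hM_rank vtp Bv) hV_fin (hV_cvg vtp Bv)
    hSigma_fin (hSigma_cvg vtp Bv) (hSigma_pd vtp Bv)).
- exact: (information_equality hTheta hf hscore hpi_meas hpi hn hU_meas hB
    (hM_rank vtp Bv) hV_fin (hV_cvg vtp Bv) hSigma_fin (hSigma_pd vtp Bv) hpilot_meas
    hpilot_cvg erefl erefl Vc (fun N => hSigmaN_cont N vtp Bv)).
Qed.
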